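(* Let $a,b\in C^0[0,1]$ with $\frac ba\in L^1(0,1)$, let $a$ be weakly degenerate at $0$, or strongly degenerate at $0$ with $K=1$. Let $M:=\frac{\|b\|_{L^\infty(0,1)}}{a(1)}$ and suppose that $K<2-2M$ (and so $M<1$). If $$T>\frac{1}{2-K-2M}\,8\max\left\{1,\frac{1}{a(1)},\frac{K\max_{[0,1]}\eta}{a(1)\min_{[0,1]}\eta}\right\},$$ then the problem $$\begin{cases}y_{tt}-ay_{xx}-by_x=0,&(t,x)\in(0,+\infty)\times(0,1),\\ y(t,1)=y(t,0)=0,&t\in(0,+\infty),\\ y(0,x)=y_0(x),\quad y_t(0,x)=y_1(x),&x\in(0,1),\end{cases}$$ is observable in time $T$ via the normal derivative at $x=1$. Moreover $$\frac{1}{\eta(1)}\left(T(2-K-2M)-8\max\left\{1,\frac1{a(1)},\frac{K\max_{[0,1]}\eta}{a(1)\min_{[0,1]}\eta}\right\}\right)\le C_T.$$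
   Context: Degeneracy. $a$ is weakly degenerate at $0$ if $a\in C^0[0,1]\cap C^1(0,1]$, $a(0)=0$, $a>0$ on $(0,1]$ and $K:=\sup_{x\in(0,1]}\frac{x|a'(x)|}{a(x)}\in(0,1)$. $a$ is strongly degenerate at $0$ if $a\in C^1[0,1]$, $a(0)=0$, $a>0$ on $(0,1]$ and $K:=\sup_{x\in(0,1]}\frac{x|a'(x)|}{a(x)}\in[1,2)$. $K$ always denotes this supremum. Weights and spaces. $\eta(x):=\exp\left\{\int_{1/2}^x\frac{b(s)}{a(s)}ds\right\}$, $\sigma:=a\eta^{-1}$, $Ay:=ay''+by'=\sigma(\eta y')'$. $L^2_{\frac1\sigma}(0,1)=\{u\in L^2(0,1):\int_0^1\frac{u^2}{\sigma}dx<\infty\}$ with inner product $\int_0^1\frac{uv}{\sigma}dx$; $H^1_{\frac1\sigma}(0,1)=L^2_{\frac1\sigma}(0,1)\cap H^1_0(0,1)$ with inner product $\int_0^1\frac{uv}{\sigma}dx+\int_0^1u'v'dx$; $D(A)=H^2_{\frac1\sigma}(0,1)=\{u\in H^1_{\frac1\sigma}(0,1):Au\in L^2_{\frac1\sigma}(0,1)\}$; $\mathcal H_0=H^1_{\frac1\sigma}(0,1)\times L^2_{\frac1\sigma}(0,1)$ with norm $\|(u,v)\|^2_{\mathcal H_0}=\int_0^1\eta(u')^2dx+\int_0^1\frac{v^2}{\sigma}dx$. Solutions. For $(y_0,y_1)\in\mathcal H_0$, the mild solution is the function $y\in C^1([0,+\infty);L^2_{\frac1\sigma}(0,1))\cap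 C([0,+\infty);H^1_{\frac1\sigma}(0,1))$ with $y(0)=y_0$ and, for all $t\ge0$, $\int_0^ty(s)ds\in D(A)$ and $y_t(t)=y_1+A\int_0^ty(s)ds$. It is classical when $(y_0,y_1)\in H^2_{\frac1\sigma}(0,1)\times H^1_{\frac1\sigma}(0,1)$. For a mild solution, the trace $y_x(\cdot,1)\in L^2(0,T)$ is the $L^2(0,T)$-limit of the traces $y^n_x(\cdot,1)$ of classical solutions $y^n$ whose initial data converge in $\mathcal H_0$ to those of $y$. Energy: $E_y(t)=\frac12\int_0^1\left(\frac1\sigma y_t^2(t,x)+\eta y_x^2(t,x)\right)dx$. Observability: the problem is observable in time $T>0$ via the normal derivative at $x=1$ if there is a constant $C>0$ such that for any $(y_0,y_1)\in\mathcal H_0$ the mild solution satisfies $CE_y(0)\le\int_0^Ty_x^2(t,1)dt$. $C_T$ denotes the supremum of all such constants $C>0$; equivalently, $C_T=\inf_{(y_0,y_1)\ne(0,0)}\frac{\int_0^Ty_x^2(t,1)dt}{E_y(0)}$. *)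

(* Defs.v *)
From HB Require Import structures.
From mathcomp Require Import all_boot all_order all_algebra.
From mathcomp Require Import all_classical all_reals all_analysis.
Import Order.TTheory GRing.Theory Num.Theory.
Import numFieldNormedType.Exports.

Set Implicit Arguments.
Unset Strict Implicit.
Unset Printing Implicit Defensive.

Local Open Scope classical_set_scope.
Local Open Scope ring_scope.

(* A function on (a subset of) [0,1] is a total function R -> R of which only
   the values on that subset matter; an element of an L^2-type space is any
   representative, and no definition below depends on the choice of it.  A
   function of (t, x) is a curve t |-> y t with y t : R -> R. *)

Local Notation I01 := `]0%R, 1%R[%classic.

Section C1.
Variable R : realType.
Implicit Types (D : set R) (f a : R -> R).

(* One-sided at an endpoint belonging to D, so that values of f outside D are
   irrelevant. *)
Definition diff_quotient f (x : R) : R -> R := fun z => (f z - f x) / (z - x).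

Definition deriv_on D f (x : R) : R :=
  lim (diff_quotient f x @ within D x^').

Definition C1_on D f : Prop :=
  (forall x, D x -> cvg (diff_quotient f x @ within D x^')) /\
  {within D, continuous (deriv_on D f)}.

(* The supremum K, in \bar R since it may a priori be infinite. *)
Definition degK a : \bar R :=
  ereal_sup [set (x * `|deriv_on `]0, 1] a x| / a x)%:E | x in `]0, 1]].

Definition weakly_degenerate a : Prop :=
  [/\ {within `[0, 1], continuous a}, C1_on `]0, 1] a, a 0 = 0,
      (forall x, x \in `]0, 1] -> 0 < a x) & (0 < degK a < 1)%E].

Definition strongly_degenerate a : Prop :=
  [/\ C1_on `[0, 1] a, a 0 = 0,
      (forall x, x \in `]0, 1] -> 0 < a x) & (1 <= degK a < 2%:E)%E].

End C1.

Section Sobolev.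
Variable R : realType.
Local Notation mu := (@lebesgue_measure R).
Implicit Types (u g phi : R -> R).

Definition L2_on (D : set R) u : Prop :=
  measurable_fun D u /\ (\int[mu]_(x in D) (u x ^+ 2)%:E < +oo)%E.

(* C_c^oo(0,1) *)
Definition test_fun phi : Prop :=
  (forall n x, derivable (derive1n n phi) x 1) /\
  exists c d : R, [/\ 0 < c, d < 1 & forall x, x \notin `[c, d] -> phi x = 0].

(* L^1_loc(0,1) *)
Definition loc_integrable u : Prop :=
  forall c d : R, 0 < c -> d < 1 -> mu.-integrable `[c, d] (EFin \o u).

Definition weak_deriv u g : Prop :=
  [/\ loc_integrable u, loc_integrable g &
      forall phi, test_fun phi ->
        \int[mu]_(x in I01) (u x * derive1 phi x) =
        - \int[mu]_(x in I01) (g x * phi x)].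

Definition has_weak_deriv u : Prop := exists g, weak_deriv u g.

(* A representative of the weak derivative, unique up to a.e. equality. *)
Definition wderiv u : R -> R := xget 0 [set g | weak_deriv u g].

(* Closure of C_c^oo(0,1) in H^1(0,1). *)
Definition H10 u : Prop :=
  [/\ L2_on I01 u, has_weak_deriv u, L2_on I01 (wderiv u) &
      exists2 phi : nat -> R -> R, forall n, test_fun (phi n) &
        (fun n => \int[mu]_(x in I01)
           ((u x - phi n x) ^+ 2 + (wderiv u x - derive1 (phi n) x) ^+ 2)%:E)%E
        @ \oo --> 0%E].

(* u_x(1) = d: u_x has a representative continuous on (0,1] with value d at 1.
   For u in D(A) there is one, since (eta u')' = Au / sigma is integrable near
   1. *)
Definition normal_deriv_at1 u (d : R) : Prop :=
  exists g, [/\ weak_deriv u g, {within `]0, 1], continuous g} & g 1 = d].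

Definition Linfty_norm (f : R -> R) : R :=
  fine ('N[mu]_+oo%E [EFin \o (f \_ I01)])%E.

End Sobolev.

(* Curves [0,+oo) -> X, for X a space of functions whose squared norm is N. *)
Section Curves.
Variable R : realType.
Variable N : (R -> R) -> \bar R.
Implicit Types (y : R -> R -> R) (v w : R -> R).

Definition curve_continuous y : Prop :=
  forall t, 0 <= t ->
    (fun s => N (fun x => y s x - y t x)) @ within `[0, +oo[ (nbhs t) --> 0%E.

Definition curve_deriv y (t : R) v : Prop :=
  (fun s => N (fun x => (y s x - y t x) / (s - t) - v x))
    @ within `[0, +oo[ t^' --> 0%E.

(* w = \int_0^t y(s) ds, as the limit in X of the tagged Riemann sums. *)
Definition curve_integral y (t : R) w : Prop :=
  forall e : R, 0 < e -> exists2 delta : R, 0 < delta &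
    forall (n : nat) (p xi : nat -> R),
      p 0%N = 0 -> p n = t ->
      (forall i, (i < n)%N ->
         p i <= xi i <= p i.+1 /\ p i.+1 - p i < delta) ->
      (N (fun x => w x - \sum_(i < n) (p i.+1 - p i) * y (xi i) x)%R
        < e%:E)%E.

End Curves.

Section WaveEquation.
Variable R : realType.
Variables a b : R -> R.
Local Notation mu := (@lebesgue_measure R).
Implicit Types (u v w : R -> R) (y : R -> R -> R).

Definition eta (x : R) : R :=
  expR (if 2^-1 <= x then \int[mu]_(s in `[2^-1, x]) (b s / a s)
        else - \int[mu]_(s in `[x, 2^-1]) (b s / a s)).

Definition sigma (x : R) : R := a x / eta x.

Definition max_eta : R := sup [set eta x | x in `[0, 1]].
Definition min_eta : R := inf [set eta x | x in `[0, 1]].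

Definition sqnormL2w u : \bar R :=
  (\int[mu]_(x in I01) (u x ^+ 2 / sigma x)%:E)%E.

Definition L2w u : Prop := L2_on I01 u /\ (sqnormL2w u < +oo)%E.

Definition sqnormH1w u : \bar R :=
  (sqnormL2w u + \int[mu]_(x in I01) (wderiv u x ^+ 2)%:E)%E.

Definition H1w u : Prop := L2w u /\ H10 u.

Definition opA u : R -> R :=
  fun x => sigma x * wderiv (fun z => eta z * wderiv u z) x.

(* D(A) = H^2_{1/sigma}(0,1) *)
Definition domA u : Prop :=
  [/\ H1w u, has_weak_deriv (fun z => eta z * wderiv u z) & L2w (opA u)].

Definition sqnormH0 u v : \bar R :=
  (\int[mu]_(x in I01) (eta x * wderiv u x ^+ 2)%:E +
   \int[mu]_(x in I01) (v x ^+ 2 / sigma x)%:E)%E.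

(* y_t(t), derivative in L^2_{1/sigma}; a representative unique up to a.e.
   equality. *)
Definition time_deriv y (t : R) : R -> R :=
  xget 0 [set v | L2w v /\ curve_deriv sqnormL2w y t v].

(* C^1([0,+oo); L^2_{1/sigma}) *)
Definition C1_L2w y : Prop :=
  [/\ forall t, 0 <= t -> L2w (y t),
      forall t, 0 <= t -> exists v, L2w v /\ curve_deriv sqnormL2w y t v &
      curve_continuous sqnormL2w (time_deriv y)].

(* C([0,+oo); H^1_{1/sigma}) *)
Definition C0_H1w y : Prop :=
  (forall t, 0 <= t -> H1w (y t)) /\ curve_continuous sqnormH1w y.

Definition mild_solution (y0 y1 : R -> R) y : Prop :=
  [/\ H1w y0 /\ L2w y1,
      C1_L2w y /\ C0_H1w y,
      {ae mu, forall x, x \in `]0, 1[ -> y 0 x = y0 x} &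
      forall t, 0 <= t -> exists w,
        [/\ curve_integral sqnormL2w y t w, domA w &
            {ae mu, forall x, x \in `]0, 1[ ->
               time_deriv y t x = y1 x + opA w x}]].

Definition classical_solution (y0 y1 : R -> R) y : Prop :=
  [/\ mild_solution y0 y1 y, domA y0 & H1w y1].

(* tau = y_x(., 1) in L^2(0,T), for the mild solution y with data (y0, y1). *)
Definition normal_trace (T : R) (y0 y1 tau : R -> R) : Prop :=
  L2_on `]0, T[ tau /\
  exists (y0n y1n : nat -> R -> R) (yn : nat -> R -> R -> R)
         (taun : nat -> R -> R),
  [/\ forall n, classical_solution (y0n n) (y1n n) (yn n),
      (fun n => sqnormH0 (fun x => y0n n x - y0 x) (fun x => y1n n x - y1 x))
        @ \oo --> 0%E,
      forall n t, t \in `]0, T[ -> normal_deriv_at1 (yn n t) (taun n t),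
      forall n, L2_on `]0, T[ (taun n) &
      (fun n => \int[mu]_(t in `]0%R, T[) ((taun n t - tau t) ^+ 2)%:E)%E
        @ \oo --> 0%E].

Definition energy y (t : R) : \bar R :=
  ((2^-1)%:E * \int[mu]_(x in I01)
     (time_deriv y t x ^+ 2 / sigma x + eta x * wderiv (y t) x ^+ 2)%:E)%E.

Definition obs_inequality (T C : R) : Prop :=
  forall (y0 y1 : R -> R) y (tau : R -> R),
    mild_solution y0 y1 y -> normal_trace T y0 y1 tau ->
    (C%:E * energy y 0 <= \int[mu]_(t in `]0%R, T[) (tau t ^+ 2)%:E)%E.

Definition observable (T : R) : Prop :=
  0 < T /\ exists2 C : R, 0 < C & obs_inequality T C.

(* C_T, a supremum in \bar R. *)
Definition obs_constant (T : R) : \bar R :=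
  ereal_sup [set C%:E | C in [set C : R | 0 < C /\ obs_inequality T C]].

End WaveEquation.

(* Main.v *)
From HB Require Import structures.
Require Import Defs.
From mathcomp Require Import all_boot all_order all_algebra.
From mathcomp Require Import all_classical all_reals all_analysis.
From mathcomp Require Import measurable_realfun ess_sup_inf.
From mathcomp Require Import ring lra.
Import Order.TTheory GRing.Theory Num.Theory.
Import numFieldNormedType.Exports.
Local Open Scope classical_set_scope.
Local Open Scope ring_scope.

Set Implicit Arguments.
Unset Strict Implicit.
Unset Printing Implicit Defensive.

(** The theorem is proved by the multiplier method.  Let [S] be the inner product
    with weight [1 / sigma], [G z v] the integral of [eta z' v'] and [X f v] that
    of [(x / sigma) f v'], so that [E = S(y_t, y_t) + G(y, y)] is twice the energy,
    which is conserved.  For a regular solution, the functional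
    [F = 2 X(y_t, y) - (K / 2) S(y, y_t)] has derivative
    [F' = 2 X(A y, y) + 2 X(y_t, y_t) - (K / 2) (S(y_t, y_t) - G(y, y))].
    One integration by parts, with [(x / eta)' = (1 - x b / a) / eta] and
    [x |b| / a <= M], gives
    [2 X(A y, y) <= eta(1) y_x(t, 1) ^ 2 - (1 - M) G(y, y)]
    ([trace_exists]); another, with
    [(x / sigma)' = (1 - x a' / a + x b / a) / sigma] and [x |a'| <= K a], gives
    [2 X(y_t, y_t) <= - (1 - M - K) S(y_t, y_t)] ([multiplier_V]).  Hence
    [F' <= eta(1) y_x(t, 1) ^ 2 - (2 - K - 2 M) / 2 E].  Since [K <= 1], the quotient
    [x / a] is nondecreasing, so it is at most [1 / a(1)]; with the Poincare
    inequality this yields [|F| <= (B / 4) E], where [B] is the constant subtracted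
    in the theorem.  Integration over [[0, T]] gives
    [(T (2 - K - 2 M) - B) / 2 E <= eta(1) * int_0^T y_x(t, 1) ^ 2 dt].

    This computation needs solutions with values in the domain of [A], and a mild
    or classical solution is only known to have primitives [w] in time with that
    property.  Therefore it is carried out, in an abstract setting, for the
    difference quotients [(w(t + k) - w t) / k], which are strong solutions
    ([multiplier_inequality]), and [k] is sent to [0].  The point is the convergence
    of the traces.  For regular data the difference quotients of [y] have bounded
    energy ([diffq_energy_bound]), so that [A] applied to the difference quotients
    of [w] is bounded, and then the trace is within [O(sqrt r)] of a mean of the
    flux [eta y_x] over [[1 - r, 1]], which is continuous for the energy norm
    ([trace_uniform]).  Mild solutions are limits of classical ones
    ([mild_observability]).

    The hypotheses of the abstract theorem are verified on test functions and
    extended by density: the Poincare inequality, Green's formula, the inequality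
    for [X(y_t, y_t)] and the lower semicontinuity of the energy norm, which is what
    places integrals in time, defined by limits in [L^2], in the energy space.
    For [z] in the domain of [A] the flux [eta z'] is absolutely continuous away from
    [0] by the lemma of du Bois-Reymond ([weak_deriv_primitive]), which gives the
    trace a meaning and allows the integration by parts ([ac_on_mul]). *)

(** * Integrable real functions *)

Section RealIntegrable.
Context {R : realType}.
Local Notation mu := (@lebesgue_measure R).
Implicit Types (f g h : R -> R) (D : set R).

Lemma ae_imp (P Q : R -> Prop) : (forall x, P x -> Q x) ->
  {ae mu, forall x, P x} -> {ae mu, forall x, Q x}.
Proof. by move=> PQ; apply: (@filterS _ _ (ae_filter_ringOfSetsType mu)). Qed.

(** Every function that is integrated below is real valued, and this notion keeps
    extended reals out of the computations. *)
Definition itg D f : Prop := mu.-integrable D (EFin \o f).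

Lemma itg_meas D f : itg D f -> measurable_fun D f.
Proof. by move=> /integrableP[/measurable_EFinP]. Qed.

Lemma itg_eq D f g : measurable D -> (forall x, D x -> f x = g x) -> itg D f -> itg D g.
Proof.
move=> mD fg; apply: eq_integrable => // x /set_mem Dx.
by rewrite /= fg.
Qed.

Lemma itgD D f g : measurable D -> itg D f -> itg D g -> itg D (fun x => f x + g x).
Proof.
by move=> mD hf hg; exact: (@integrableD _ _ _ mu D mD (EFin \o f) (EFin \o g)).
Qed.

Lemma itgZ D c f : measurable D -> itg D f -> itg D (fun x => c * f x).
Proof. by move=> mD hf; exact: (@integrableZl _ _ _ mu D mD c (EFin \o f)). Qed.

Lemma itgN D f : measurable D -> itg D f -> itg D (fun x => - f x).
Proof.
by move=> mD hf; have := itgZ (-1) mD hf; apply: itg_eq => // x _; rewrite mulN1r.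
Qed.

Lemma itgB D f g : measurable D -> itg D f -> itg D g -> itg D (fun x => f x - g x).
Proof. by move=> mD hf hg; apply: itgD => //; exact: itgN. Qed.

Lemma itg_le D f g : measurable D -> measurable_fun D f ->
  (forall x, D x -> `|f x| <= g x) -> itg D g -> itg D f.
Proof.
move=> mD mf fg hg; apply: (@le_integrable _ _ _ mu D _ _ (EFin \o g)) => //; first exact/measurable_EFinP.
move=> x Dx /=; rewrite lee_fin (le_trans (fg x Dx))//; exact: ler_norm.
Qed.

Lemma itg_norm D f : measurable D -> itg D f -> itg D (fun x => `|f x|).
Proof.
move=> mD hf; apply: (@le_integrable _ _ _ mu D _ _ (EFin \o f)) => //.
  by apply/measurable_EFinP; apply: measurableT_comp => //; exact: itg_meas.
by move=> x _ /=; rewrite normr_id.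
Qed.

Lemma itgS (D E : set R) f : measurable E -> measurable D -> D `<=` E -> itg E f -> itg D f.
Proof. by move=> mE mD DE hf; apply: (@integrableS _ _ _ mu E). Qed.

Lemma itg_cont (c d : R) f : {within `[c, d], continuous f} -> itg `[c, d] f.
Proof.
by move=> cf; apply: continuous_compact_integrable => //; exact: segment_compact.
Qed.

Lemma itg_cst (c d k : R) : itg `[c, d] (fun=> k).
Proof. by apply: itg_cont; apply: continuous_subspaceT => x; exact: cst_continuous. Qed.

Lemma itg_cst_oo (c d k : R) : itg `]c, d[ (fun=> k).
Proof.
by apply: (itgS (E := `[c, d]%classic)) => //; [exact: subset_itv_oo_cc|exact: itg_cst].
Qed.

Lemma itg_mul_bounded D f g k : measurable D -> measurable_fun D f ->
  (forall x, D x -> `|f x| <= k) -> itg D g -> itg D (fun x => f x * g x).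
Proof.
move=> mD mf fk hg; apply: (itg_le (g := fun x => k * `|g x|)) => //.
- by apply: measurable_funM => //; exact: itg_meas.
- by move=> x Dx; rewrite normrM ler_wpM2r// fk.
- by apply: itgZ => //; exact: itg_norm.
Qed.

Lemma itg_ae_eq D f g : measurable D -> {ae mu, forall x, D x -> f x = g x} ->
  itg D f -> itg D g -> \int[mu]_(x in D) f x = \int[mu]_(x in D) g x.
Proof.
move=> mD fg hf hg; congr fine; apply: ae_eq_integral => //.
- by case/integrableP: hf.
- by case/integrableP: hg.
- apply: ae_imp fg => x h Dx; by rewrite h.
Qed.

Lemma itg_ge0_lty D f : measurable D -> measurable_fun D f -> (forall x, D x -> 0 <= f x) ->
  itg D f <-> (\int[mu]_(x in D) (f x)%:E < +oo)%E.
Proof.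
move=> mD mf f0.
have e : (\int[mu]_(x in D) `|(EFin \o f) x| = \int[mu]_(x in D) (f x)%:E)%E.
  by apply: eq_integral => x /set_mem Dx; rewrite /= ger0_norm// f0.
split; first by move=> /integrableP[_]; rewrite e.
by move=> h; apply/integrableP; split; [exact/measurable_EFinP|rewrite e].
Qed.

Lemma EFin_Rintegral D f : measurable D -> itg D f ->
  (\int[mu]_(x in D) (f x)%:E)%E = (\int[mu]_(x in D) f x)%:E.
Proof. by move=> mD hf; rewrite fineK//; apply: integrable_fin_num. Qed.

Lemma Rint_itv_oo_cc (c d : R) f : itg `[c, d] f ->
  \int[mu]_(x in `]c, d[) f x = \int[mu]_(x in `[c, d]) f x.
Proof.
move=> hf; rewrite -[RHS]Rintegral_itv_obnd_cbnd; last first.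
  by apply: itgS hf => //; exact: subset_itv_oc_cc.
by rewrite Rintegral_itv_bndo_bndc//; apply: itgS hf => //; exact: subset_itv_oo_cc.
Qed.

Lemma Rint_itv_cat (c d e : R) f : c <= d -> d <= e -> itg `[c, e] f ->
  \int[mu]_(x in `[c, e]) f x = \int[mu]_(x in `[c, d]) f x + \int[mu]_(x in `[d, e]) f x.
Proof.
move=> cd de hf.
have := @Rintegral_itvB R f (BLeft c) (BRight e) d hf.
rewrite !bnd_simp => /(_ cd de) h.
rewrite -(Rintegral_itv_obnd_cbnd (r := d)).
  by rewrite -h addrC subrK.
by apply: itgS hf => // x /=; rewrite !in_itv/= => /andP[dx ->]; rewrite andbT (le_trans cd)// ltW.
Qed.

Lemma Rint_restrict (D E : set R) f : measurable D -> measurable E -> E `<=` D ->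
  (forall x, D x -> ~ E x -> f x = 0) ->
  \int[mu]_(x in D) f x = \int[mu]_(x in E) f x.
Proof.
move=> mD mE ED f0; rewrite -(setIidr ED) Rintegral_mkcondr; apply: eq_Rintegral.
by move=> x /set_mem Dx; rewrite patchE; case: ifPn => // /negP xE; apply: f0 => // /mem_set.
Qed.

Lemma itg_oo_cc (c d : R) f : itg `]c, d[ f -> itg `[c, d] f.
Proof.
move=> /integrableP[mf foo]; move/measurable_EFinP : (mf) => mf'.
have mf1 := measurable_fun_itv_cc mf'.
have mf2 : measurable_fun `]c, d] f by apply: (measurable_fun_itv_oc mf').
apply/integrableP; split; first exact/measurable_EFinP.
rewrite -integral_itv_obnd_cbnd; last first.
  by apply/measurable_EFinP; apply: measurableT_comp.
rewrite -integral_itv_bndo_bndc//.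
by apply/measurable_EFinP; apply: measurableT_comp.
Qed.

Lemma Rint_cst_cc (c d k : R) : c <= d -> \int[mu]_(x in `[c, d]) k = k * (d - c).
Proof.
move=> cd; rewrite Rintegral_cst//.
rewrite [X in _ * fine X](lebesgue_measure_itv `[c, d]) /= lte_fin.
have [//|dc] := ltP c d.
by have -> : c = d by [apply/eqP; rewrite eq_le cd|]; rewrite subrr !mulr0.
Qed.

Lemma Rint_cst_oo (c d k : R) : c <= d -> \int[mu]_(x in `]c, d[) k = k * (d - c).
Proof.
by move=> cd; rewrite Rint_itv_oo_cc ?Rint_cst_cc//; exact: itg_cst.
Qed.

End RealIntegrable.

(** Closes the density arguments, whose error terms are multiples of [e]. *)
Lemma le_addeps {R : realType} (x y c : R) : 0 <= c -> (forall e, 0 < e -> x <= y + c * e) -> x <= y.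
Proof.
move=> c0 h; apply/ler_addgt0Pl => e e0.
have := h (e / (c + 1)) (divr_gt0 e0 (ltr_wpDl c0 ltr01)) => /le_trans; apply.
by rewrite addrC lerD2r mulrCA ler_piMr ?(ltW e0)// ler_pdivrMr ?ltr_wpDl// mul1r lerDl.
Qed.

(** * Absolutely continuous functions *)

Section AbsolutelyContinuous.
Context {R : realType}.
Local Notation mu := (@lebesgue_measure R).
Implicit Types (u v p q : R -> R) (x y z s lo hi e d k : R).

(** Real induction: the supremum of the [y] with [Q lo y] is [hi], since the local
    hypothesis allows a step across it.  This takes the place of a partition into
    short subintervals. *)
Lemma interval_induction (Q : R -> R -> Prop) lo hi : lo <= hi ->
  (forall y z, Q lo y -> Q y z -> Q lo z) ->
  (forall x, lo <= x <= hi -> exists2 d, 0 < d & forall y z, lo <= y -> y <= x -> x <= z -> z <= hi ->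
     x - d < y -> z < x + d -> Q y z) -> Q lo hi.
Proof.
move=> lh tr loc; pose E := [set y | lo <= y <= hi /\ Q lo y].
have Elo : E lo.
  split; first by rewrite lexx.
  have [|d d0 h] := loc lo; first by rewrite lexx.
  by apply: h => //; rewrite ?ltrBlDr ?ltrDl.
have Eub y : E y -> y <= hi by move=> [/andP[]].
have supE : has_sup E by split; [exists lo|exists hi => y /Eub].
pose s := sup E.
have slo : lo <= s by apply: ub_le_sup => //; case: supE.
have shi : s <= hi by apply: ge_sup => //; exists lo.
have [|d d0 h] := loc s; first by rewrite slo.
have [y [/andP[ly yh] Qy] sy] := sup_adherent d0 supE; rewrite -/s in sy.
have ys : y <= s by apply: ub_le_sup; [case: supE|split; rewrite ?ly].
pose z := Num.min hi (s + d / 2).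
have sz : s <= z by rewrite le_min shi lerDl divr_ge0// ltW.
have zh : z <= hi by rewrite ge_min lexx.
have zd : z < s + d.
  by rewrite (@le_lt_trans _ _ (s + d / 2)) ?ge_min ?lexx ?orbT//; lra.
have Qz := tr _ _ Qy (h y z ly ys sz zh sy zd).
have Ez : E z by split=> //; rewrite zh andbT (le_trans slo).
have zs : z <= s by apply: ub_le_sup => //; case: supE.
suff <- : z = hi by [].
have : (z == hi) || (z == s + d / 2) by rewrite /z; case: ltP => _; rewrite eqxx ?orbT.
by case/orP => /eqP // e; exfalso; lra.
Qed.

(** [u] is an indefinite integral of [p] on [[lo, hi]]; [p] is only integrable,
    since the flux of a function of the domain of the operator has no better
    derivative. *)
Definition ac_on lo hi u p := itg `[lo, hi] p /\
  forall x y, lo <= x -> x <= y -> y <= hi -> u y - u x = \int[mu]_(s in `[x, y]) p s.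

Lemma ac_on_continuous lo hi u p : lo <= hi -> ac_on lo hi u p -> {within `[lo, hi], continuous u}.
Proof.
move=> lh [ip up].
have /subspace_continuousP h := parameterized_integral_continuous lh ip.
apply/subspace_continuousP => x xlh.
have e z : z \in `[lo, hi]%classic -> u lo + \int[mu]_(s in `[lo, z]) p s = u z.
  by move=> /set_mem; rewrite /= in_itv/= => /andP[lz zh]; rewrite -up// addrC subrK.
have hx : u lo + \int[mu]_(s in `[lo, z]) p s @[z --> within `[lo, hi] (nbhs x)] -->
    u lo + \int[mu]_(s in `[lo, x]) p s.
  by apply: cvgD; [exact: cvg_cst|exact: (h x xlh)].
rewrite e ?inE// in hx; apply: cvg_trans hx; apply: near_eq_cvg.
by rewrite near_withinE; apply: nearW => z zlh; rewrite e// inE.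
Qed.

Lemma ac_on_bounded lo hi u p : lo <= hi -> ac_on lo hi u p ->
  exists k, forall s, `[lo, hi]%classic s -> `|u s| <= k.
Proof.
move=> lh au; have cu := ac_on_continuous lh au.
have cn : {within `[lo, hi], continuous (fun s => `|u s|)}.
  by move=> s; apply: continuous_comp; [exact: cu|exact: norm_continuous].
have [s _ hs] := EVT_max lh cn; exists `|u s| => x xlh; exact: hs.
Qed.

Lemma ac_on_itg_mul lo hi u p q : lo <= hi -> ac_on lo hi u p -> itg `[lo, hi] q ->
  itg `[lo, hi] (fun s => u s * q s).
Proof.
move=> lh au iq; have [k hk] := ac_on_bounded lh au.
apply: itg_mul_bounded hk iq => //.
by apply: subspace_continuous_measurable_fun => //; exact: ac_on_continuous au.
Qed.

Lemma ac_on_near lo hi u p x e : lo <= hi -> ac_on lo hi u p -> lo <= x <= hi -> 0 < e ->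
  exists2 d, 0 < d & forall s, lo <= s <= hi -> `|s - x| < d -> `|u s - u x| < e.
Proof.
move=> lh au xlh e0.
have /subspace_continuousP/(_ x) := ac_on_continuous lh au.
have xlh' : x \in `[lo, hi] by rewrite in_itv.
move=> /(_ xlh') /cvgrPdist_lt /(_ e e0) [d /= d0 hd]; exists d => // s slh sd.
by rewrite distrC; apply: hd; rewrite /= ?in_itv//= distrC.
Qed.

(** On a short interval [[y, z]] the increment of [u v] is the integral of
    [v z p + u y q], which differs from that of [v p + u q] by at most [e] times
    the integral of [|p| + |q|].  These errors add up along adjacent intervals,
    so [interval_induction] bounds the total error by [e] times a constant. *)
Lemma ac_on_mul lo hi u v p q : lo <= hi -> ac_on lo hi u p -> ac_on lo hi v q ->
  u hi * v hi - u lo * v lo = \int[mu]_(s in `[lo, hi]) (v s * p s + u s * q s).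
Proof.
move=> lh au av; have [ip up] := au; have [iq vq] := av.
have ivp := ac_on_itg_mul lh av ip; have iuq := ac_on_itg_mul lh au iq.
have imain := itgD (measurable_itv _) ivp iuq.
have im := itgD (measurable_itv _) (itg_norm (measurable_itv _) ip) (itg_norm (measurable_itv _) iq).
have sub y z : lo <= y -> z <= hi -> `[y, z]%classic `<=` `[lo, hi]%classic.
  move=> ly zh s /=; rewrite !in_itv/= => /andP[ys sz].
  by rewrite (le_trans ly ys) (le_trans sz zh).
set F := fun s => v s * p s + u s * q s in imain *.
set m := fun s => `|p s| + `|q s| in im.
pose N := \int[mu]_(s in `[lo, hi]) m s.
have m0 (A : set R) : 0 <= \int[mu]_(s in A) m s.
  by apply: Rintegral_ge0 => s _; rewrite addr_ge0.
apply/eqP; rewrite -subr_eq0 -normr_le0; apply: (le_addeps (c := N)); first exact: m0.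
move=> e e0; rewrite add0r (mulrC N).
suff [//] : hi <= hi /\ `|u hi * v hi - u lo * v lo - \int[mu]_(s in `[lo, hi]) F s| <=
   e * \int[mu]_(s in `[lo, hi]) m s.
pose Q y z := lo <= y -> y <= z /\ (z <= hi -> `|u z * v z - u y * v y - \int[mu]_(s in `[y, z]) F s| <=
   e * \int[mu]_(s in `[y, z]) m s).
suff : Q lo hi by move=> /(_ (lexx _)) [_ h]; split=> //; exact: h.
apply: interval_induction => //.
  move=> y z Q1 Q2 _; have [ly h1] := Q1 (lexx _); have [yz h2] := Q2 ly.
  split; [exact: le_trans yz|move=> zh].
  have {}h1 := h1 (le_trans yz zh); have {}h2 := h2 zh.
  have iz f : itg `[lo, hi] f -> itg `[lo, z] f by apply: itgS => //; exact: sub.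
  rewrite (Rint_itv_cat ly yz (iz _ imain)) (Rint_itv_cat ly yz (iz _ im)) mulrDr.
  set I1 := \int[mu]_(s in `[lo, y]) F s in h1 *; set I2 := \int[mu]_(s in `[y, z]) F s in h2 *.
  have -> : u z * v z - u lo * v lo - (I1 + I2) =
    (u y * v y - u lo * v lo - I1) + (u z * v z - u y * v y - I2) by ring.
  exact: le_trans (ler_normD _ _) (lerD h1 h2).
move=> x xlh; have e2 : 0 < e / 2 by rewrite divr_gt0.
have [d1 d10 hu] := ac_on_near lh au xlh e2.
have [d2 d20 hv] := ac_on_near lh av xlh e2.
exists (Num.min d1 d2); first by rewrite lt_min d10.
move=> y z ly yx xz zh xy zx _; split; first exact: le_trans xz.
move=> _; have yz := le_trans yx xz.
have near s : y <= s <= z -> lo <= s <= hi /\ `|s - x| < Num.min d1 d2.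
  move=> /andP[ys sz]; rewrite (le_trans ly ys) (le_trans sz zh); split=> //.
  rewrite ltr_norml; apply/andP; split; lra.
have {}hu s : y <= s <= z -> `|u s - u x| < e / 2.
  by move=> /near [h1 h2]; apply: hu => //; apply: lt_le_trans h2 _; rewrite ge_min lexx.
have {}hv s : y <= s <= z -> `|v s - v x| < e / 2.
  by move=> /near [h1 h2]; apply: hv => //; apply: lt_le_trans h2 _; rewrite ge_min lexx orbT.
have iyz f : itg `[lo, hi] f -> itg `[y, z] f by apply: itgS => //; exact: sub.
have i1 := itgZ (v z) (measurable_itv _) (iyz _ ip).
have i2 := itgZ (u y) (measurable_itv _) (iyz _ iq).
have i3 := itgD (measurable_itv _) i1 i2.
have e1 : u z * v z - u y * v y = \int[mu]_(s in `[y, z]) (v z * p s + u y * q s).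
  rewrite RintegralD// RintegralZl//; last exact: iyz.
  by rewrite RintegralZl//; [rewrite -up// -vq//; ring|exact: iyz].
have iF := iyz _ imain.
rewrite e1 -RintegralB// -RintegralZl//; last exact: iyz.
apply: le_trans (le_normr_Rintegral _ _) _ => //; first exact: itgB.
apply: le_Rintegral.
- by [].
- by apply: itg_norm => //; exact: itgB.
- by apply: itgZ => //; exact: iyz.
move=> s /=; rewrite in_itv/= => syz.
have yyz : y <= y <= z by rewrite lexx.
have zyz : y <= z <= z by rewrite lexx andbT.
have -> : v z * p s + u y * q s - F s = (v z - v s) * p s + (u y - u s) * q s by rewrite /F; ring.
have b1 : `|v z - v s| <= e.
  have := hv z zyz; have := hv s syz; rewrite distrC => h1 h2.
  have := ler_normD (v z - v x) (v x - v s); rewrite subrKA => h3.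
  by apply: le_trans h3 _; lra.
have b2 : `|u y - u s| <= e.
  have := hu y yyz; have := hu s syz; rewrite distrC => h1 h2.
  have := ler_normD (u y - u x) (u x - u s); rewrite subrKA => h3.
  by apply: le_trans h3 _; lra.
apply: le_trans (ler_normD _ _) _; rewrite !normrM /m mulrDr.
by apply: lerD; rewrite ler_wpM2r.
Qed.

Lemma ac_onS lo hi lo' hi' u p : lo <= lo' -> hi' <= hi -> ac_on lo hi u p -> ac_on lo' hi' u p.
Proof.
move=> ll hh [ip up]; split.
  apply: itgS ip => // s /=; rewrite !in_itv/= => /andP[ys sz].
  by rewrite (le_trans ll ys) (le_trans sz hh).
by move=> x y lx xy yh; apply: up => //; [exact: le_trans lx|exact: le_trans hh].
Qed.

Lemma ac_on_prod lo hi u v p q : lo <= hi -> ac_on lo hi u p -> ac_on lo hi v q ->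
  ac_on lo hi (fun s => u s * v s) (fun s => v s * p s + u s * q s).
Proof.
move=> lh au av; have [ip _] := au; have [iq _] := av; split.
  exact: itgD (measurable_itv _) (ac_on_itg_mul lh av ip) (ac_on_itg_mul lh au iq).
by move=> x y lx xy yh; apply: ac_on_mul => //; exact: ac_onS lx yh _.
Qed.

Lemma ac_on_C1 lo hi u p : {within `[lo, hi], continuous u} -> {within `[lo, hi], continuous p} ->
  (forall x, lo < x < hi -> is_derive x 1 u (p x)) -> ac_on lo hi u p.
Proof.
move=> cu cp du; split; first exact: itg_cont.
move=> x y lx; rewrite le_eqVlt => /predU1P[<- _|xy yh].
  by rewrite subrr (_ : `[x, x]%classic = [set x]) ?Rintegral_set1// set_itv1.
have sub : `[x, y]%classic `<=` `[lo, hi]%classic.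
  move=> s /=; rewrite !in_itv/= => /andP[ys sz].
  by rewrite (le_trans lx ys) (le_trans sz yh).
have cu' := continuous_subspaceW sub cu; have cp' := continuous_subspaceW sub cp.
have du' s : s \in `]x, y[ -> is_derive s 1 u (p s).
  by rewrite in_itv/= => /andP[xs sy]; apply: du; rewrite (le_lt_trans lx xs) (lt_le_trans sy yh).
rewrite /Rintegral (@continuous_FTC2 _ p u)//.
- have [h1 h2 h3] := (continuous_within_itvP u xy).1 cu'.
  by split=> // s /du' [].
- by move=> s /du' h; rewrite derive1E; case: h.
Qed.

End AbsolutelyContinuous.

(** * A smooth step *)

Section Smooth.
Context {R : realType}.
Implicit Types (f g : R -> R) (p q : {poly R}).

(** Smoothness as a recursive predicate, which products and quotients preserve by
    induction; [Cn_derive1n] relates it to iterated derivatives. *)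
Fixpoint Cn (n : nat) f : Prop :=
  if n is m.+1 then (forall x : R, derivable f x (1:R)) /\ Cn m (derive1 f) else True.

Lemma derive1n_shift n f : derive1n n.+1 f = derive1n n (derive1 f).
Proof. by elim: n => // n IH; rewrite derive1nS IH derive1nS. Qed.

Lemma Cn_derive1n f : (forall n, Cn n f) <-> (forall n x, derivable (derive1n n f) x 1).
Proof.
split=> [Cf n x|df n].
  elim: n f Cf => [|n IH] f Cf; first by case: (Cf 1%N).
  by rewrite derive1n_shift; apply: IH => m; case: (Cf m.+1).
elim: n f df => // n IH f df; split; first exact: (df 0%N).
by apply: IH => m x; rewrite -derive1n_shift.
Qed.

Lemma CnW n f : Cn n.+1 f -> Cn n f.
Proof. by elim: n f => // n IH f [df Cf]; split=> //; exact: IH. Qed.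

Lemma is_derive_derive1 f g : (forall x : R, is_derive x 1 f (g x)) -> derive1 f = g.
Proof. by move=> fg; apply/funext => x; rewrite derive1E; case: (fg x). Qed.

Lemma derivable_is_derive f x : derivable f x 1 -> is_derive x 1 f (derive1 f x).
Proof. by move=> df; apply: DeriveDef => //; rewrite derive1E. Qed.

Lemma CnS n f g : (forall x : R, is_derive x 1 f (g x)) -> Cn n g -> Cn n.+1 f.
Proof.
move=> fg Cg; split=> [x|]; first by case: (fg x).
by rewrite (is_derive_derive1 fg).
Qed.

Lemma Cn_cst n (k : R) : Cn n (cst k).
Proof. by elim: n k => // n IH k; apply: (@CnS n _ (cst 0)). Qed.

Lemma CnD n f g : Cn n f -> Cn n g -> Cn n (f \+ g).
Proof.
elim: n f g => // n IH f g [df Cf] [dg Cg].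
apply: (@CnS n _ (derive1 f \+ derive1 g)) => [x|]; last exact: IH.
by apply: is_deriveD; apply: derivable_is_derive.
Qed.

Lemma CnM n f g : Cn n f -> Cn n g -> Cn n (f \* g).
Proof.
elim: n f g => // n IH f g Cf Cg.
have [[df Cf'] [dg Cg']] := (Cf, Cg).
apply: (@CnS n _ ((f \* derive1 g) \+ (g \* derive1 f))) => [x|].
  by apply: is_deriveM; apply: derivable_is_derive.
by apply: CnD; apply: IH => //; exact: CnW.
Qed.

Lemma CnV n f : (forall x, f x != 0) -> Cn n f -> Cn n (fun x => (f x)^-1).
Proof.
move=> f0; elim: n => // n IH Cf; have [df Cf'] := Cf.
pose h := (fun x => (f x)^-1).
apply: (@CnS n _ ((cst (-1)) \* ((h \* h) \* derive1 f))) => [x|].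
  have h1 := is_deriveV (f0 x) (derivable_is_derive (df x)).
  apply: (is_derive_eq h1); rewrite /h /= /GRing.scale /=.
  by rewrite mulN1r mulNr -exprVn expr2.
apply: CnM; first exact: Cn_cst.
by apply: CnM => //; apply: CnM; apply: IH; exact: CnW.
Qed.

Lemma Cn_affine n f (k c : R) : Cn n f -> Cn n (fun x => f (k * x + c)).
Proof.
elim: n f => // n IH f [df Cf].
apply: (@CnS n _ (cst k \* (fun x => derive1 f (k * x + c)))) => [x|]; last first.
  by apply: CnM; [exact: Cn_cst|exact: IH].
have h1 : is_derive x 1 (fun x => k * x + c) k.
  have -> : (fun x => k * x + c) = (k \*: (id : R -> R)) + cst c by [].
  by apply: is_derive_eq; rewrite addr0 /GRing.scale /= mulr1.
have h2 : is_derive (k * x + c) 1 f (derive1 f (k * x + c)).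
  exact: derivable_is_derive.
have := @is_derive1_comp _ f (fun x => k * x + c) x _ k h2 h1.
by rewrite mulrC.
Qed.

(** Polynomial growth is dominated by the exponential because
    [u ^+ n <= n ^ n (1 + u / n) ^+ n]. *)
Lemma horner_le_expR p : exists2 C : R, 0 <= C & forall u, 0 <= u -> `|p.[u]| <= C * expR u.
Proof.
exists (\sum_(i < size p) `|p`_i| * (i.+1%:R ^+ i)).
  by apply: sumr_ge0 => i _; rewrite mulr_ge0.
move=> u u0; rewrite horner_coef (le_trans (ler_norm_sum _ _ _))//.
rewrite mulr_suml; apply: ler_sum => i _.
rewrite normrM -mulrA ler_wpM2l// ger0_norm ?exprn_ge0//.
have i0 : 0 < i.+1%:R :> R by rewrite ltr0n.
have -> : u = i.+1%:R * (u / i.+1%:R) by rewrite mulrCA divff ?mulr1// gt_eqF.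
set v := u / _; have v0 : 0 <= v by rewrite divr_ge0// ltW.
have vE : v <= expR v by rewrite (le_trans _ (expR_ge1Dx v))// lerDr.
rewrite exprMn ler_wpM2l ?exprn_ge0//.
rewrite mulrC expRM_natr (le_trans (y := expR v ^+ i))//.
  by rewrite lerXn2r// nnegrE ?expR_ge0.
by rewrite ler_weXn2l// (le_trans _ (expR_ge1Dx v))// lerDl.
Qed.

(** The functions [x |-> p (1/x) exp (-1/x)] on the positive axis, extended by
    [0]: this family is stable under derivation, hence consists of smooth
    functions. *)
Definition flat p : R -> R := fun x => if 0 < x then p.[x^-1] * expR (- x^-1) else 0.

Lemma flat_quadratic p : exists2 C : R, 0 <= C & forall x, `|flat p x| <= C * x ^+ 2.
Proof.
have [C C0 pC] := horner_le_expR (p * 'X^2); exists C => // x.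
rewrite /flat; case: ifPn => [x0|_]; last by rewrite normr0 mulr_ge0// sqr_ge0.
have xi0 : 0 < x^-1 by rewrite invr_gt0.
have := pC _ (ltW xi0); rewrite hornerM hornerXn normrM.
rewrite (ger0_norm (exprn_ge0 _ (ltW xi0))) => h.
rewrite normrM (ger0_norm (expR_ge0 _)) expRN.
rewrite ler_pdivrMr ?expR_gt0// -[X in _ <= X]mulrAC -ler_pdivrMr ?exprn_gt0//.
by rewrite -exprVn.
Qed.

Lemma is_derive0_quadratic f (C : R) : (forall x, `|f x| <= C * x ^+ 2) ->
  is_derive (0 : R) 1 f 0.
Proof.
move=> fC.
have f0 : f 0 = 0.
  by apply/eqP; rewrite -normr_le0 (le_trans (fC 0))// expr0n mulr0.
have C0 : 0 <= C by have := fC 1; rewrite expr1n mulr1; apply: le_trans.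
suff h : h^-1 *: (f (h *: 1 + 0) - f 0) @[h --> 0^'] --> (0 : R).
  apply: DeriveDef; first by apply/cvg_ex; exists 0; move: h; under eq_fun do rewrite /GRing.scale/= mulr1 addr0.
  by apply: cvg_lim => //; move: h.
apply/cvgr0Pnorm_le => e e0.
near=> h.
rewrite f0 subr0 addr0 [in f _]/GRing.scale/= mulr1 normrM normfV.
have h0 : 0 < `|h| by rewrite normr_gt0; near: h; exact: nbhs_dnbhs_neq.
rewrite mulrC ler_pdivrMr// (le_trans (fC h))//.
rewrite -normr_id -(real_normK (num_real h)) expr2 normr_id mulrA ler_wpM2r//.
have : `|h| < e / (C + 1).
  near: h; apply: dnbhs0_lt; rewrite divr_gt0// ltr_wpDl//.
rewrite ltr_pdivlMr ?ltr_wpDl// => /ltW; apply: le_trans.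
by rewrite mulrC ler_wpM2l// lerDl.
Unshelve. all: by end_near. Qed.

Lemma is_derive_flat p (x : R) : is_derive x 1 (flat p) (flat ('X^2 * (p - p^`())) x).
Proof.
have [x0|x0|x0] := ltgtP 0 x.
- have -> : flat ('X^2 * (p - p^`())) x =
     (- x ^- 2 * p^`().[x^-1]) * expR (- x^-1) + p.[x^-1] * (x ^- 2 * expR (- x^-1)).
    rewrite /flat x0 hornerM hornerXn hornerD hornerN exprVn; ring.
  pose f1 := fun y : R => p.[y^-1] * expR (- y^-1).
  have xn : x != 0 by rewrite gt_eqF.
  have dV : is_derive x 1 (fun y : R => y^-1) (- x ^- 2).
    have := @is_deriveV _ id x 1 1 xn (is_derive_id _ _).
    by rewrite /GRing.scale/= mulr1.
  have dp : is_derive x 1 (fun y : R => p.[y^-1]) (- x ^- 2 * p^`().[x^-1]).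
    have h : is_derive (x^-1) 1 (horner p) (p^`().[x^-1]) by exact: is_derive_poly.
    have := @is_derive1_comp _ (horner p) (fun y : R => y^-1) x _ _ h dV.
    by rewrite mulrC.
  have dE : is_derive x 1 (fun y : R => expR (- y^-1)) (x ^- 2 * expR (- x^-1)).
    have h : is_derive (- x^-1) 1 (@expR R) (expR (- x^-1)) by exact: is_derive_expR.
    have h1 : is_derive x 1 (fun y : R => - y^-1) (x ^- 2).
      by have := is_deriveN dV; rewrite opprK.
    have := @is_derive1_comp _ (@expR R) (fun y : R => - y^-1) x _ _ h h1.
    by rewrite mulrC.
  have dM : is_derive x 1 f1
     ((- x ^- 2 * p^`().[x^-1]) * expR (- x^-1) + p.[x^-1] * (x ^- 2 * expR (- x^-1))).
    have h := is_deriveM dp dE; apply: (is_derive_eq h).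
    by rewrite /GRing.scale/=; ring.
  apply: near_eq_is_derive dM => //.
  near=> y; rewrite /flat /f1 ifT//; near: y; exact: lt_nbhsr.
- have -> : flat ('X^2 * (p - p^`())) x = 0 by rewrite /flat ltNge (ltW x0).
  have h : is_derive x 1 (cst 0 : R -> R) 0 by exact: is_derive_cst.
  apply: near_eq_is_derive h => //.
  near=> y; rewrite /flat ltNge ltW//; near: y; exact: lt_nbhsl.
- rewrite -x0; have -> : flat ('X^2 * (p - p^`())) 0 = 0 by rewrite /flat ltxx.
  by have [C _ /is_derive0_quadratic] := flat_quadratic p.
Unshelve. all: by end_near. Qed.

Lemma Cn_flat n p : Cn n (flat p).
Proof. elim: n p => // n IH p; exact: CnS (is_derive_flat p) (IH _). Qed.

(** A smooth function equal to [0] before [-1] and to [1] after [1]. *)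
Definition step : R -> R := fun x => flat 1 (1 + x) / (flat 1 (1 + x) + flat 1 (1 - x)).

Lemma flat1_ge0 x : 0 <= flat 1 x.
Proof. by rewrite /flat hornerC mul1r; case: ifP => // _; rewrite expR_ge0. Qed.

Lemma flat1_gt0 x : 0 < x -> 0 < flat 1 x.
Proof. by rewrite /flat hornerC mul1r => ->; rewrite expR_gt0. Qed.

Lemma step_den_gt0 (x : R) : 0 < flat 1 (1 + x) + flat 1 (1 - x).
Proof.
have [x0|x0] := leP 0 x.
  by rewrite ltr_pwDl ?flat1_ge0// flat1_gt0// ltr_wpDr.
by rewrite ltr_wpDl ?flat1_ge0// flat1_gt0// subr_gt0 (lt_trans x0).
Qed.

Lemma Cn_step n : Cn n step.
Proof.
have h (k : R) : Cn n (fun x => flat 1 (1 + k * x)).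
  by under eq_fun do rewrite addrC; apply: Cn_affine; exact: Cn_flat.
have h1 := h 1; have h2 := h (-1).
have -> : step = (fun x => flat 1 (1 + 1 * x)) \*
   (fun x => (((fun x => flat 1 (1 + 1 * x)) \+ (fun x => flat 1 (1 + -1 * x))) x)^-1).
  by apply/funext => x; rewrite /step /= mul1r mulN1r.
apply: CnM => //; apply: CnV; last exact: CnD.
by move=> x; rewrite /= mul1r mulN1r gt_eqF// step_den_gt0.
Qed.

Lemma step_left x : x <= -1 -> step x = 0.
Proof. by move=> x1; rewrite /step /flat ltNge [X in X <= 0]addrC -lerBrDr sub0r x1 mul0r. Qed.

Lemma step_right x : 1 <= x -> step x = 1.
Proof.
move=> x1; rewrite /step [flat _ (1 - x)]/flat ltNge subr_le0 x1 addr0 divff//.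
by rewrite gt_eqF// flat1_gt0// (lt_le_trans ltr01)// lerDl (le_trans ler01).
Qed.

End Smooth.

(** * Signed primitives *)

Section Primitive.
Context {R : realType}.
Local Notation mu := (@lebesgue_measure R).
Local Notation I01 := `]0%R, 1%R[%classic.
Implicit Types (f g h : R -> R) (x c d k m lo hi : R).

Lemma half01 : (0 : R) <= (2^-1 : R) <= 1.
Proof. by rewrite invr_ge0 ler0n/= invf_le1// ler1n. Qed.

(** The base point [1/2] is that of the exponent of [eta], so that
    [eta a b x] is convertible to [expR (primitive _ x)]. *)
Definition primitive g x : R :=
  if 2^-1 <= x then \int[mu]_(s in `[2^-1, x]) g s
  else - \int[mu]_(s in `[x, 2^-1]) g s.

Lemma primitiveB g lo hi c x : lo <= 2^-1 <= hi -> lo <= c -> c <= x -> x <= hi ->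
  itg `[lo, hi] g -> primitive g x - primitive g c = \int[mu]_(s in `[c, x]) g s.
Proof.
move=> /andP[lo2 hi2] lc cx xh ig.
have sub p q : lo <= p -> q <= hi -> itg `[p, q] g.
  move=> lp qh; apply: itgS ig => // z /=; rewrite !in_itv/= => /andP[pz zq].
  by rewrite (le_trans lp)// (le_trans zq).
rewrite /primitive; have [c2|c2] := leP 2^-1 c.
  rewrite (le_trans c2 cx) (@Rint_itv_cat _ 2^-1 c x)//; last exact: sub.
  by rewrite addrAC subrr add0r.
have [x2|x2] := leP 2^-1 x.
  rewrite opprK (@Rint_itv_cat _ c 2^-1 x)//; [exact: addrC|exact: ltW|exact: sub].
rewrite opprK addrC (@Rint_itv_cat _ c x 2^-1 g cx (ltW x2)) ?addrK//.
exact: sub.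
Qed.

Lemma ac_on_primitive lo hi g : lo <= 2^-1 <= hi -> itg `[lo, hi] g ->
  ac_on lo hi (primitive g) g.
Proof. by move=> lh ig; split=> // x y lx xy yh; exact: primitiveB lh lx xy yh ig. Qed.

Lemma near_oo c d x : c < x -> x < d -> \forall z \near x, c < z < d.
Proof.
move=> cx xd; near=> z; apply/andP; split; near: z; [exact: lt_nbhsr|exact: lt_nbhsl].
Unshelve. all: by end_near. Qed.

Lemma primitive_derive lo hi g x : lo <= 2^-1 <= hi -> itg `[lo, hi] g ->
  lo < x -> x < hi -> {for x, continuous g} -> is_derive x 1 (primitive g) (g x).
Proof.
move=> lh ig lx xh cg.
have [df f'] := continuous_FTC1_closed xh ig lx cg.
pose F z := \int[mu]_(s in `[lo, z]) g s.
have dF : is_derive x 1 (fun z => primitive g lo + F z) (g x).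
  have h : is_derive x 1 F (g x).
    by have := derivable_is_derive df; rewrite f'.
  have := is_deriveD (is_derive_cst (primitive g lo) x 1) h.
  by rewrite add0r.
apply: near_eq_is_derive dF.
have := near_oo lx xh; apply: filterS => z /andP[z1 z2].
by rewrite /F -(primitiveB lh (lexx _) (ltW z1) (ltW z2) ig) addrC subrK.
Qed.

(** Weights are singular at [0] only, so integral inequalities are proved on
    [[d, 1]] and [d] is sent to [0]. *)
Lemma tail_le h m : itg I01 h ->
  (forall d, 0 < d -> d <= 2^-1 -> \int[mu]_(x in `[d, 1]) h x <= m) ->
  \int[mu]_(x in I01) h x <= m.
Proof.
move=> ih hd; have ic := itg_oo_cc ih.
rewrite Rint_itv_oo_cc//; apply/ler_addgt0Pl => e e0.
have /subspace_continuousP/(_ 0) := ac_on_continuous ler01 (ac_on_primitive half01 ic).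
have z01 : (0 : R) \in `[0, 1] by rewrite in_itv/= lexx ler01.
move=> /(_ z01) /cvgrPdist_lt /(_ e e0) [d /= d0 hdd].
pose k := Num.min (d / 2) 2^-1.
have k0 : 0 < k by rewrite lt_min divr_gt0//= invr_gt0.
have k2 : k <= 2^-1 by rewrite ge_min lexx orbT.
have k1 : k <= 1 by rewrite (le_trans k2)// invf_le1// ler1n.
have kd : k < d by rewrite (@le_lt_trans _ _ (d / 2))// ?ge_min ?lexx//; lra.
rewrite (Rint_itv_cat (ltW k0) k1 ic) lerD//; last exact: hd.
rewrite -(primitiveB half01 (lexx 0) (ltW k0) k1 ic).
apply/ltW; rewrite (le_lt_trans (ler_norm _))// distrC.
by apply: hdd => //=; rewrite ?in_itv/= ?(ltW k0)// sub0r normrN gtr0_norm.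
Qed.

End Primitive.

(** * Test functions *)

Section TestFunctions.
Context {R : realType}.
Local Notation mu := (@lebesgue_measure R).
Local Notation I01 := `]0%R, 1%R[%classic.
Implicit Types (f g u v phi psi : R -> R) (x s c d k lo hi : R).

Lemma test_continuous phi : test_fun phi -> continuous phi.
Proof.
move=> [cphi _] s; apply/differentiable_continuous/derivable1_diffP; exact: (cphi 0%N).
Qed.

Lemma test_is_derive phi (x : R) : test_fun phi -> is_derive x 1 phi (derive1 phi x).
Proof. by move=> [cphi _]; apply: derivable_is_derive; exact: (cphi 0%N). Qed.

Lemma derive_out phi c d x : (forall x, x \notin `[c, d] -> phi x = 0) ->
  x \notin `[c, d] -> derive1 phi x = 0.
Proof.
move=> out xcd; have h : is_derive x 1 phi 0.
  apply: near_eq_is_derive (is_derive_cst 0 x 1).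
  have op : open (~` [set` `[c, d]]) by apply: closed_openC; exact: interval_closed.
  have : nbhs x (~` [set` `[c, d]]) by apply: open_nbhs_nbhs; split=> //; apply/negP.
  by apply: filterS => z /negP zcd; rewrite out.
by rewrite derive1E; case: h.
Qed.

Lemma test_derive phi : test_fun phi -> test_fun (derive1 phi).
Proof.
move=> [cphi [c [d [c0 d1 out]]]]; split; first by move=> n x; rewrite -derive1n_shift; exact: cphi.
by exists c, d; split=> // x; exact: derive_out.
Qed.

Lemma test_lin c phi psi : test_fun phi -> test_fun psi -> test_fun (fun x => c * phi x + psi x).
Proof.
move=> [/Cn_derive1n cphi [a1 [b1 [a10 b11 out1]]]] [/Cn_derive1n cpsi [a2 [b2 [a20 b21 out2]]]].
split.
  apply/Cn_derive1n => n; apply: CnD => //.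
  by apply: (@CnM _ n (cst c)) => //; exact: Cn_cst.
exists (Num.min a1 a2), (Num.max b1 b2); split; [by rewrite lt_min a10|by rewrite gt_max b11|].
move=> x; rewrite in_itv/= ge_min le_max !negb_and !negb_or => hx.
rewrite out1 ?out2 ?mulr0 ?addr0// in_itv/= negb_and.
  by case/orP: hx => /andP[h1 h2]; rewrite ?h1 ?h2 ?orbT.
by case/orP: hx => /andP[h1 h2]; rewrite ?h1 ?h2 ?orbT.
Qed.

(** A support interval on the boundary of which the function vanishes too, and
    which contains the base point [1/2] of [primitive]. *)
Lemma test_support phi : test_fun phi -> exists lo hi : R, [/\ 0 < lo, lo <= 2^-1 <= hi, hi < 1 &
  forall x, x \notin `]lo, hi[ -> phi x = 0 /\ derive1 phi x = 0].
Proof.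
move=> tphi; have [_ [c [d [c0 d1 out]]]] := tphi.
pose lo := Num.min (c / 2) 2^-1; pose hi := Num.max ((1 + d) / 2) 2^-1.
have loc : lo <= c / 2 by rewrite ge_min lexx.
have hid : (1 + d) / 2 <= hi by rewrite le_max lexx.
have out' x : x \notin `]lo, hi[ -> x \notin `[c, d].
  rewrite !in_itv/= !negb_and -!leNgt -!ltNge => /orP[h|h]; apply/orP; [left|right]; lra.
exists lo, hi; split.
- by rewrite lt_min divr_gt0//= invr_gt0 ltr0n.
- by rewrite ge_min le_max !lexx !orbT.
- by rewrite gt_max; apply/andP; split; [lra|rewrite invf_lt1// ltr1n].
- move=> x /out' xcd; split; [exact: out|exact: derive_out xcd].
Qed.

Lemma Rint_support f psi lo hi : 0 < lo -> hi < 1 -> (forall x, x \notin `]lo, hi[ -> psi x = 0) ->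
  \int[mu]_(x in I01) (f x * psi x) = \int[mu]_(x in `[lo, hi]) (f x * psi x).
Proof.
move=> lo0 hi1 out; apply: Rint_restrict => //.
  by move=> x /=; rewrite !in_itv/= => /andP[x1 x2]; rewrite (lt_le_trans lo0 x1) (le_lt_trans x2 hi1).
move=> x _ /= /negP xn; rewrite out ?mulr0//.
by apply: contra xn => /subset_itv_oo_cc.
Qed.

Lemma itg_mul_continuous (f : R -> R) lo hi u : continuous f -> itg `[lo, hi] u ->
  itg `[lo, hi] (fun s => u s * f s).
Proof.
move=> cf iu; have [lh|lh] := leP lo hi; last first.
  by rewrite /itg set_itv_ge ?bnd_simp -?ltNge//; exact: integrable_set0.
have cn : {within `[lo, hi], continuous (fun s => `|f s|)}.
  apply: continuous_subspaceT => s; apply: continuous_comp; first exact: cf.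
  exact: norm_continuous.
have [s _ hs] := EVT_max lh cn.
have := @itg_mul_bounded R `[lo, hi] f u `|f s| _ _ _ iu.
move=> h; apply: (itg_eq _ _ (h _ _ _)) => //.
- by move=> z _; rewrite mulrC.
- by apply: measurable_funTS; exact: continuous_measurable_fun.
Qed.

Lemma itg_test u phi : loc_integrable u -> test_fun phi -> itg I01 (fun x => u x * phi x).
Proof.
move=> iu tphi; have [lo [hi [lo0 lh hi1 out]]] := test_support tphi.
have ih : itg `[lo, hi] (fun x => u x * phi x).
  by apply: itg_mul_continuous; [exact: test_continuous|exact: iu].
have -> : (fun x => u x * phi x) = (fun x => u x * phi x) \_ `[lo, hi]%classic.
  apply/funext => x; rewrite patchE; case: ifPn => // /negP xn.
  have [|-> _] := out x; last by rewrite mulr0.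
  by apply/negP => /subset_itv_oo_cc h; apply: xn; exact/mem_set.
rewrite /itg -restrict_EFin; apply/integrable_restrict => //.
rewrite (_ : _ `&` _ = `[lo, hi]%classic)//; apply/setIidr => x /=.
by rewrite !in_itv/= => /andP[x1 x2]; rewrite (lt_le_trans lo0 x1) (le_lt_trans x2 hi1).
Qed.

Lemma test_bounded phi : test_fun phi -> exists2 C : R, 0 <= C & forall x, `|phi x| <= C.
Proof.
move=> tphi; have [lo [hi [lo0 /andP[l2 h2] hi1 out]]] := test_support tphi.
have cn : {within `[lo, hi], continuous (fun s => `|phi s|)}.
  apply: continuous_subspaceT => s; apply: continuous_comp; first exact: test_continuous.
  exact: norm_continuous.
have [s _ hs] := EVT_max (le_trans l2 h2) cn; exists `|phi s|; first exact: normr_ge0.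
move=> x; have [xlh|xlh] := boolP (x \in `[lo, hi]); first exact: hs.
have [|-> _] := out x; last by rewrite normr0.
by apply: contra xlh => /subset_itv_oo_cc.
Qed.

Lemma ac_on_test phi lo hi : test_fun phi -> ac_on lo hi phi (derive1 phi).
Proof.
move=> tphi; apply: ac_on_C1.
- by apply: continuous_subspaceT; exact: test_continuous.
- by apply: continuous_subspaceT; apply: test_continuous; exact: test_derive.
- by move=> x _; exact: test_is_derive.
Qed.

(** The intervals contain [1/2] so that [primitive] is an instance. *)
Definition loc_ac u g := forall lo hi, 0 < lo -> lo <= 2^-1 <= hi -> hi < 1 -> ac_on lo hi u g.

Lemma loc_ac_C1 u g : (forall x, 0 < x < 1 -> is_derive x 1 u (g x)) ->
  (forall x, 0 < x < 1 -> {for x, continuous g}) -> loc_ac u g.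
Proof.
move=> du cg lo hi lo0 _ hi1.
have I x : `[lo, hi]%classic x -> 0 < x < 1.
  by rewrite /= in_itv/= => /andP[h1 h2]; rewrite (lt_le_trans lo0 h1) (le_lt_trans h2 hi1).
have w (k : R -> R) : (forall x, 0 < x < 1 -> {for x, continuous k}) -> {within `[lo, hi], continuous k}.
  by move=> ck; apply/subspace_continuousP => x /I x01; apply: cvg_within_filter; exact: ck.
apply: ac_on_C1; [apply: w|exact: w|].
  by move=> x x01; apply/differentiable_continuous/derivable1_diffP; case: (du x x01).
by move=> x /andP[h1 h2]; apply: du; rewrite (lt_trans lo0 h1) (lt_trans h2 hi1).
Qed.

Lemma loc_ac_primitive g : loc_integrable g -> loc_ac (primitive g) g.
Proof. by move=> ig lo hi lo0 lh hi1; apply: ac_on_primitive => //; exact: ig. Qed.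

(** The product rule on a support interval, at whose ends the test function
    vanishes. *)
Lemma loc_ac_ibp u g phi : loc_ac u g -> test_fun phi ->
  \int[mu]_(x in I01) (u x * derive1 phi x) = - \int[mu]_(x in I01) (g x * phi x).
Proof.
move=> au tphi; have [lo [hi [lo0 lh hi1 out]]] := test_support tphi.
have {}au := au lo hi lo0 lh hi1; have at_ := ac_on_test lo hi tphi.
have lohi : lo <= hi by case/andP: lh => /le_trans; apply.
have [ig _] := au; have [id _] := at_.
rewrite (Rint_support u lo0 hi1); last by move=> x /out[].
rewrite (Rint_support g lo0 hi1); last by move=> x /out[].
have := ac_on_mul lohi au at_.
have [|-> _] := out lo; first by rewrite in_itv/= ltxx.
have [|-> _] := out hi; first by rewrite in_itv/= ltxx andbF.
have i1 := ac_on_itg_mul lohi at_ ig; have i2 := ac_on_itg_mul lohi au id.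
rewrite RintegralD// (@eq_Rintegral _ _ _ mu _ (fun x => g x * phi x)); last first.
  by move=> x _; rewrite mulrC.
rewrite !mulr0 subrr; lra.
Qed.

Lemma test_sqr phi : test_fun phi -> test_fun (fun x => phi x * phi x) /\
  derive1 (fun x => phi x * phi x) = (fun x => 2 * (phi x * derive1 phi x)).
Proof.
move=> tphi; have [/Cn_derive1n cphi [c [d [c0 d1 out]]]] := tphi; split.
  split; first by apply/Cn_derive1n => n; exact: CnM.
  by exists c, d; split=> // x /out ->; rewrite mul0r.
apply: is_derive_derive1 => x.
have h := is_deriveM (test_is_derive x tphi) (test_is_derive x tphi).
by apply: (is_derive_eq h); rewrite /GRing.scale/=; ring.
Qed.

End TestFunctions.

(** * The fundamental lemma of the calculus of variations *)

Section Variations.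
Context {R : realType}.
Local Notation mu := (@lebesgue_measure R).
Local Notation I01 := `]0%R, 1%R[%classic.
Implicit Types (u g phi : R -> R) (c d x r s lo hi : R).

Definition lebesgue_point u x := forall e : R, 0 < e -> exists2 d : R, 0 < d &
  forall r, 0 < r -> r < d -> \int[mu]_(s in `[x - r, x + r]) `|u s - u x| <= e * r.

Lemma ae_lebesgue_point_itv u c d : itg `[c, d] u ->
  {ae mu, forall x, x \in `]c, d[ -> lebesgue_point u x}.
Proof.
move=> iu.
have lu : locally_integrable [set: R] (u \_ `[c, d]).
  exact: integrable_locally_restrict.
have := lebesgue_differentiation lu.
apply: ae_imp => x hx.
rewrite in_itv/= => /andP[cx xd] e e0.
have h0 : (0 < (e / 2)%:E)%E by rewrite lte_fin divr_gt0.
have := hx _ (@nbhs_open_ereal_lt _ 0 (fun=> e / 2) _); rewrite -lte_fin => /(_ h0).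
rewrite lte_fin in h0.
case=> d1 /= d10 hd.
pose d2 := Num.min d1 (Num.min (x - c) (d - x)).
exists d2; first by rewrite !lt_min d10 !subr_gt0 cx.
move=> r r0; rewrite !lt_min => /and3P[rd1 rxc rdx].
have sub : `[x - r, x + r]%classic `<=` `[c, d]%classic.
  move=> z /=; rewrite !in_itv/= => /andP[z1 z2]; apply/andP; split; lra.
have iur : itg `[x - r, x + r] (fun s => `|u s - u x|).
  apply: itg_norm => //; apply: itgB => //; last exact: itg_cst.
  exact: itgS iu.
have := hd r; rewrite /ball_/= sub0r normrN gtr0_norm// => /(_ rd1 r0).
have xcd : x \in `[c, d]%classic by rewrite inE/= in_itv/= !ltW.
rewrite /davg /iavg (lebesgue_measure_ball x (ltW r0)).
have -> : (\int[mu]_(y in ball x r) `|((center ((u \_ `[c, d]) x) \o (u \_ `[c, d])) y)%:E|)%E =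
  (\int[mu]_(s in `[(x - r)%R, (x + r)%R]) `|u s - u x|)%:E.
  rewrite ball_itv -Rint_itv_oo_cc// -EFin_Rintegral//; last first.
    by apply: itgS iur => //; exact: subset_itv_oo_cc.
  apply: eq_integral => y /set_mem yr; rewrite /= !patchE xcd.
  have -> : y \in `[c, d]%classic by apply/mem_set; apply: sub; exact: (subset_itv_oo_cc yr).
  by [].
rewrite inver mulrn_eq0 ?gt_eqF//= -EFinM lte_fin ltr_pdivrMl ?mulrn_wgt0//.
rewrite -mulr_natr => h; apply: ltW; apply: lt_le_trans h _.
by rewrite le_eqVlt; apply/orP; left; apply/eqP; field.
Qed.

Lemma ae_lebesgue_point u : loc_integrable u ->
  {ae mu, forall x, x \in `]0, 1[ -> lebesgue_point u x}.
Proof.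
move=> iu.
have h n : {ae mu, forall x, x \in `](n.+2%:R)^-1, 1 - (n.+2%:R)^-1[ -> lebesgue_point u x}.
  by apply: ae_lebesgue_point_itv; apply: iu; rewrite ?invr_gt0// ltrBlDr ltrDl invr_gt0.
have := ae_foralln h; apply: ae_imp => x hx.
rewrite in_itv/= => /andP[x0 x1].
pose m := Num.min x (1 - x); have m0 : 0 < m by rewrite lt_min x0 subr_gt0.
pose n := Num.truncn m^-1.
have hn : (n.+2%:R)^-1 < m.
  rewrite -[m]invrK ltf_pV2 ?posrE ?invr_gt0// (lt_le_trans (truncnS_gt _))//.
  by rewrite ler_nat.
move: hn; rewrite lt_min => /andP[h1 h2].
by apply: (hx n); rewrite in_itv/= h1/= ltrBrDr -ltrBrDl.
Qed.

Definition bump : R -> R := derive1 step.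

Lemma is_derive_step (s : R) : is_derive s 1 step (bump s).
Proof. by apply: derivable_is_derive; case: (@Cn_step R 1). Qed.

Lemma bump_continuous : continuous bump.
Proof.
move=> s; apply/differentiable_continuous/derivable1_diffP.
by have [_ []] := @Cn_step R 2.
Qed.

Lemma bump_out s : 1 < `|s| -> bump s = 0.
Proof.
move=> s1; have [k hk] : exists k : R, \forall z \near s, cst k z = step z.
  move: s1; rewrite ltr_normr => /orP[s1|s1].
    exists 1; near=> z; rewrite step_right//; apply: ltW; near: z; exact: lt_nbhsr.
  exists 0; near=> z; rewrite step_left//; apply: ltW; near: z.
  by apply: lt_nbhsl; rewrite ltrNr.
have h : is_derive s 1 step 0.
  by apply: (near_eq_is_derive _ (is_derive_cst k s 1)).
by rewrite /bump derive1E; case: h.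
Unshelve. all: by end_near. Qed.

Lemma bump_bounded : exists2 C : R, 0 <= C & forall s, `|bump s| <= C.
Proof.
have cr : {within `[(-1 : R), 1], continuous (fun s => `|bump s|)}.
  apply: continuous_subspaceT => s; apply: continuous_comp; first exact: bump_continuous.
  exact: norm_continuous.
have h11 : (-1 : R) <= 1 by lra.
have [s _ hs] := EVT_max h11 cr.
exists `|bump s|; first exact: normr_ge0.
move=> z; have [z1|z1] := leP `|z| 1.
  by apply: hs; rewrite in_itv/= -ler_norml.
by rewrite bump_out// normr0.
Qed.

(** [mollifier r c] is a smooth approximation of the Dirac mass at [c], and
    [ramp r c] its primitive. *)
Definition mollifier r c s := bump ((s - c) / r) / r.
Definition ramp r c s := step ((s - c) / r).

Lemma Cn_ramp n r c : Cn n (ramp r c).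
Proof.
rewrite /ramp; have := @Cn_affine _ n step r^-1 (- c / r) (Cn_step n).
by congr Cn; apply/funext => s; rewrite mulrBl mulrC mulNr.
Qed.

Lemma is_derive_ramp r c (s : R) : is_derive s 1 (ramp r c) (mollifier r c s).
Proof.
have h1 : is_derive s 1 (fun z : R => (z - c) / r) r^-1.
  have -> : (fun z => (z - c) / r) = (r^-1 \*: ((id : R -> R) - cst c)).
    by apply/funext => z; rewrite /GRing.scale/= mulrC.
  by apply: is_derive_eq; rewrite subr0 /GRing.scale /= mulr1.
exact: (@is_derive1_comp _ step (fun z => (z - c) / r) s _ _ (is_derive_step _) h1).
Qed.

Lemma Cn_mollifier n r c : Cn n (mollifier r c).
Proof.
have [_] := Cn_ramp n.+1 r c.
by rewrite (is_derive_derive1 (is_derive_ramp r c)).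
Qed.

Lemma mollifier_out r c s : 0 < r -> r < `|s - c| -> mollifier r c s = 0.
Proof.
move=> r0 sc; rewrite /mollifier bump_out ?mul0r//.
by rewrite normrM (gtr0_norm (_ : 0 < r^-1)) ?invr_gt0// ltr_pdivlMr// mul1r.
Qed.

Lemma ramp_left r c s : 0 < r -> s <= c - r -> ramp r c s = 0.
Proof. by move=> r0 sc; rewrite /ramp step_left// ler_pdivrMr// mulN1r lerBlDr addrC. Qed.

Lemma ramp_right r c s : 0 < r -> c + r <= s -> ramp r c s = 1.
Proof. by move=> r0 sc; rewrite /ramp step_right// ler_pdivlMr// mul1r lerBrDl. Qed.

Lemma mollifier_continuous r c : continuous (mollifier r c).
Proof.
move=> s; apply/differentiable_continuous/derivable1_diffP.
by have [h _] := Cn_mollifier 1 r c; apply: h.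
Qed.

Lemma ramp_continuous r c : continuous (ramp r c).
Proof.
move=> s; apply/differentiable_continuous/derivable1_diffP.
by case: (is_derive_ramp r c s).
Qed.

Lemma mollifier_integral r c lo hi : 0 < r -> lo <= c - r -> c + r <= hi ->
  \int[mu]_(s in `[lo, hi]) mollifier r c s = 1.
Proof.
move=> r0 lc ch; have lh : lo < hi by lra.
have cm : {within `[lo, hi], continuous (mollifier r c)}.
  by apply: continuous_subspaceT; exact: mollifier_continuous.
have dr : derivable_oo_LRcontinuous (ramp r c) lo hi.
  split=> [s _||]; first by case: (is_derive_ramp r c s).
    by apply: cvg_at_right_filter; exact: ramp_continuous.
  by apply: cvg_at_left_filter; exact: ramp_continuous.
have := continuous_FTC2 lh cm dr.
rewrite /Rintegral => -> /=; first by rewrite ramp_right// ramp_left// subr0.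
by move=> s _; rewrite (is_derive_derive1 (is_derive_ramp r c)).
Qed.

Lemma mollifier_test r c : 0 < r -> 0 < c - r -> c + r < 1 -> test_fun (mollifier r c).
Proof.
move=> r0 c0 c1; split; first by apply/Cn_derive1n => n; exact: Cn_mollifier.
exists (c - r), (c + r); split=> // x; rewrite in_itv/= => /negP h; apply: mollifier_out => //.
rewrite ltNge; apply/negP; rewrite ler_norml => /andP[h1 h2]; apply: h.
by apply/andP; split; lra.
Qed.

(** The mollifier has integral [1] and is at most [C / r], so it averages [u] over
    an interval of length [2 r] around [c]. *)
Lemma mollify C u r c lo hi : (forall s, `|bump s| <= C) -> 0 < r -> lo <= c - r -> c + r <= hi ->
  itg `[lo, hi] u ->
  `|\int[mu]_(s in `[lo, hi]) (u s * mollifier r c s) - u c| <=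
    C / r * \int[mu]_(s in `[c - r, c + r]) `|u s - u c|.
Proof.
move=> rC r0 lc ch iu.
have C0 : 0 <= C by apply: le_trans (rC 0).
have icst := @itg_cst R lo hi (u c).
have cm := @mollifier_continuous r c.
have i1 := itg_mul_continuous cm iu; have i2 := itg_mul_continuous cm icst.
have iuc : itg `[lo, hi] (fun s => u s - u c) by apply: itgB.
have sub : `[c - r, c + r]%classic `<=` `[lo, hi]%classic.
  move=> z /=; rewrite !in_itv/= => /andP[z1 z2]; apply/andP; split; lra.
have -> : \int[mu]_(s in `[lo, hi]) (u s * mollifier r c s) - u c =
  \int[mu]_(s in `[lo, hi]) ((u s - u c) * mollifier r c s).
  have -> : \int[mu]_(s in `[lo, hi]) ((u s - u c) * mollifier r c s) =
    \int[mu]_(s in `[lo, hi]) (u s * mollifier r c s - u c * mollifier r c s).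
    by apply: eq_Rintegral => s _; rewrite mulrBl.
  rewrite RintegralB// RintegralZl//; last first.
    by apply: itg_cont; exact: continuous_subspaceT.
  by rewrite mollifier_integral// mulr1.
have i3 := itg_mul_continuous cm iuc.
apply: le_trans (le_normr_Rintegral _ i3) _ => //.
have -> : \int[mu]_(s in `[lo, hi]) `|(u s - u c) * mollifier r c s| =
   \int[mu]_(s in `[c - r, c + r]) `|(u s - u c) * mollifier r c s|.
  apply: Rint_restrict => // s _ /= sn; rewrite (@mollifier_out r c s) ?mulr0 ?normr0//.
  rewrite ltNge; apply/negP => h; apply: sn; rewrite in_itv/=.
  by move: h; rewrite ler_norml => /andP[h1 h2]; apply/andP; split; lra.
rewrite -RintegralZl//; last first.
  by apply: itg_norm => //; exact: itgS iuc.
apply: le_Rintegral => //.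
- by apply: itg_norm => //; exact: itgS i3.
- by apply: itgZ => //; apply: itg_norm => //; exact: itgS iuc.
- move=> s _; rewrite normrM mulrC ler_wpM2r// normrM.
  by rewrite (gtr0_norm (_ : 0 < r^-1)) ?invr_gt0// ler_wpM2r ?invr_ge0 ?(ltW r0).
Qed.

(** At a Lebesgue point [c] of [g], the integrals of [g] against mollifiers
    centred at [c] tend to [g c]; they all vanish. *)
Lemma variation_eq0 g : loc_integrable g ->
  (forall phi, test_fun phi -> \int[mu]_(x in I01) (g x * phi x) = 0) ->
  {ae mu, forall x, x \in `]0, 1[ -> g x = 0}.
Proof.
move=> ig g0; have := ae_lebesgue_point ig.
apply: ae_imp => c hc c01.
have {}hc := hc c01; move: c01; rewrite in_itv/= => /andP[c0 c1].
have [C C0 rC] := bump_bounded.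
apply/eqP; rewrite -normr_le0; apply/ler_addgt0Pl => e e0; rewrite addr0.
have eC : 0 < e / (C + 1) by rewrite divr_gt0// ltr_wpDl.
have [d d0 hd] := hc _ eC.
pose r := Num.min (d / 2) (Num.min (c / 2) ((1 - c) / 2)).
have r0 : 0 < r by rewrite !lt_min !divr_gt0 ?subr_gt0.
have rd : r < d by apply: (@le_lt_trans _ _ (d / 2)); [rewrite ge_min lexx|lra].
have rc : r <= c / 2 by rewrite !ge_min lexx orbT.
have rc1 : r <= (1 - c) / 2 by rewrite !ge_min lexx !orbT.
pose lo := c - r; pose hi := c + r.
have lo0 : 0 < lo by rewrite /lo; lra.
have hi1 : hi < 1 by rewrite /hi; lra.
have tf := mollifier_test r0 lo0 hi1.
have iglh : itg `[lo, hi] g by apply: ig; rewrite /lo /hi; lra.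
have := mollify rC r0 (lexx _) (lexx _) iglh.
have -> : \int[mu]_(s in `[lo, hi]) (g s * mollifier r c s) = 0.
  rewrite -(g0 _ tf); apply/esym; apply: Rint_restrict => //.
    by move=> x /=; rewrite /lo /hi !in_itv/= => /andP[x1 x2]; apply/andP; split; lra.
  move=> x _ /= xn.
  rewrite (@mollifier_out r c x) ?mulr0// ltNge; apply/negP.
  rewrite ler_norml => /andP[h1 h2]; apply: xn; rewrite in_itv/= /lo /hi.
  by apply/andP; split; lra.
rewrite sub0r normrN => h; apply: le_trans h _.
apply: le_trans (ler_wpM2l _ (hd r r0 rd)) _; first by rewrite divr_ge0// ltW.
have -> : C / r * (e / (C + 1) * r) = e * (C / (C + 1)).
  by field; rewrite !gt_eqF// ltr_wpDl.
by rewrite ler_piMr ?(ltW e0)// ler_pdivrMr ?ltr_wpDl// mul1r lerDl.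
Qed.

End Variations.

(** * Weak derivatives *)

Section WeakCalculus.
Context {R : realType}.
Local Notation mu := (@lebesgue_measure R).
Local Notation I01 := `]0%R, 1%R[%classic.
Implicit Types (f g h u v w phi psi : R -> R) (x s r e d c k : R).

Lemma wderivP u : has_weak_deriv u -> weak_deriv u (wderiv u).
Proof. by move=> [g ug]; rewrite /wderiv; case: xgetP => [h -> //|/(_ g)]. Qed.

Lemma loc_integrable_lin c u v : loc_integrable u -> loc_integrable v ->
  loc_integrable (fun x => c * u x + v x).
Proof.
move=> iu iv a1 b1 a0 b0; apply: (@itgD R `[a1, b1] (fun x => c * u x) v) => //; last exact: iv.
by apply: itgZ => //; exact: iu.
Qed.

Lemma loc_integrable_one : loc_integrable (fun=> 1 : R).
Proof. by move=> c d _ _; exact: itg_cst. Qed.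

Lemma loc_integrable_measurable u : loc_integrable u -> measurable_fun (I01 : set R) u.
Proof.
move=> iu.
have -> : I01 = \bigcup_n `[(n.+2%:R : R)^-1, 1 - n.+2%:R^-1]%classic.
  apply/seteqP; split=> x /=.
    rewrite in_itv/= => /andP[x0 x1].
    pose k := Num.min x (1 - x); have k0 : 0 < k by rewrite lt_min x0 subr_gt0.
    pose n := Num.truncn k^-1.
    have hn : (n.+2%:R)^-1 < k.
      rewrite -[k]invrK ltf_pV2 ?posrE ?invr_gt0// (lt_le_trans (truncnS_gt _))//.
      by rewrite ler_nat.
    move: hn; rewrite lt_min => /andP[h1 h2].
    by exists n => //=; rewrite in_itv/= (ltW h1)/= lerBrDr -lerBrDl ltW.
  move=> [n _]; rewrite /= !in_itv/= => /andP[h1 h2].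
  have n0 : 0 < (n.+2%:R : R)^-1 by rewrite invr_gt0.
  by rewrite (lt_le_trans n0 h1) (le_lt_trans h2)// ltrBlDr ltrDl.
apply/measurable_fun_bigcup => // n; apply: itg_meas; apply: iu.
  by rewrite invr_gt0.
by rewrite ltrBlDr ltrDl invr_gt0.
Qed.

Lemma weak_deriv_lin c u v g h : weak_deriv u g -> weak_deriv v h ->
  weak_deriv (fun x => c * u x + v x) (fun x => c * g x + h x).
Proof.
move=> [iu ig ug] [iv ih vh]; split; [exact: loc_integrable_lin|exact: loc_integrable_lin|].
move=> phi tphi; have tphi' := test_derive tphi.
have lin f1 f2 psi : loc_integrable f1 -> loc_integrable f2 -> test_fun psi ->
  \int[mu]_(x in I01) ((c * f1 x + f2 x) * psi x) =
  c * \int[mu]_(x in I01) (f1 x * psi x) + \int[mu]_(x in I01) (f2 x * psi x).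
  move=> i1 i2 tpsi; have j1 := itg_test i1 tpsi; have j2 := itg_test i2 tpsi.
  rewrite -RintegralZl// -RintegralD//; last exact: itgZ.
  by apply: eq_Rintegral => x _; ring.
by rewrite !lin// ug// vh//; ring.
Qed.

Lemma loc_integrable_sub u v : loc_integrable u -> loc_integrable v ->
  loc_integrable (fun x => u x - v x).
Proof. by move=> iu iv c d c0 d1; apply: itgB => //; [exact: iu|exact: iv]. Qed.

Lemma itg_test_sub u v phi : loc_integrable u -> loc_integrable v -> test_fun phi ->
  \int[mu]_(x in I01) ((u x - v x) * phi x) =
  \int[mu]_(x in I01) (u x * phi x) - \int[mu]_(x in I01) (v x * phi x).
Proof.
move=> iu iv tphi; rewrite -RintegralB//; [|exact: itg_test|exact: itg_test].
by apply: eq_Rintegral => x _; rewrite mulrBl.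
Qed.

Lemma weak_deriv_unique u g1 g2 : weak_deriv u g1 -> weak_deriv u g2 ->
  {ae mu, forall x, x \in `]0, 1[ -> g1 x = g2 x}.
Proof.
move=> [_ i1 h1] [_ i2 h2].
have := variation_eq0 (loc_integrable_sub i1 i2).
move=> /(_ _)/ae_imp; apply; last first.
  move=> phi tphi; rewrite itg_test_sub//.
  by apply/eqP; rewrite subr_eq0 -eqr_opp -h1// -h2.
by move=> x h x01; apply/eqP; rewrite -subr_eq0 h.
Qed.

(** The primitive is constant outside the support interval, with the same value on
    both sides when the integral is zero. *)
Lemma test_primitive zeta : test_fun zeta -> \int[mu]_(x in I01) zeta x = 0 ->
  exists2 chi, test_fun chi & derive1 chi = zeta.
Proof.
move=> tz z0; have [lo [hi [lo0 /andP[lo2 hi2] hi1 out]]] := test_support tz.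
have cz := test_continuous tz; have [/Cn_derive1n Cz _] := tz.
have iz (c d : R) : itg `[c, d] zeta by apply: itg_cont; exact: continuous_subspaceT.
have acz c d : c <= 2^-1 <= d -> ac_on c d (primitive zeta) zeta.
  by move=> cd; apply: ac_on_primitive => //; exact: iz.
pose chi x := primitive zeta x - primitive zeta lo.
have dchi (x : R) : is_derive x 1 chi (zeta x).
  have m1 : Num.min x 2^-1 <= x by rewrite ge_min lexx.
  have m2 : Num.min x 2^-1 <= 2^-1 by rewrite ge_min lexx orbT.
  have m3 : x <= Num.max x 2^-1 by rewrite le_max lexx.
  have m4 : 2^-1 <= Num.max x 2^-1 by rewrite le_max lexx orbT.
  have lx : Num.min x 2^-1 - 1 < x by lra.
  have xh : x < Num.max x 2^-1 + 1 by lra.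
  have lh : Num.min x 2^-1 - 1 <= 2^-1 <= Num.max x 2^-1 + 1 by apply/andP; split; lra.
  have h := is_deriveB (primitive_derive lh (iz _ _) lx xh (cz x)) (is_derive_cst (primitive zeta lo) x 1).
  by rewrite subr0 in h.
exists chi; last exact: is_derive_derive1.
split; first by apply/Cn_derive1n => -[//|n]; exact: (CnS dchi).
have vanish c d : c <= d -> (forall x, c < x < d -> x \notin `]lo, hi[) -> \int[mu]_(x in `[c, d]) zeta x = 0.
  move=> cd h; rewrite -Rint_itv_oo_cc//.
  rewrite (@eq_Rintegral _ _ _ mu _ (fun=> 0)); first by rewrite Rint_cst_oo// mul0r.
  by move=> x /set_mem /=; rewrite in_itv/= => /h/out[].
exists lo, hi; split=> // x; rewrite in_itv/= negb_and -!ltNge => /orP[xlo|hix].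
  have xh : x <= 2^-1 <= hi by rewrite hi2 (le_trans (ltW xlo) lo2).
  have [_ h] := acz x hi xh.
  rewrite /chi -opprB h ?(ltW xlo)//; last exact: le_trans hi2.
  rewrite vanish ?(ltW xlo) ?oppr0// => s /andP[_ slo].
  by rewrite in_itv/= negb_and -!leNgt (ltW slo).
have lx : lo <= 2^-1 <= x by rewrite lo2 (le_trans hi2 (ltW hix)).
have [_ h] := acz lo x lx.
have lh := le_trans lo2 hi2.
rewrite /chi h ?(le_trans lh (ltW hix))// (Rint_itv_cat lh (ltW hix))//.
rewrite (vanish hi x) ?(ltW hix)//; last first.
  by move=> s /andP[hs _]; rewrite in_itv/= negb_and -!leNgt (ltW hs) orbT.
have := Rint_support (fun=> 1) lo0 hi1 (fun x hx => proj1 (out x hx)).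
rewrite (@eq_Rintegral _ _ _ mu _ zeta); last by move=> s _; rewrite mul1r.
rewrite z0 addr0 => ->; apply: eq_Rintegral => s _; by rewrite mul1r.
Qed.

(** The lemma of du Bois-Reymond: [u] minus a primitive of [g] is orthogonal to
    all derivatives of test functions, hence to all test functions of integral
    zero, hence is constant. *)
Theorem weak_deriv_primitive u g : weak_deriv u g ->
  exists k : R, {ae mu, forall x, x \in `]0, 1[ -> u x = k + primitive g x}.
Proof.
move=> [iu ig ug]; have ag := loc_ac_primitive ig.
have ip : loc_integrable (primitive g).
  move=> c d c0 d1; have /andP[_ h1] := @half01 R.
  have lh : Num.min c 2^-1 <= 2^-1 <= Num.max d 2^-1 by rewrite ge_min le_max !lexx !orbT.
  have [lo0 hi1] : 0 < Num.min c 2^-1 /\ Num.max d 2^-1 < 1.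
    by rewrite lt_min gt_max c0 d1 invr_gt0 ltr0n invf_lt1// ltr1n.
  have cp := ac_on_continuous (_ : Num.min c 2^-1 <= Num.max d 2^-1) (ag _ _ lo0 lh hi1).
  have {}cp := cp (le_trans (proj1 (andP lh)) (proj2 (andP lh))).
  apply: itgS (itg_cont cp) => // x /=; rewrite !in_itv/= ge_min le_max.
  by move=> /andP[-> ->].
set v := fun x => u x - primitive g x.
have iv : loc_integrable v := loc_integrable_sub iu ip.
have v0 phi : test_fun phi -> \int[mu]_(x in I01) (v x * derive1 phi x) = 0.
  move=> tphi; rewrite itg_test_sub//; last exact: test_derive.
  by rewrite ug// (loc_ac_ibp ag)// subrr.
have r0 : 0 < (4^-1 : R) by rewrite invr_gt0.
pose psi : R -> R := mollifier 4^-1 2^-1.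
have tpsi : test_fun psi by apply: mollifier_test => //; lra.
have psi1 : \int[mu]_(x in I01) psi x = 1.
  rewrite Rint_itv_oo_cc; first by rewrite mollifier_integral//; lra.
  by apply: itg_cont; apply: continuous_subspaceT; exact: test_continuous.
have i1 := loc_integrable_one.
have ione phi : test_fun phi -> itg I01 phi.
  by move=> /(itg_test i1); apply: itg_eq => // x _; rewrite mul1r.
pose k := \int[mu]_(x in I01) (v x * psi x); exists k.
have ivk : loc_integrable (fun x => v x - k).
  by apply: loc_integrable_sub => // c d _ _; exact: itg_cst.
have := variation_eq0 ivk => /(_ _)/ae_imp; apply; last first.
  move=> phi tphi; set m := \int[mu]_(x in I01) phi x.
  have tz : test_fun (fun x => - m * psi x + phi x) by exact: test_lin.
  have [|chi tchi dchi] := test_primitive tz.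
    rewrite RintegralD//; [|by apply: itgZ => //; exact: ione|exact: ione].
    rewrite RintegralZl//; last exact: ione.
    by rewrite psi1 mulr1 addrC subrr.
  have := v0 _ tchi; rewrite dchi.
  have jpsi := itg_test iv tpsi; have jphi := itg_test iv tphi.
  rewrite (@eq_Rintegral _ _ _ mu _ (fun x => - m * (v x * psi x) + v x * phi x)); last first.
    by move=> x _; ring.
  rewrite RintegralD//; last exact: itgZ.
  rewrite RintegralZl// -/k => h.
  rewrite itg_test_sub//; last by move=> c d _ _; exact: itg_cst.
  rewrite RintegralZl//; last exact: ione.
  by move/eqP: h; rewrite mulNr addrC subr_eq0 -/m => /eqP ->; rewrite mulrC subrr.
by move=> x h x01; have := h x01; rewrite /v => /eqP; rewrite subr_eq0 => /eqP <-; rewrite subrK.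
Qed.

Lemma wderiv_lin c u v : has_weak_deriv u -> has_weak_deriv v ->
  {ae mu, forall x, x \in `]0, 1[ -> wderiv (fun x => c * u x + v x) x = c * wderiv u x + wderiv v x}.
Proof.
move=> hu hv; have h := weak_deriv_lin c (wderivP hu) (wderivP hv).
have hw : has_weak_deriv (fun x => c * u x + v x) by exists (fun x => c * wderiv u x + wderiv v x).
exact: weak_deriv_unique (wderivP hw) h.
Qed.

Lemma has_weak_deriv_lin c u v : has_weak_deriv u -> has_weak_deriv v ->
  has_weak_deriv (fun x => c * u x + v x).
Proof. by move=> [g ug] [h vh]; eexists; exact: weak_deriv_lin ug vh. Qed.

Lemma loc_integrable_continuous u : (forall x, 0 < x < 1 -> {for x, continuous u}) -> loc_integrable u.
Proof.
move=> cu c d c0 d1; apply: itg_cont; apply/subspace_continuousP => x /=.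
rewrite in_itv/= => /andP[cx xd].
by apply: cvg_within_filter; apply: cu; rewrite (lt_le_trans c0 cx) (le_lt_trans xd d1).
Qed.

Lemma test_weak_deriv phi : test_fun phi -> weak_deriv phi (derive1 phi).
Proof.
move=> tphi; split.
- by apply: loc_integrable_continuous => x _; exact: test_continuous.
- by apply: loc_integrable_continuous => x _; apply: test_continuous; exact: test_derive.
- by move=> psi tpsi; apply: loc_ac_ibp => // lo hi _ _ _; exact: ac_on_test.
Qed.

Lemma test_wderiv phi : test_fun phi ->
  {ae mu, forall x, x \in `]0, 1[ -> wderiv phi x = derive1 phi x}.
Proof.
move=> tphi; have h := test_weak_deriv tphi.
have hw : has_weak_deriv phi by exists (derive1 phi).
exact: weak_deriv_unique (wderivP hw) h.
Qed.

Lemma weak_deriv_ae u v g : loc_integrable v -> {ae mu, forall x, x \in `]0, 1[ -> u x = v x} ->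
  weak_deriv u g -> weak_deriv v g.
Proof.
move=> iv uv [iu ig ug]; split=> // phi tphi; rewrite -ug//.
have tphi' := test_derive tphi.
apply/esym; apply: itg_ae_eq => //; [|exact: itg_test|exact: itg_test].
by apply: ae_imp uv => x h Ix; rewrite h.
Qed.

Lemma wderiv_ae u v : loc_integrable u -> loc_integrable v ->
  {ae mu, forall x, x \in `]0, 1[ -> u x = v x} -> wderiv u = wderiv v.
Proof.
move=> iu iv uv; rewrite /wderiv; congr xget; apply/seteqP; split=> g /=.
  exact: weak_deriv_ae.
apply: weak_deriv_ae => //.
by apply: ae_imp uv => x h Ix; rewrite h.
Qed.

End WeakCalculus.

(** * The coefficients *)

Section Coefficients.
Context {R : realType}.
Local Notation mu := (@lebesgue_measure R).
Local Notation I01 := `]0%R, 1%R[%classic.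
Implicit Types (f g a b : R -> R) (x s r e d c : R).

Lemma within_near (T : Type) (F : set_system T) (D : set T) : Filter F -> F D -> within D F = F.
Proof.
move=> FF FD; apply/seteqP; split=> P; last by apply: filterS => x Px _.
move=> h; have h' : F (fun t : T => D t -> P t) by exact: h.
by apply: filterS (filterI FD h') => t [Dt]; apply.
Qed.

Lemma deriv_on_interior (D E : set R) f x : (\forall z \near x, D z) -> (\forall z \near x, E z) ->
  deriv_on D f x = deriv_on E f x.
Proof.
by move=> Dx Ex; rewrite /deriv_on !within_near//; apply: nbhs_dnbhs.
Qed.

Lemma diff_quotient_derive (D : set R) f x : (\forall z \near x, D z) ->
  cvg (diff_quotient f x @ within D x^') -> is_derive x 1 f (deriv_on D f x).
Proof.
move=> Dx; have wD : within D x^' = x^' by apply: within_near; exact: nbhs_dnbhs.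
rewrite /deriv_on wD => /cvg_ex[l hl].
have -> : lim (diff_quotient f x @ x^') = l by exact: cvg_lim.
have cv : h^-1 *: (f (h *: 1 + x) - f x) @[h --> 0^'] --> (l : R).
  apply/cvgrPdist_le => e e0; move/cvgrPdist_le : hl => /(_ e e0) [d /= d0 hd].
  exists d => //= h; rewrite /ball_/= sub0r normrN => hd1 h0.
  have := hd (h + x); rewrite /ball_/= opprD addrCA subrr addr0 normrN => /(_ hd1).
  rewrite -subr_eq0 addrK => /(_ h0).
  by rewrite /diff_quotient addrK /GRing.scale/= mulr1 mulrC.
apply: DeriveDef; first by apply/cvg_ex; exists l.
exact: cvg_lim.
Qed.

(** Inside the interval the one-sided derivatives that define [C1_on] are ordinary
    derivatives. *)
Lemma C1_interior (D : set R) f x : I01 `<=` D -> C1_on D f -> 0 < x < 1 ->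
  is_derive x 1 f (derive1 f x) /\ derive1 f x = deriv_on D f x.
Proof.
move=> ID [df _] /andP[x0 x1].
have Dx : \forall z \near x, D z.
  by apply: filterS (near_oo x0 x1) => z hz; apply: ID; rewrite /= in_itv.
have h := diff_quotient_derive Dx (df x (nbhs_singleton Dx)).
have e : derive1 f x = deriv_on D f x by rewrite derive1E; case: h.
by rewrite e.
Qed.

Lemma within_continuous_interior (D : set R) f x : I01 `<=` D -> 0 < x < 1 ->
  {within D, continuous f} -> {for x, continuous f}.
Proof.
move=> ID /andP[x0 x1] cf.
have Dx : \forall z \near x, D z.
  by apply: filterS (near_oo x0 x1) => z hz; apply: ID; rewrite /= in_itv.
move/subspace_continuousP : cf => /(_ x (nbhs_singleton Dx)).
by rewrite within_near.
Qed.

Lemma C1_interior_continuous (D : set R) f x : I01 `<=` D -> C1_on D f -> 0 < x < 1 ->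
  {for x, continuous (derive1 f)}.
Proof.
move=> ID C1f x01; have [_ cf] := C1f.
have h := within_continuous_interior ID x01 cf.
have e z : 0 < z < 1 -> deriv_on D f z = derive1 f z.
  by move=> z01; have [_ ->] := C1_interior ID C1f z01.
rewrite /prop_for /continuous_at -e//.
apply: cvg_trans h; apply: near_eq_cvg.
have /andP[x0 x1] := x01; apply: filterS (near_oo x0 x1) => z; exact: e.
Qed.

(** The hypotheses of the theorem on [a] and [b], bundled so that all that follows
    depends on a single parameter. *)
Record coefficients := Coefficients {
  ca : R -> R;
  cb : R -> R;
  ca_cont : {within `[0, 1], continuous ca};
  cb_cont : {within `[0, 1], continuous cb};
  cba_int : mu.-integrable I01 (fun x => (cb x / ca x)%:E);
  ca_deg : weakly_degenerate ca \/ (strongly_degenerate ca /\ degK ca = 1%E) }.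

Arguments ca_cont : clear implicits.
Arguments cb_cont : clear implicits.
Arguments cba_int : clear implicits.
Arguments ca_deg : clear implicits.

Variable p : coefficients.
Let a := ca p.
Let b := cb p.
(** The constants [K] and [M] of the theorem. *)
Definition cK := fine (degK a).
Definition cM := Linfty_norm b / a 1.
Local Notation eta := (eta a b).
Local Notation sigma := (sigma a b).

Lemma a_gt0 x : 0 < x <= 1 -> 0 < a x.
Proof. by move=> x01; case: (ca_deg p) => [[_ _ _ h _]|[[_ _ h _] _]]; apply: h; rewrite in_itv. Qed.

Lemma a_C1 : exists2 D : set R, I01 `<=` D & C1_on D a.
Proof.
case: (ca_deg p) => [[_ h _ _ _]|[[h _ _ _] _]].
  by exists `]0, 1]%classic => //; exact: subset_itv_oo_oc.
by exists `[0, 1]%classic => //; exact: subset_itv_oo_cc.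
Qed.

Lemma a_derive x : 0 < x < 1 -> is_derive x 1 a (derive1 a x).
Proof. by move=> x01; have [D ID h] := a_C1; case: (C1_interior ID h x01). Qed.

Lemma a'_continuous x : 0 < x < 1 -> {for x, continuous (derive1 a)}.
Proof. by have [D ID h] := a_C1; exact: C1_interior_continuous ID h. Qed.

Lemma degK_itv : (0 < degK a <= 1)%E.
Proof.
by case: (ca_deg p) => [[_ _ _ _ /andP[-> /ltW ->]]|[_ ->]] //; rewrite lexx lte_fin ltr01.
Qed.

Lemma cK_itv : 0 < cK <= 1.
Proof.
have := degK_itv; rewrite /cK; case: (degK a) => [r||]; first by rewrite lte_fin lee_fin.
  by move=> /andP[_]; rewrite leye_eq.
by move=> /andP[]; rewrite ltNge leNye.
Qed.

(** The supremum is finite in both cases of degeneracy, so it is a bound. *)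
Lemma degK_bound x : 0 < x < 1 -> x * `|derive1 a x| <= cK * a x.
Proof.
move=> x01; have /andP[x0 x1] := x01.
have ax : 0 < a x by apply: a_gt0; rewrite x0 ltW.
have [D ID h] := a_C1; have [_ e] := C1_interior ID h x01.
have Dx (E : set R) : I01 `<=` E -> \forall z \near x, E z.
  by move=> IE; apply: filterS (near_oo x0 x1) => z hz; apply: IE; rewrite /= in_itv.
rewrite -ler_pdivrMr// -lee_fin /cK fineK; last first.
  have /andP[k0 k1] := degK_itv; rewrite fin_real//.
  by rewrite (lt_trans (ltNyr _) k0) (le_lt_trans k1 (ltry _)).
apply: ereal_sup_ubound; exists x; first by rewrite /= in_itv/= x0 ltW.
rewrite e (@deriv_on_interior D `]0, 1]%classic)//; apply: Dx => //.
exact: subset_itv_oo_oc.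
Qed.

(** [x / a x] is nondecreasing because [K <= 1]. *)
Lemma x_div_a x : 0 < x <= 1 -> x / a x <= (a 1)^-1.
Proof.
move=> /andP[x0]; rewrite le_eqVlt => /predU1P[->|x1]; first by rewrite mul1r.
have a1 : 0 < a 1 by apply: a_gt0; rewrite ltr01 lexx.
have dq (z : R) : z \in `]x, 1[ -> is_derive z 1 (fun z => z / a z)
    ((a z)^-1 + z * (- (a z) ^- 2 * derive1 a z)).
  rewrite in_itv/= => /andP[xz z1].
  have z0 : 0 < z by exact: lt_trans xz.
  have az : a z != 0 by rewrite gt_eqF// a_gt0// z0 ltW.
  have dV : is_derive z 1 (fun z => (a z)^-1) (- (a z) ^- 2 * derive1 a z).
    by apply: (is_deriveV az); apply: a_derive; rewrite z0.
  have h := is_deriveM (is_derive_id z 1) dV; apply: (is_derive_eq h).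
  by rewrite /GRing.scale/= mulr1 addrC.
have cq : {within `[x, 1], continuous (fun z => z / a z)}.
  have sub : `[x, 1]%classic `<=` `[0, 1]%classic.
    by move=> z /=; rewrite !in_itv/= => /andP[xz ->]; rewrite (le_trans (ltW x0)).
  have ca1 := continuous_subspaceW sub (ca_cont p).
  apply/subspace_continuousP => z xz; apply: cvgM.
    by apply: cvg_within_filter; exact: cvg_id.
  apply: cvgV; last by move/subspace_continuousP : ca1; apply.
  move: xz; rewrite /= in_itv/= => /andP[xz z1].
  by rewrite gt_eqF// a_gt0// (lt_le_trans x0).
have [z xz1] := MVT x1 dq cq; rewrite mul1r => e.
rewrite -subr_ge0 e mulr_ge0 ?subr_ge0 ?(ltW x1)//.
move: xz1; rewrite in_itv/= => /andP[xz z1]; have z0 : 0 < z by exact: lt_trans xz.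
have az : 0 < a z by rewrite a_gt0// z0 ltW.
have z01 : 0 < z < 1 by rewrite z0.
have := degK_bound z01; have /andP[k0 k1] := cK_itv => h.
have -> : (a z)^-1 + z * (- a z ^- 2 * derive1 a z) = (a z - z * derive1 a z) / a z ^+ 2.
  by field; rewrite gt_eqF.
rewrite divr_ge0 ?sqr_ge0// subr_ge0 (@le_trans _ _ (z * `|derive1 a z|))//.
  by rewrite ler_wpM2l ?(ltW z0)// ler_norm.
by apply: le_trans h _; rewrite ler_piMl// ltW.
Qed.

(** For a continuous function the essential supremum bounds every value: a larger
    value at a point persists on an interval, which has positive measure. *)
Lemma Linfty_bound x : 0 < x < 1 -> `|b x| <= Linfty_norm b.
Proof.
move=> x01; have /andP[x0 x1] := x01.
pose f := EFin \o (b \_ I01).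
have mT : (0 < mu [set: R])%E.
  apply: (@lt_le_trans _ _ (mu I01)).
    rewrite [X in (_ < X)%E](lebesgue_measure_itv `]0, 1[) /= lte_fin ltr01.
    by rewrite oppr0 adde0 lte_fin ltr01.
  by apply: le_measure => //; rewrite inE//; exact: measurable_itv.
rewrite /Linfty_norm unlock mT.
have cb01 : {within `[(0 : R), 1], continuous (fun s => `|b s|)}.
  apply/subspace_continuousP => z z01; apply: cvg_norm.
  by move/subspace_continuousP : (cb_cont p); apply.
have [s s01 hs] := EVT_max ler01 cb01.
have fin : ess_sup mu (abse \o f) \is a fin_num.
  rewrite fin_real//; apply/andP; split.
    apply: lt_le_trans (ltNyr 0) _; apply: ess_sup_gee => //.
    by apply: aeW => z /=; rewrite lee_fin; exact: normr_ge0.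
  apply: le_lt_trans (ltry `|b s|); apply/ess_supP; apply: aeW => z /=.
  rewrite lee_fin patchE; case: ifPn => [/set_mem zI|_]; last by rewrite normr0.
  by apply: hs; exact: (subset_itv_oo_cc zI).
rewrite -lee_fin fineK// leNgt; apply/negP => lt.
pose m := fine (ess_sup mu (abse \o f)).
have lt' : m < `|b x| by rewrite -lte_fin fineK.
have cbx := within_continuous_interior (@subset_itv_oo_cc _ _ 0 1) x01 (cb_cont p).
have : \forall z \near x, m < `|b z| /\ 0 < z < 1.
  apply: filterS2 (near_oo x0 x1) _; last first.
    have : `|b z| @[z --> x] --> `|b x| by apply: cvg_norm; exact: cbx.
    by move=> h; apply: (cvgr_gt _ h); exact: lt'.
  by move=> z h1 h2.
case=> d /= d0 hd.
have : mu.-negligible (ball x d).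
  apply: negligibleS (ess_sup_ge mu (abse \o f)) => z xz h.
  have [h1 h2] := hd z xz.
  move: h => /=; rewrite patchE mem_set ?in_itv//= -[leRHS]fineK// lee_fin -/m.
  by rewrite leNgt h1.
move=> /(negligibleP _) => /(_ (measurable_ball _ _)).
move=> h0; have : ((d *+ 2)%:E = 0 :> \bar R)%E.
  by rewrite -(lebesgue_measure_ball x (ltW d0)); exact: h0.
by move=> /eqP; rewrite eqe mulrn_eq0/= gt_eqF.
Qed.

Lemma x_b_div_a x : 0 < x < 1 -> x * `|b x| / a x <= cM.
Proof.
move=> x01; have /andP[x0 x1] := x01; rewrite mulrAC /cM mulrC ler_pM//.
- by rewrite divr_ge0 ?ltW// a_gt0// x0 ltW.
- exact: Linfty_bound.
- by apply: x_div_a; rewrite x0 ltW.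
Qed.

Let ratio x := b x / a x.

Lemma ratio_itg : itg `[0, 1] ratio.
Proof. by apply: itg_oo_cc; exact: cba_int. Qed.

Lemma eta_gt0 x : 0 < eta x. Proof. exact: expR_gt0. Qed.

Lemma eta_within : {within `[0, 1], continuous eta}.
Proof.
have h := ac_on_continuous ler01 (ac_on_primitive half01 ratio_itg).
apply/subspace_continuousP => x x01.
have hx : primitive ratio z @[z --> within `[0, 1] (nbhs x)] --> primitive ratio x.
  by move/subspace_continuousP : h; apply.
have h2 : expR z @[z --> primitive ratio x] --> expR (primitive ratio x).
  exact: continuous_expR.
exact: (cvg_comp _ _ hx h2).
Qed.

Lemma eta_continuous x : 0 < x < 1 -> {for x, continuous eta}.
Proof. by move=> x01; exact: (within_continuous_interior (@subset_itv_oo_cc _ _ 0 1) x01 eta_within). Qed.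

Lemma a_continuous x : 0 < x < 1 -> {for x, continuous a}.
Proof. by move=> x01; exact: (within_continuous_interior (@subset_itv_oo_cc _ _ 0 1) x01 (ca_cont p)). Qed.

Lemma b_continuous x : 0 < x < 1 -> {for x, continuous b}.
Proof. by move=> x01; exact: (within_continuous_interior (@subset_itv_oo_cc _ _ 0 1) x01 (cb_cont p)). Qed.

Lemma eta_derive x : 0 < x < 1 -> is_derive x 1 eta (eta x * (b x / a x)).
Proof.
move=> x01; have /andP[x0 x1] := x01.
have cr : {for x, continuous ratio}.
  apply: cvgM; first exact: b_continuous.
  by apply: cvgV; [rewrite gt_eqF// a_gt0// x0 ltW|exact: a_continuous].
have h := primitive_derive half01 ratio_itg x0 x1 cr.
have := @is_derive1_comp _ (@expR R) (primitive ratio) x _ _ (is_derive_expR _) h.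
by [].
Qed.

Lemma eta_bounds : exists2 m, 0 < m & forall x, 0 <= x <= 1 -> m <= eta x.
Proof.
have [x x01 hx] := EVT_min ler01 eta_within.
by exists (eta x); [exact: eta_gt0|move=> z z01; apply: hx; rewrite in_itv].
Qed.

Lemma max_eta_ub x : 0 <= x <= 1 -> eta x <= max_eta a b.
Proof.
have [z z01 hz] := EVT_max ler01 eta_within.
move=> x01; apply: ub_le_sup; last by exists x; rewrite //= in_itv.
by exists (eta z) => _ [y y01 <-]; exact: hz.
Qed.

Lemma min_eta_lb x : 0 <= x <= 1 -> min_eta a b <= eta x.
Proof.
have [m m0 hm] := eta_bounds.
move=> x01; apply: ge_inf; last by exists x; rewrite //= in_itv.
by exists m => _ [y y01 <-]; apply: hm; move: y01; rewrite /= in_itv.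
Qed.

Lemma min_eta_gt0 : 0 < min_eta a b.
Proof.
have [m m0 hm] := eta_bounds; apply: lt_le_trans m0 _.
apply: lb_le_inf; first by exists (eta 0), 0 => //=; rewrite in_itv/= lexx ler01.
by move=> _ [y y01 <-]; apply: hm; move: y01; rewrite /= in_itv.
Qed.

Lemma sigma_gt0 x : 0 < x <= 1 -> 0 < sigma x.
Proof. by move=> x01; rewrite divr_gt0 ?eta_gt0 ?a_gt0. Qed.

Lemma sigma_continuous x : 0 < x < 1 -> {for x, continuous sigma}.
Proof.
move=> x01; apply: cvgM; first exact: a_continuous.
by apply: cvgV; [rewrite gt_eqF ?eta_gt0|exact: eta_continuous].
Qed.

Lemma sigma_within : {within `[0, 1], continuous sigma}.
Proof.
apply/subspace_continuousP => x x01; apply: cvgM.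
  by move/subspace_continuousP : (ca_cont p); apply.
apply: cvgV; first by rewrite gt_eqF ?eta_gt0.
by move/subspace_continuousP : eta_within; apply.
Qed.

(** This bound controls the Hardy-type weight [x / sigma] although [1 / sigma] is
    singular at [0]; [eta] is bounded and [x / a] is at most [1 / a 1]. *)
Lemma x_div_sigma x : 0 < x <= 1 -> x / sigma x <= max_eta a b / a 1.
Proof.
move=> x01; have /andP[x0 x1] := x01; have ax := a_gt0 x01.
have -> : x / sigma x = eta x * (x / a x).
  by rewrite /sigma; field; rewrite !gt_eqF ?eta_gt0.
rewrite ler_pM ?x_div_a//; [exact/ltW/eta_gt0|by rewrite divr_ge0// ltW|].
by apply: max_eta_ub; rewrite ltW.
Qed.

Lemma measurable_I01 f : (forall x, 0 < x < 1 -> {for x, continuous f}) -> measurable_fun (I01 : set R) f.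
Proof.
move=> cf; apply: open_continuous_measurable_fun; first exact: interval_open.
by move=> x /set_mem /=; rewrite in_itv/=; exact: cf.
Qed.

End Coefficients.

(** * Semi-inner products *)

Section SemiInner.
Context {R : realType} {E : lmodType R}.
Implicit Types (S : E -> E -> R) (u v w : E).

(** Definiteness is not required: elements of the function spaces below are
    representatives, and equality almost everywhere is never quotiented out. *)
Definition semi_inner S :=
  [/\ forall (c : R) u v w, S (c *: u + v) w = c * S u w + S v w,
      forall u v, S u v = S v u & forall u, 0 <= S u u].

Definition snorm S u := Num.sqrt (S u u).

Variable S : E -> E -> R.
Hypothesis hS : semi_inner S.

Lemma sipl (c : R) u v w : S (c *: u + v) w = c * S u w + S v w.
Proof. by case: hS. Qed.
Lemma sipC u v : S u v = S v u.
Proof. by case: hS. Qed.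
Lemma sip_ge0 u : 0 <= S u u.
Proof. by case: hS. Qed.
Lemma sip0l w : S 0 w = 0.
Proof. by have := sipl 1 0 0 w; rewrite scaler0 addr0 mul1r => h; lra. Qed.
Lemma sipDl u v w : S (u + v) w = S u w + S v w.
Proof. by have := sipl 1 u v w; rewrite scale1r mul1r. Qed.
Lemma sipZl c u w : S (c *: u) w = c * S u w.
Proof. by have := sipl c u 0 w; rewrite addr0 sip0l addr0. Qed.
Lemma sipNl u w : S (- u) w = - S u w.
Proof. by rewrite -scaleN1r sipZl mulN1r. Qed.
Lemma sipBl u v w : S (u - v) w = S u w - S v w.
Proof. by rewrite sipDl sipNl. Qed.
Lemma sipDr u v w : S w (u + v) = S w u + S w v.
Proof. by rewrite !(sipC w) sipDl. Qed.
Lemma sipZr c u w : S w (c *: u) = c * S w u.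
Proof. by rewrite !(sipC w) sipZl. Qed.
Lemma sipNr u w : S w (- u) = - S w u.
Proof. by rewrite !(sipC w) sipNl. Qed.
Lemma sipBr u v w : S w (u - v) = S w u - S w v.
Proof. by rewrite !(sipC w) sipBl. Qed.

Lemma snorm_ge0 u : 0 <= snorm S u.
Proof. exact: sqrtr_ge0. Qed.
Lemma sqr_snorm u : snorm S u ^+ 2 = S u u.
Proof. by rewrite sqr_sqrtr// sip_ge0. Qed.

Lemma cauchy_schwarz u v : `|S u v| <= snorm S u * snorm S v.
Proof.
rewrite -sqrtrM ?sip_ge0// -sqrtr_sqr ler_sqrt ?mulr_ge0 ?sip_ge0//.
set a := S u u; set b := S u v; set c := S v v.
have a0 : 0 <= a := sip_ge0 u; have c0 : 0 <= c := sip_ge0 v.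
have q (t : R) : 0 <= a + 2 * t * b + t ^+ 2 * c.
  have := sip_ge0 (t *: v + u).
  rewrite !sipDl !sipDr !sipZl !sipZr (sipC v u) -/a -/b -/c => h.
  by apply: le_trans h _; rewrite le_eqVlt; apply/orP; left; apply/eqP; ring.
have [c00|c00] := eqVneq c 0.
  have [->|b0] := eqVneq b 0; first by rewrite expr0n mulr_ge0.
  have := q (- (a + 1) / (2 * b)); rewrite c00 mulr0 addr0.
  have -> : 2 * (- (a + 1) / (2 * b)) * b = - (a + 1) by field.
  lra.
have cp : 0 < c by rewrite lt_def c00.
have := q (- b / c).
have -> : a + 2 * (- b / c) * b + (- b / c) ^+ 2 * c = a - b ^+ 2 / c by field.
by rewrite subr_ge0 ler_pdivrMr.
Qed.

Lemma snormD u v : snorm S (u + v) <= snorm S u + snorm S v.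
Proof.
rewrite -(@ler_pXn2r _ 2)// ?nnegrE ?addr_ge0 ?snorm_ge0//.
rewrite sqr_snorm sqrrD !sqr_snorm !sipDl !sipDr (sipC v u).
have := cauchy_schwarz u v; rewrite ler_norml => /andP[_ h]; lra.
Qed.

Lemma snormZ c u : snorm S (c *: u) = `|c| * snorm S u.
Proof.
by rewrite /snorm sipZl sipZr mulrA -expr2 sqrtrM ?sqr_ge0// sqrtr_sqr.
Qed.

Lemma snormN u : snorm S (- u) = snorm S u.
Proof. by rewrite -scaleN1r snormZ normrN1 mul1r. Qed.

Lemma snormB u v : snorm S (u - v) = snorm S (v - u).
Proof. by rewrite -snormN opprB. Qed.

Lemma snorm0 : snorm S 0 = 0.
Proof. by rewrite -(scale0r 0) snormZ normr0 mul0r. Qed.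

Lemma snorm_dist u v : `|snorm S u - snorm S v| <= snorm S (u - v).
Proof.
rewrite ler_norml lerBDl lerBlDr; apply/andP; split.
  by have := snormD (v - u) u; rewrite subrK snormB addrC.
by rewrite lerBlDr; have := snormD (u - v) v; rewrite subrK.
Qed.

Lemma snorm_triangle u v w : snorm S (u - w) <= snorm S (u - v) + snorm S (v - w).
Proof. by have := snormD (u - v) (v - w); rewrite addrA subrK. Qed.

Lemma snorm_null_sip u v : snorm S u = 0 -> S u v = 0.
Proof.
by move=> u0; apply/eqP; rewrite -normr_le0 (le_trans (cauchy_schwarz u v))// u0 mul0r.
Qed.

End SemiInner.

(** * Curves on the half-line *)

Section NormCurves.
Context {R : realType}.
Implicit Types (s t e d k m T : R) (f g h : R -> R).

Definition seminorm (E : lmodType R) (N : E -> R) :=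
  [/\ forall u, 0 <= N u, forall u v, N (u + v) <= N u + N v &
      forall (c : R) u, N (c *: u) = `|c| * N u].

Lemma snorm_seminorm (E : lmodType R) (S : E -> E -> R) :
  semi_inner S -> seminorm (snorm S).
Proof.
move=> hS; split; [move=> u; exact: snorm_ge0|exact: snormD|exact: snormZ].
Qed.

Lemma normr_seminorm : seminorm (fun x : R^o => `|x|).
Proof. by split=> [//|u v|c u]; [exact: ler_normD|rewrite normrM]. Qed.

Section one.
Variables (E : lmodType R) (N : E -> R).
Implicit Types (y v : R -> E).

(** Continuity and differentiability on [[0, +oo[] for a seminorm, one-sided at
    [0]. *)
Definition ccont y := forall t, 0 <= t -> forall e, 0 < e ->
  exists2 d : R, 0 < d & forall s, 0 <= s -> `|s - t| < d -> N (y s - y t) <= e.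

Definition cderiv y v := forall t, 0 <= t -> forall e, 0 < e ->
  exists2 d : R, 0 < d & forall s, 0 <= s -> `|s - t| < d ->
    N (y s - y t - (s - t) *: v t) <= e * `|s - t|.

Hypothesis hN : seminorm N.

Lemma cderiv_cont y v : cderiv y v -> ccont y.
Proof.
case: hN => N0 ND NZ dy t t0 e e0.
have [d d0 hd] := dy t t0 1 ltr01.
exists (Num.min d (e / (1 + N (v t)))).
  by rewrite lt_min d0 divr_gt0// ltr_pwDl.
move=> s s0; rewrite lt_min => /andP[sd].
rewrite ltr_pdivlMr ?ltr_pwDl// => se.
rewrite -(subrK ((s - t) *: v t) (y s - y t)) (le_trans (ND _ _))//.
by rewrite NZ (le_trans _ (ltW se))// mulrDr mulr1 lerD2r -[leRHS]mul1r hd.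
Qed.

Lemma ccont_affine y (c : R) (z : R -> E) : ccont y -> ccont z -> ccont (fun t => c *: y t + z t).
Proof.
case: hN => N0 ND NZ cy cz t t0 e e0.
have e2 : 0 < e / (2 * (1 + `|c|)) by rewrite divr_gt0// mulr_gt0// ltr_pwDl.
have e2' : 0 < e / 2 by rewrite divr_gt0.
have [d d0 hd] := cy t t0 _ e2; have [d' d'0 hd'] := cz t t0 _ e2'.
exists (Num.min d d'); first by rewrite lt_min d0.
move=> s s0; rewrite lt_min => /andP[sd sd'].
have -> : c *: y s + z s - (c *: y t + z t) = c *: (y s - y t) + (z s - z t).
  by rewrite scalerBr opprD addrACA.
rewrite (le_trans (ND _ _))// NZ (splitr e) lerD ?hd'//.
have h := hd s s0 sd; rewrite (le_trans (ler_wpM2l _ h))//.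
rewrite mulrC -mulrA [leLHS](_ : _ = (e / 2) * (`|c| / (1 + `|c|))); last first.
  by rewrite invfM; ring.
by rewrite ler_piMr ?(ltW e2')// ler_pdivrMr ?ltr_pwDl// mul1r lerDr.
Qed.

Lemma cderiv_affine y v (c : R) z w : cderiv y v -> cderiv z w ->
  cderiv (fun t => c *: y t + z t) (fun t => c *: v t + w t).
Proof.
case: hN => N0 ND NZ cy cz t t0 e e0.
have e2 : 0 < e / (2 * (1 + `|c|)) by rewrite divr_gt0// mulr_gt0// ltr_pwDl.
have e2' : 0 < e / 2 by rewrite divr_gt0.
have [d d0 hd] := cy t t0 _ e2; have [d' d'0 hd'] := cz t t0 _ e2'.
exists (Num.min d d'); first by rewrite lt_min d0.
move=> s s0; rewrite lt_min => /andP[sd sd'].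
have -> : c *: y s + z s - (c *: y t + z t) - (s - t) *: (c *: v t + w t)
   = c *: (y s - y t - (s - t) *: v t) + (z s - z t - (s - t) *: w t).
  rewrite scalerDr (opprD (c *: y t)) (addrACA (c *: y s)) opprD (addrACA (c *: y s - c *: y t)).
  by rewrite !scalerBr !scalerA [c * _]mulrC.
rewrite (le_trans (ND _ _))// NZ [e in leRHS]splitr mulrDl lerD ?hd'//.
have h := hd s s0 sd; rewrite (le_trans (ler_wpM2l _ h))//.
rewrite mulrA ler_wpM2r//.
rewrite mulrC -mulrA [leLHS](_ : _ = (e / 2) * (`|c| / (1 + `|c|))); last first.
  by rewrite invfM; ring.
by rewrite ler_piMr ?(ltW e2')// ler_pdivrMr ?ltr_pwDl// mul1r lerDr.
Qed.

Lemma N0_ : N 0 = 0.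
Proof. by case: hN => _ _ NZ; rewrite -(scale0r 0) NZ normr0 mul0r. Qed.

Lemma cderiv_cst (c : E) : cderiv (fun=> c) (fun=> 0).
Proof.
move=> t t0 e e0; exists 1 => // s _ _.
by rewrite subrr scaler0 subr0 N0_ mulr_ge0// ltW.
Qed.

Lemma cderiv_linear (c : E) : cderiv (fun t => t *: c) (fun=> c).
Proof.
move=> t t0 e e0; exists 1 => // s _ _.
by rewrite scalerBl subrr N0_ mulr_ge0// ltW.
Qed.

Lemma cderiv_square (c : E) : cderiv (fun t => (t ^+ 2 / 2) *: c) (fun t => t *: c).
Proof.
case: hN => N0 ND NZ t t0 e e0; exists (e / (1 + N c)).
  by rewrite divr_gt0// ltr_pwDl.
move=> s s0; rewrite ltr_pdivlMr ?ltr_pwDl// => h.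
have -> : (s ^+ 2 / 2) *: c - (t ^+ 2 / 2) *: c - (s - t) *: (t *: c) =
    ((s - t) * ((s - t) / 2)) *: c.
  by rewrite scalerA -scalerBl -scalerBl; congr (_ *: _); field.
rewrite NZ normrM -mulrA mulrC ler_wpM2r// (le_trans _ (ltW h))//.
rewrite normrM ler_pM// ?mulr_ge0// ?lerDr//.
by rewrite ler_piMr// ger0_norm ?invr_ge0// invf_le1// ler1n.
Qed.

Lemma cderiv_shift y v k : 0 <= k -> cderiv y v ->
  cderiv (fun t => y (t + k)) (fun t => v (t + k)).
Proof.
move=> k0 dy t t0 e e0; have [d d0 hd] := dy (t + k) (addr_ge0 t0 k0) e e0.
exists d => // s s0 st; have e1 : s + k - (t + k) = s - t by ring.
by rewrite -e1 hd ?e1// addr_ge0.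
Qed.

Lemma ccont_shift y k : 0 <= k -> ccont y -> ccont (fun t => y (t + k)).
Proof.
move=> k0 dy t t0 e e0; have [d d0 hd] := dy (t + k) (addr_ge0 t0 k0) e e0.
exists d => // s s0 st; have e1 : s + k - (t + k) = s - t by ring.
by rewrite hd ?e1// addr_ge0.
Qed.

End one.

Section two.
Variables (E1 E2 : lmodType R) (N1 : E1 -> R) (N2 : E2 -> R).
Variables (B : E1 -> E2 -> R) (c : R).
Hypotheses (h1 : seminorm N1) (h2 : seminorm N2).
Hypothesis Bl : forall k u v w, B (k *: u + v) w = k * B u w + B v w.
Hypothesis Br : forall k u v w, B w (k *: u + v) = k * B w u + B w v.
Hypothesis c0 : 0 <= c.
Hypothesis Bc : forall u v, `|B u v| <= c * (N1 u * N2 v).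

Lemma bil0l w : B 0 w = 0.
Proof. by have := Bl 1 0 0 w; rewrite scaler0 addr0 mul1r => h; lra. Qed.
Lemma bilDl u v w : B (u + v) w = B u w + B v w.
Proof. by have := Bl 1 u v w; rewrite scale1r mul1r. Qed.
Lemma bilZl k u w : B (k *: u) w = k * B u w.
Proof. by have := Bl k u 0 w; rewrite addr0 bil0l addr0. Qed.
Lemma bilBl u v w : B (u - v) w = B u w - B v w.
Proof. by rewrite bilDl -scaleN1r bilZl mulN1r. Qed.
Lemma bil0r w : B w 0 = 0.
Proof. by have := Br 1 0 0 w; rewrite scaler0 addr0 mul1r => h; lra. Qed.
Lemma bilDr u v w : B w (u + v) = B w u + B w v.
Proof. by have := Br 1 u v w; rewrite scale1r mul1r. Qed.
Lemma bilZr k u w : B w (k *: u) = k * B w u.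
Proof. by have := Br k u 0 w; rewrite addr0 bil0r addr0. Qed.
Lemma bilBr u v w : B w (u - v) = B w u - B w v.
Proof. by rewrite bilDr -scaleN1r bilZr mulN1r. Qed.

Lemma ccont_bilin u v : ccont N1 u -> ccont N2 v ->
  ccont (fun x : R^o => `|x|) (fun t => B (u t) (v t)).
Proof.
have [[p1 D1 Z1] [p2 D2 Z2]] := (h1, h2).
move=> cu cv t t0 e e0.
set m : R := c * (N1 (u t) + N2 (v t) + 1) + 1.
have m0 : 0 < m by rewrite ltr_wpDl// mulr_ge0// !addr_ge0.
set e1 : R := Num.min 1 (e / m).
have e10 : 0 < e1 by rewrite lt_min ltr01 divr_gt0.
have [d d0 hd] := cu t t0 _ e10; have [d' d'0 hd'] := cv t t0 _ e10.
exists (Num.min d d'); first by rewrite lt_min d0.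
move=> s s0; rewrite lt_min => /andP[/(hd s s0) {}hd /(hd' s s0) {}hd'].
have -> : B (u s) (v s) - B (u t) (v t) =
   B (u s - u t) (v t) + B (u t) (v s - v t) + B (u s - u t) (v s - v t).
  by rewrite !bilBl !bilBr; ring.
rewrite (le_trans (ler_normD _ _))// (le_trans (lerD (ler_normD _ _) (lexx _)))//.
rewrite (le_trans (lerD (lerD (Bc _ _) (Bc _ _)) (Bc _ _)))//.
have e11 : e1 <= 1 by rewrite ge_min lexx.
have e1e : e1 * m <= e by rewrite -ler_pdivlMr// ge_min lexx orbT.
apply: le_trans e1e; rewrite /m -!mulrDr.
have : N1 (u s - u t) * N2 (v t) + N1 (u t) * N2 (v s - v t) +
   N1 (u s - u t) * N2 (v s - v t) <= e1 * (N1 (u t) + N2 (v t) + 1).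
  rewrite !mulrDr mulr1 [e1 * N1 _ + _]addrC lerD// ?lerD ?ler_wpM2r// 1?mulrC ?ler_wpM2r//.
  by rewrite -[leRHS]mulr1 ler_pM// (le_trans hd).
move=> /(ler_wpM2l c0) /le_trans; apply.
by rewrite [leRHS]mulrDr mulr1 mulrCA lerDl ltW.
Qed.

(** The product rule for a bounded bilinear form along two curves. *)
Lemma cderiv_bilin u v u' v' : cderiv N1 u u' -> cderiv N2 v v' ->
  cderiv (fun x : R^o => `|x|) (fun t => B (u t) (v t))
    (fun t => B (u' t) (v t) + B (u t) (v' t)).
Proof.
have [[p1 D1 Z1] [p2 D2 Z2]] := (h1, h2).
move=> cu cv t t0 e e0.
set q := (1 + N1 (u' t)) * (1 + N2 (v' t)).
have q0 : 0 <= q by rewrite mulr_ge0 ?addr_ge0.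
set m : R := c * (N1 (u t) + N2 (v t) + q) + 1.
have m0 : 0 < m by rewrite ltr_wpDl// mulr_ge0// !addr_ge0.
set e1 : R := Num.min 1 (e / m).
have e10 : 0 < e1 by rewrite lt_min ltr01 divr_gt0.
have [d d0 hd] := cu t t0 _ e10; have [d' d'0 hd'] := cv t t0 _ e10.
exists (Num.min e1 (Num.min d d')); first by rewrite lt_min e10/= lt_min d0.
move=> s s0; rewrite !lt_min => /andP[/andP[he1 he2] /andP[/(hd s s0) {}hd /(hd' s s0) {}hd']].
have he : `|s - t| < e1 by rewrite lt_min he1.
set r1 := u s - u t - _ in hd; set r2 := v s - v t - _ in hd'.
have e11 : e1 <= 1 by rewrite ge_min lexx.
set h := `|s - t| in he hd hd' *.
have h0 : 0 <= h by exact: normr_ge0.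
have du : N1 (u s - u t) <= (1 + N1 (u' t)) * h.
  rewrite -(subrK ((s - t) *: u' t) (u s - u t)) (le_trans (D1 _ _))// Z1 mulrDl.
  rewrite -/h mul1r [_ * h]mulrC lerD2r (le_trans hd)//.
  by rewrite ler_piMl.
have dv : N2 (v s - v t) <= (1 + N2 (v' t)) * h.
  rewrite -(subrK ((s - t) *: v' t) (v s - v t)) (le_trans (D2 _ _))// Z2 mulrDl.
  rewrite -/h mul1r [_ * h]mulrC lerD2r (le_trans hd')//.
  by rewrite ler_piMl.
have -> : B (u s) (v s) - B (u t) (v t) - (s - t) *: ((B (u' t) (v t) + B (u t) (v' t)) : R^o) =
   B r1 (v t) + B (u t) r2 + B (u s - u t) (v s - v t).
  by rewrite /r1 /r2 !bilBl !bilBr bilZl bilZr /GRing.scale/=; ring.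
rewrite (le_trans (ler_normD _ _))// (le_trans (lerD (ler_normD _ _) (lexx _)))//.
rewrite (le_trans (lerD (lerD (Bc _ _) (Bc _ _)) (Bc _ _)))//.
have e1e : e1 * m <= e by rewrite -ler_pdivlMr// ge_min lexx orbT.
apply: (le_trans _ (ler_wpM2r h0 e1e)); rewrite /m -!mulrDr.
have : N1 r1 * N2 (v t) + N1 (u t) * N2 r2 +
   N1 (u s - u t) * N2 (v s - v t) <= e1 * h * (N1 (u t) + N2 (v t) + q).
  rewrite !mulrDr [e1 * h * N1 _ + _]addrC lerD// ?lerD ?ler_wpM2r// 1?mulrC ?ler_wpM2r//.
  rewrite mulrC (le_trans (ler_pM _ _ du dv))// mulrACA -/q [leRHS]mulrC ler_wpM2l//.
  by rewrite ler_wpM2r// ltW.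
move=> /(ler_wpM2l c0) /le_trans; apply.
set X := _ + q; have -> : c * (e1 * h * X) = e1 * (c * X) * h by ring.
by rewrite ler_wpM2r// ler_wpM2l ?(ltW e10)// lerDl.
Qed.

End two.

(** Real-valued curves; away from [0] these are the usual notions, so that the
    mean value theorem and the fundamental theorem of calculus apply. *)
Definition sderiv (f g : R -> R) := cderiv (fun x : R^o => `|x|) (f : R -> R^o) (g : R -> R^o).
Definition scont (f : R -> R) := ccont (fun x : R^o => `|x|) (f : R -> R^o).

Lemma near_dist t d : 0 < d -> \forall s \near t, `|s - t| < d.
Proof. by move=> d0; exists d => // s /=; rewrite distrC. Qed.

Lemma scont_cvg f t : scont f -> 0 < t -> f @ t --> (f t : R).
Proof.
move=> cf t0; apply/cvgrPdist_le => e e0.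
have [d d0 hd] := cf t (ltW t0) e e0.
near=> s; rewrite distrC hd//.
by apply/ltW; near: s; exact: lt_nbhsr.
Unshelve. all: by end_near. Qed.

Lemma scont_within f T : scont f -> {within `[0, T], continuous f}.
Proof.
move=> cf; apply/subspace_continuousP => t /=; rewrite in_itv/= => /andP[t0 tT].
apply/cvgrPdist_le => e e0.
have [d d0 hd] := cf t t0 e e0.
have nd : \forall s \near within `[0, T]%classic (nbhs (t : R)), `|s - t| < d.
  by apply: cvg_within; exact: near_dist.
near=> s; have : s \in `[0, T] by near: s; exact: withinT.
rewrite in_itv/= => /andP[s0 _].
rewrite distrC hd//.
by near: s; exact: nd.
Unshelve. all: by end_near. Qed.

Lemma sderiv_is_derive f g t : sderiv f g -> 0 < t -> is_derive t 1 f (g t).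
Proof.
move=> df t0.
have cv : h^-1 *: (f (h *: 1 + t) - f t) @[h --> 0^'] --> (g t : R).
  apply/cvgrPdist_le => e e0.
  have [d d0 hd] := df t (ltW t0) e e0.
  near=> h.
  have h0 : h != 0 by near: h; exact: nbhs_dnbhs_neq.
  have h1 : `|h| < Num.min d t by near: h; apply: dnbhs0_lt; rewrite lt_min d0.
  move: h1; rewrite lt_min => /andP[h1 h2].
  have h3 : 0 <= h + t by move: h2; rewrite ltr_norml => /andP[]; lra.
  have := hd (h + t) h3; rewrite addrK => /(_ h1).
  rewrite /GRing.scale/= mulr1 => h4.
  rewrite -(ler_pM2r (_ : 0 < `|h|)) ?normr_gt0// -normrM.
  rewrite [X in `|X| <= _](_ : _ = - (f (h + t) - f t - h * g t)); last by field.
  by rewrite normrN.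
apply: DeriveDef; first by apply/cvg_ex; exists (g t).
exact: cvg_lim.
Unshelve. all: by end_near. Qed.

Lemma sderiv_LR f g T : 0 < T -> sderiv f g -> derivable_oo_LRcontinuous f 0 T.
Proof.
move=> T0 df; have cf : scont f := cderiv_cont normr_seminorm df.
split.
- by move=> x; rewrite in_itv/= => /andP[x0 _]; case: (sderiv_is_derive df x0).
- apply/cvgrPdist_le => e e0; have [d d0 hd] := cf 0 (lexx _) e e0.
  near=> s; have s0 : 0 < s by near: s; exact: nbhs_right_gt.
  rewrite distrC; apply: hd; first exact: ltW.
  by rewrite subr0 gtr0_norm//; near: s; exact: nbhs_right_lt.
- apply: cvg_at_left_filter; exact: scont_cvg.
Unshelve. all: by end_near. Qed.

Lemma sderiv_mean f g T m : 0 <= T -> sderiv f g ->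
  (forall t, 0 <= t <= T -> `|g t| <= m) -> `|f T - f 0| <= T * m.
Proof.
rewrite le_eqVlt => /orP[/eqP <- _ _|T0 df gm]; first by rewrite subrr normr0 mul0r.
have cf : scont f := cderiv_cont normr_seminorm df.
have [x|x xT ->] := @MVT _ f g 0 T T0 _ (@scont_within f T cf).
  by rewrite in_itv/= => /andP[x0 _]; exact: sderiv_is_derive.
move: xT; rewrite in_itv/= subr0 => /andP[x0 xT].
by rewrite normrM mulrC (gtr0_norm T0) ler_wpM2l ?(ltW T0)// gm// !ltW.
Qed.

(** The differential inequality of the multiplier method is integrated here: [g] is
    continuous, while its bound [h] is only integrable, being made of squared
    traces. *)
Lemma sderiv_integral_le f g h T : 0 < T -> sderiv f g -> scont g ->
  (@lebesgue_measure R).-integrable `]0, T[ (EFin \o h) ->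
  (forall t, 0 < t < T -> g t <= h t) ->
  f T - f 0 <= \int[lebesgue_measure]_(t in `]0, T[) h t.
Proof.
move=> T0 df cg ih gh.
have cgT := @scont_within g T cg.
have := continuous_FTC2 T0 cgT (sderiv_LR T0 df) _ => /(_ _) h1.
have {}h1 : (\int[lebesgue_measure]_(x in `[0%R, T]) (g x)%:E = (f T)%:E - (f 0)%:E)%E.
  apply: h1 => x; rewrite in_itv/= => /andP[x0 _].
  by rewrite derive1E; case: (sderiv_is_derive df x0).
have ig : (@lebesgue_measure R).-integrable `[0, T] (EFin \o g).
  by apply: continuous_compact_integrable => //; exact: segment_compact.
have -> : f T - f 0 = \int[lebesgue_measure]_(t in `[0, T]) g t.
  by rewrite /Rintegral h1.
have iS : `]0, T[%classic `<=` `[0, T]%classic by exact: subset_itv_oo_cc.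
have ig' : (@lebesgue_measure R).-integrable `]0, T[ (EFin \o g).
  by apply: integrableS ig.
have -> : \int[lebesgue_measure]_(t in `[0, T]) g t = \int[lebesgue_measure]_(t in `]0, T[) g t.
  rewrite -Rintegral_itv_obnd_cbnd; last first.
    by apply: integrableS ig => //; exact: subset_itv_oc_cc.
  by rewrite Rintegral_itv_bndo_bndc.
apply: le_Rintegral => // t; rewrite /= in_itv/=; exact: gh.
Qed.

End NormCurves.

(** * Abstract evolutions and the multiplier method *)

Section Evolution.
Context {R : realType} {H V : lmodType R} (iota : {linear V -> H}).
Variables (A : V -> H -> Prop) (S : H -> H -> R) (G : V -> V -> R).
Implicit Types (s t e d k m T : R).

Local Notation nS := (snorm S).
Local Notation nG := (snorm G).

Hypotheses (hS : semi_inner S) (hG : semi_inner G).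
Hypothesis A_affine : forall c z f z' f',
  A z f -> A z' f' -> A (c *: z + z') (c *: f + f').
Hypothesis green : forall z f v, A z f -> S f (iota v) = - G z v.

Let snS := snorm_seminorm hS.
Let snG := snorm_seminorm hG.

(** A solution [y] of [y'' = A y] in integrated form: [v] is its velocity and [w]
    is a primitive of [y] whose increments lie in the domain of [A].  Neither
    [y t] nor [v t] is assumed to be more regular than the energy allows. *)
Record evolution (w y : R -> V) (v : R -> H) : Prop := Evolution {
  evo_wy : cderiv nG w y;
  evo_yv : cderiv nS (iota \o y) v;
  evo_y : ccont nG y;
  evo_v : ccont nS v;
  evo_A : forall s t, 0 <= s -> 0 <= t -> A (w t - w s) (v t - v s) }.

(** Difference quotients in time.  Those of [w] lie in the domain of [A], hence
    are strong solutions, and they tend to [y]; they regularize the evolution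
    without any resolvent or semigroup. *)
Definition diffq {E : lmodType R} k (u : R -> E) (t : R) : E :=
  k^-1 *: (u (t + k) - u t).

Lemma diffqE {E : lmodType R} k (u : R -> E) :
  diffq k u = fun t => k^-1 *: u (t + k) + (- k^-1) *: u t.
Proof. by apply/funext => t; rewrite /diffq scalerBr scaleNr. Qed.

Lemma cderiv_diffq (E : lmodType R) (N : E -> R) k y v : seminorm N -> 0 < k ->
  cderiv N y v -> cderiv N (diffq k y) (diffq k v).
Proof.
move=> hN k0 dy; rewrite !diffqE.
have d0 : cderiv N (fun t => - k^-1 *: y t) (fun t => - k^-1 *: v t).
  have := cderiv_affine hN (- k^-1) dy (cderiv_cst hN 0).
  by under eq_fun do rewrite addr0; under [X in cderiv _ _ X]eq_fun do rewrite addr0.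
by apply: cderiv_affine => //; apply: cderiv_shift => //; exact: ltW.
Qed.

Lemma ccont_diffq (E : lmodType R) (N : E -> R) k y : seminorm N -> 0 < k ->
  ccont N y -> ccont N (diffq k y).
Proof.
move=> hN k0 cy; rewrite diffqE.
have c0 : ccont N (fun t => - k^-1 *: y t).
  have := ccont_affine hN (- k^-1) cy (cderiv_cont hN (cderiv_cst hN 0)).
  by under eq_fun do rewrite addr0.
by apply: ccont_affine => //; apply: ccont_shift => //; exact: ltW.
Qed.

Lemma diffq_iota k (y : R -> V) t : diffq k (iota \o y) t = iota (diffq k y t).
Proof. by apply/esym; rewrite /diffq /= linearZ linearB. Qed.

Lemma evolution_diffq w y v k : 0 < k -> evolution w y v ->
  evolution (diffq k w) (diffq k y) (diffq k v).
Proof.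
move=> k0 [wy yv cy cv hA]; split.
- exact: cderiv_diffq.
- have -> : iota \o diffq k y = diffq k (iota \o y).
    by apply/funext => t; rewrite diffq_iota.
  exact: cderiv_diffq.
- exact: ccont_diffq.
- exact: ccont_diffq.
- move=> s t s0 t0; rewrite /diffq -!scalerBr.
  have hD (E : lmodType R) (u : R -> E) :
      k^-1 *: (u (t + k) - u t - (u (s + k) - u s)) =
      k^-1 *: (u (t + k) - u (s + k)) + ((- k^-1) *: (u t - u s) + 0).
    rewrite addr0 scaleNr -scalerBr; congr (_ *: _).
    by rewrite !opprB addrACA [RHS]addrACA; congr (_ + _); rewrite addrC.
  rewrite !hD; apply: A_affine; first by apply: hA; rewrite addr_ge0// ltW.
  apply: A_affine; first exact: hA.
  by have := hA 0 0 (lexx _) (lexx _); rewrite !subrr.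
Qed.

Lemma evolution_strong w y v k t : 0 < k -> evolution w y v -> 0 <= t ->
  A (diffq k w t) (diffq k v t).
Proof.
move=> k0 [_ _ _ _ hA] t0.
have A0 : A 0 0 by have := hA 0 0 (lexx _) (lexx _); rewrite !subrr.
have := A_affine k^-1 (hA t (t + k) t0 (addr_ge0 t0 (ltW k0))) A0.
by rewrite !addr0.
Qed.

Lemma diffq_near (E : lmodType R) (N : E -> R) y v t : seminorm N -> 0 <= t ->
  cderiv N y v -> forall e, 0 < e -> exists2 d : R, 0 < d &
    forall k, 0 < k -> k < d -> N (diffq k y t - v t) <= e.
Proof.
move=> [N0 ND NZ] t0 dy e e0; have [d d0 hd] := dy t t0 e e0.
exists d => // k k0 kd.
have tk : t + k - t = k by rewrite addrAC subrr add0r.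
have := hd (t + k) (addr_ge0 t0 (ltW k0)); rewrite tk gtr0_norm// => /(_ kd) h.
have -> : diffq k y t - v t = k^-1 *: (y (t + k) - y t - k *: v t).
  by rewrite scalerBr scalerA mulVf ?gt_eqF// scale1r.
by rewrite NZ gtr0_norm ?invr_gt0// ler_pdivrMl// mulrC.
Qed.

(** Twice the energy. *)
Definition energy2 (u : H) (z : V) := S u u + G z z.
Definition nE u z := Num.sqrt (energy2 u z).

Lemma energy2_ge0 u z : 0 <= energy2 u z.
Proof. by rewrite addr_ge0 ?sip_ge0. Qed.

Lemma nE_ge0 u z : 0 <= nE u z. Proof. exact: sqrtr_ge0. Qed.

Lemma sqr_nE u z : nE u z ^+ 2 = energy2 u z.
Proof. by rewrite sqr_sqrtr// energy2_ge0. Qed.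

Lemma nS_le_nE u z : nS u <= nE u z.
Proof. by rewrite ler_sqrt ?energy2_ge0// lerDl sip_ge0. Qed.

Lemma nG_le_nE u z : nG z <= nE u z.
Proof. by rewrite ler_sqrt ?energy2_ge0// lerDr sip_ge0. Qed.

Lemma nE_le u z : nE u z <= nS u + nG z.
Proof.
rewrite -(@ler_pXn2r _ 2)// ?nnegrE ?addr_ge0 ?snorm_ge0 ?nE_ge0//.
rewrite sqr_nE sqrrD !sqr_snorm// /energy2 lerD2r lerDl.
by rewrite mulrn_wge0// mulr_ge0 ?snorm_ge0.
Qed.

Let pairS (p q : H * V) : R := S p.1 q.1 + G p.2 q.2.

Lemma pairS_semi : semi_inner pairS.
Proof.
split=> [c u v w|u v|u]; rewrite /pairS /=.
- by rewrite (sipl hS) (sipl hG); ring.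
- by rewrite (sipC hS) (sipC hG).
- by rewrite addr_ge0 ?sip_ge0.
Qed.

Lemma nED u z u' z' : nE (u + u') (z + z') <= nE u z + nE u' z'.
Proof. exact: (snormD pairS_semi (u, z) (u', z')). Qed.

Lemma nEZ c u z : nE (c *: u) (c *: z) = `|c| * nE u z.
Proof. exact: (snormZ pairS_semi c (u, z)). Qed.

Lemma nE_dist u z u' z' : `|nE u z - nE u' z'| <= nS (u - u') + nG (z - z').
Proof.
apply: le_trans (nE_le _ _); exact: (snorm_dist pairS_semi (u, z) (u', z')).
Qed.

Lemma sderiv_sip (E : lmodType R) (N : E -> E -> R) y y' : semi_inner N ->
  cderiv (snorm N) y y' -> sderiv (fun t => N (y t) (y t)) (fun t => 2 * N (y' t) (y t)).
Proof.
move=> hN dy; have sN := snorm_seminorm hN.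
have := @cderiv_bilin R E E _ _ N 1 sN sN (fun k u v w => sipl hN k u v w)
  _ ler01 _ _ _ _ _ dy dy.
rewrite /sderiv; move=> h; have {}h := h _ _.
have -> : (fun t => 2 * N (y' t) (y t)) = (fun t => N (y' t) (y t) + N (y t) (y' t)).
  by apply/funext => t; rewrite (sipC hN (y t)) mulr_natl mulr2n.
apply: h => [k u v w|u v]; first by rewrite (sipDr hN) (sipZr hN).
by rewrite mul1r cauchy_schwarz.
Qed.

Lemma sderiv_sipr (E : lmodType R) (N : E -> E -> R) y y' (c : E) : semi_inner N ->
  cderiv (snorm N) y y' -> sderiv (fun t => N (y t) c) (fun t => N (y' t) c).
Proof.
move=> hN dy; have sN := snorm_seminorm hN.
have := @cderiv_bilin R E E _ _ N 1 sN sN (fun k u v w => sipl hN k u v w)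
  _ ler01 _ _ _ _ _ dy (cderiv_cst sN c).
rewrite /sderiv; move=> h; have {}h := h _ _.
have -> : (fun t => N (y' t) c) = (fun t => N (y' t) c + N (y t) 0).
  by apply/funext => t; rewrite (sipC hN (y t)) (sip0l hN) addr0.
apply: h => [k u v w|u v]; first by rewrite (sipDr hN) (sipZr hN).
by rewrite mul1r cauchy_schwarz.
Qed.

Lemma sderivD f g f' g' : sderiv f f' -> sderiv g g' ->
  sderiv (fun t => f t + g t) (fun t => f' t + g' t).
Proof.
move=> df dg; have := cderiv_affine (@normr_seminorm R) 1 df dg.
have h (f1 f2 : R -> R) : (fun t => f1 t + f2 t) = (fun t => 1 *: (f1 t : R^o) + f2 t).
  by apply/funext => t; rewrite scale1r.
by rewrite /sderiv (h f) (h f').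
Qed.

Lemma sderivZ c f f' : sderiv f f' -> sderiv (fun t => c * f t) (fun t => c * f' t).
Proof.
move=> df; have := cderiv_affine (@normr_seminorm R) c df (cderiv_cst (@normr_seminorm R) 0).
have h (f1 : R -> R) : (fun t => c * f1 t) = (fun t => c *: (f1 t : R^o) + 0).
  by apply/funext => t; rewrite addr0.
by rewrite /sderiv (h f) (h f').
Qed.

(** The derivative of the energy of [diffq k w] is zero by [green]. *)
Lemma strong_energy w y v k t : evolution w y v -> 0 < k -> 0 <= t ->
  nE (diffq k (iota \o y) t) (diffq k w t) = nE (diffq k (iota \o y) 0) (diffq k w 0).
Proof.
move=> ev k0 t0; have [wy yv cy cv hA] := ev.
congr Num.sqrt; apply/eqP; rewrite -subr_eq0 -normr_le0.
rewrite -[leRHS](mulr0 t).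
pose f t := S (diffq k (iota \o y) t) (diffq k (iota \o y) t) + G (diffq k w t) (diffq k w t).
apply: (@sderiv_mean _ f (fun s => 2 * S (diffq k v s) (diffq k (iota \o y) s) +
    2 * G (diffq k y s) (diffq k w s)) t 0 t0).
  by apply: sderivD; apply: sderiv_sip => //; exact: cderiv_diffq.
move=> s /andP[s0 _]; rewrite normr_le0; apply/eqP.
rewrite diffq_iota (green _ (evolution_strong k0 ev s0)) (sipC hG (diffq k y s)); ring.
Qed.

(** Energy is conserved: strong solutions satisfy it by differentiation, and
    a general evolution is the limit of the strong ones [diffq k w]. *)
Lemma energy_conservation w y v t : evolution w y v -> 0 <= t ->
  nE (v t) (y t) = nE (v 0) (y 0).
Proof.
move=> ev t0; have [wy yv cy cv hA] := ev.
apply/eqP; rewrite -subr_eq0 -normr_le0; apply/ler_addgt0Pl => e e0.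
rewrite addr0.
have e4 : 0 < e / 4 by rewrite divr_gt0.
have [d1 d10 h1] := diffq_near snG t0 wy e4.
have [d2 d20 h2] := diffq_near snS t0 yv e4.
have [d3 d30 h3] := diffq_near snG (lexx 0) wy e4.
have [d4 d40 h4] := diffq_near snS (lexx 0) yv e4.
pose d := Num.min (Num.min d1 d2) (Num.min d3 d4).
have d0 : 0 < d by rewrite !lt_min d10 d20 d30.
pose k := d / 2; have k0 : 0 < k by rewrite divr_gt0.
have : k < d by rewrite ltr_pdivrMr// ltr_pMr// ltr1n.
rewrite !lt_min => /andP[/andP[/(h1 k k0) {}h1 /(h2 k k0) {}h2] /andP[/(h3 k k0) {}h3 /(h4 k k0) {}h4]].
have := nE_dist (diffq k (iota \o y) t) (diffq k w t) (v t) (y t).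
have := nE_dist (diffq k (iota \o y) 0) (diffq k w 0) (v 0) (y 0).
rewrite (strong_energy ev k0 t0) !ler_norml => /andP[a1 a2] /andP[a3 a4].
by apply/andP; split; lra.
Qed.

Variable cl : R.
Hypothesis cl0 : 0 <= cl.
(** Lower semicontinuity, up to the constant [cl], of the norm of [V] for
    convergence in [H]. *)
Hypothesis lsc : forall u m,
  (forall e, 0 < e -> exists r, nS (iota (u - r)) <= e /\ nG r <= m) ->
  nG u <= cl * m.

(** [w] is the integral of [y] over [[0, t]] for the weaker norm of [H], as in the
    definition of a mild solution; [riemann_cderiv] recovers the norm of [V]. *)
Definition riemann (y : R -> V) t (w : V) := forall e, 0 < e ->
  exists2 d : R, 0 < d & forall (n : nat) (p xi : nat -> R),
    p 0%N = 0 -> p n = t ->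
    (forall i, (i < n)%N -> p i <= xi i <= p i.+1 /\ p i.+1 - p i < d) ->
    nS (iota (w - \sum_(i < n) (p i.+1 - p i) *: y (xi i))) <= e.

Lemma snorm_sum_le n (r : 'I_n -> V) m : (forall i, nG (r i) <= m) ->
  nG (\sum_(i < n) r i) <= n%:R * m.
Proof.
move=> hr; elim: n r hr => [|n IH] r hr; first by rewrite big_ord0 snorm0// mul0r.
rewrite big_ord_recr/= (le_trans (snormD hG _ _))// -natr1 mulrDl mul1r lerD//.
exact: IH.
Qed.

(** The Riemann sums of [w t - w s - (t - s) c] over [s, t] are bounded in [V],
    so lower semicontinuity turns their convergence in [H] into a bound in [V]. *)
Lemma riemann_increment y s t ws wt (c : V) m : 0 <= s -> s <= t ->
  riemann y s ws -> riemann y t wt ->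
  (forall xi, s <= xi <= t -> nG (y xi - c) <= m) ->
  nG (wt - ws - (t - s) *: c) <= cl * ((t - s) * m).
Proof.
move=> s0 st rs rt ym; apply: lsc => e e0.
have e2 : 0 < e / 2 by rewrite divr_gt0.
have [d1 d10 h1] := rs _ e2; have [d2 d20 h2] := rt _ e2.
pose d := Num.min d1 d2; have d0 : 0 < d by rewrite lt_min d10.
pose n1 := (Num.truncn (s / d)).+1; pose n2 := (Num.truncn ((t - s) / d)).+1.
have n10 : 0 < n1%:R :> R by rewrite ltr0n.
have n20 : 0 < n2%:R :> R by rewrite ltr0n.
have ts0 : 0 <= t - s by rewrite subr_ge0.
have sn1 : s / n1%:R < d by rewrite ltr_pdivrMr// mulrC -ltr_pdivrMr// truncnS_gt.
have sn2 : (t - s) / n2%:R < d by rewrite ltr_pdivrMr// mulrC -ltr_pdivrMr// truncnS_gt.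
pose p i : R := if (i <= n1)%N then s * (i%:R / n1%:R) else s + (t - s) * ((i - n1)%:R / n2%:R).
have pL i : (i <= n1)%N -> p i = s * (i%:R / n1%:R) by rewrite /p => ->.
have pR i : p (n1 + i)%N = s + (t - s) * (i%:R / n2%:R).
  rewrite /p; case: i => [|i].
    by rewrite addn0 leqnn divff ?gt_eqF// mulr1 mul0r mulr0 addr0.
  by rewrite -[X in (_ <= X)%N]addn0 leq_add2l ltn0 addKn.
have pLS i : (i < n1)%N -> p i.+1 - p i = s / n1%:R.
  by move=> i1; rewrite !pL// 1?ltnW// -natr1; field; rewrite gt_eqF.
have pRS i : p (n1 + i).+1 - p (n1 + i)%N = (t - s) / n2%:R.
  by rewrite -addnS !pR -natr1; field; rewrite gt_eqF.
have p0 : p 0%N = 0 by rewrite pL// mul0r mulr0.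
have p1 : p n1 = s by rewrite pL// divff ?gt_eqF// mulr1.
have p2 : p (n1 + n2)%N = t by rewrite pR divff ?gt_eqF// mulr1 addrC subrK.
have pinc i : p i <= p i <= p i.+1 /\ p i.+1 - p i < d.
  rewrite lexx/= -subr_ge0; have [i1|i1] := ltnP i n1.
    by rewrite pLS// divr_ge0// ltW.
  by rewrite -(subnKC i1) pRS divr_ge0// ltW.
have dd1 i : (i < n1)%N -> p i <= p i <= p i.+1 /\ p i.+1 - p i < d1.
  by move=> _; have [-> h] := pinc i; split=> //; apply: lt_le_trans h _; rewrite ge_min lexx.
have dd2 i : (i < n1 + n2)%N -> p i <= p i <= p i.+1 /\ p i.+1 - p i < d2.
  by move=> _; have [-> h] := pinc i; split=> //; apply: lt_le_trans h _; rewrite ge_min lexx orbT.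
have {}h1 := h1 n1 p p p0 p1 dd1.
have {}h2 := h2 (n1 + n2)%N p p p0 p2 dd2.
exists (\sum_(j < n2) ((t - s) / n2%:R) *: (y (p (n1 + j)%N) - c)); split; last first.
  have -> : (t - s) * m = n2%:R * ((t - s) / n2%:R * m) by field; rewrite gt_eqF.
  apply: snorm_sum_le => j; rewrite snormZ// ger0_norm ?divr_ge0//.
  rewrite ler_wpM2l ?divr_ge0// ym// pR lerDl mulr_ge0//=.
  rewrite -lerBrDl ler_piMr// ler_pdivrMr// mul1r ler_nat; exact: ltnW.
have -> : wt - ws - (t - s) *: c - \sum_(j < n2) ((t - s) / n2%:R) *: (y (p (n1 + j)%N) - c)
  = (wt - \sum_(i < n1 + n2) (p i.+1 - p i) *: y (p i)) -
    (ws - \sum_(i < n1) (p i.+1 - p i) *: y (p i)).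
  rewrite big_split_ord/=.
  under [X in _ = wt - (_ + X) - _]eq_bigr do rewrite pRS.
  rewrite -2!scaler_sumr sumrB sumr_const card_ord scalerBr.
  rewrite -[c *+ n2]scaler_nat scalerA divfK ?gt_eqF//.
  set a := \sum_(i < n1) _; set b := _ *: \sum_(i < n2) _.
  rewrite !opprB !opprD !addrA subrK.
  by rewrite [wt - a - b]addrAC subrK [RHS]addrAC.
rewrite linearB (le_trans (snormD hS _ _))// snormN// (splitr e) lerD//.
Qed.

Lemma riemann_cderiv w y : ccont nG y -> (forall t, 0 <= t -> riemann y t (w t)) ->
  cderiv nG w y.
Proof.
move=> cy rw t t0 e e0.
have e1 : 0 < e / (cl + 1) by rewrite divr_gt0// ltr_wpDl.
have [d d0 hd] := cy t t0 _ e1; exists d => // s s0 st.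
suff : nG (w s - w t - (s - t) *: y t) <= cl * (`|s - t| * (e / (cl + 1))).
  move=> /le_trans; apply; rewrite mulrCA mulrC ler_wpM2r//.
  by rewrite mulrCA ler_piMr ?(ltW e0)// ler_pdivrMr ?ltr_wpDl// mul1r lerDl.
have [ts|ts] := leP t s.
  rewrite ger0_norm ?subr_ge0//; apply: (riemann_increment (y := y)) => //; try exact: rw.
  move=> xi /andP[x1 x2]; apply: hd; first exact: le_trans x1.
  rewrite ger0_norm ?subr_ge0//; rewrite ger0_norm ?subr_ge0// in st.
  by apply: le_lt_trans st; rewrite lerD2r.
rewrite ltr0_norm ?subr_lt0// opprB.
have -> : w s - w t - (s - t) *: y t = - (w t - w s - (t - s) *: y t).
  by rewrite -(opprB t s) scaleNr opprK opprB opprB addrC.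
rewrite snormN//; apply: (riemann_increment (y := y)) => //; try exact: rw.
  exact: ltW.
move=> xi /andP[x1 x2]; apply: hd; first exact: le_trans x1.
rewrite ler0_norm ?subr_le0// opprB; rewrite ltr0_norm ?subr_lt0// opprB in st.
by apply: le_lt_trans st; rewrite lerD2l lerN2.
Qed.

(** Bootstrap: a bounded nonnegative function whose square is controlled by
    [c] times any of its own bounds is bounded by [c]. *)
Lemma bootstrap (D : set R) (f : R -> R) c m0 : 0 <= c ->
  (forall s, D s -> 0 <= f s <= m0) ->
  (forall m, (forall s, D s -> f s <= m) -> forall s, D s -> f s ^+ 2 <= c * m) ->
  forall s, D s -> f s <= c.
Proof.
move=> c0 fb fm s Ds.
pose X := [set f r | r in D].
have hX : has_sup X.
  by split; [exists (f s), s|exists m0 => _ [r Dr <-]; case/andP: (fb r Dr)].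
have fX r : D r -> f r <= sup X by move=> Dr; apply: sup_upper_bound => //; exists r.
have X0 : 0 <= sup X by apply: le_trans (fX s Ds); case/andP: (fb s Ds).
have sq := fm _ fX.
have : sup X <= Num.sqrt (c * sup X).
  apply: ge_sup; first by exists (f s), s.
  move=> _ [r Dr <-]; have /andP[fr0 _] := fb r Dr.
  by rewrite -(ger0_norm fr0) -sqrtr_sqr ler_sqrt ?mulr_ge0 ?sq.
rewrite -(@ler_pXn2r _ 2) ?nnegrE// ?sqrtr_ge0// sqr_sqrtr ?mulr_ge0//.
have [X00|Xn] := eqVneq (sup X) 0.
  by move=> _; have := fX s Ds; rewrite X00 => /le_trans; apply.
rewrite expr2 ler_pM2r ?lt_def ?Xn// => h; exact: le_trans (fX s Ds) h.
Qed.

Section InitialData.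
Variables (w y : R -> V) (v : R -> H) (f0 : H) (y1 : V).
Hypothesis ev : evolution w y v.
Hypothesis Ay0 : A (y 0) f0.
Hypothesis vy1 : nS (v 0 - iota y1) = 0.

(** The deviation of the solution from its affine part, and a primitive of it. *)
Let q t : V := y t - y 0 - t *: y1.
Let Q t : V := w t - w 0 - t *: y 0 - (t ^+ 2 / 2) *: y1.

(** Expanding the squares, conservation of energy cancels the quadratic terms; the
    others are integrals of [A] against [y1] and [f0] by [green]. *)
Lemma q_energy t : 0 <= t ->
  energy2 (v t - v 0) (q t) = 2 * (G (Q t) y1 - t * G (q t) y1 + S (iota (q t)) f0).
Proof.
move=> t0; have [wy yv cy cv hA] := ev.
have e0 : S (v t) (v t) + G (y t) (y t) = S (v 0) (v 0) + G (y 0) (y 0).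
  by have := energy_conservation ev t0 => /(congr1 (fun x => x ^+ 2)); rewrite !sqr_nE.
have v0 f : S (v 0) f = S (iota y1) f.
  by apply/eqP; rewrite -subr_eq0 -(sipBl hS) (snorm_null_sip hS).
have e1 : S (v t) (iota y1) = S (v 0) (v 0) - (G (w t) y1 - G (w 0) y1).
  have := green y1 (hA 0 t (lexx _) t0).
  have s0 : S (v 0) (v 0) = S (iota y1) (iota y1) by rewrite v0 (sipC hS) v0.
  rewrite (sipBl hS) (sipBl hG) v0 s0 => h; lra.
have g z : S f0 (iota z) = - G (y 0) z by apply: green.
have vt : S (v t) (v 0) = S (v t) (iota y1) by rewrite (sipC hS) v0 (sipC hS).
rewrite /energy2 (sipBl hS) !(sipBr hS) (sipC hS (v 0) (v t)) vt.
rewrite /q /Q (sipC hS _ f0) g.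
rewrite !(sipBl hG) !(sipBr hG) !(sipZl hG) !(sipZr hG).
rewrite (sipC hG (y t) (y 0)) (sipC hG y1 (y 0)) (sipC hG y1 (y t)) e1.
move: e0 e1; lra.
Qed.

Let C : R := 4 * nG y1 + 2 * nS f0.

Let C0 : 0 <= C.
Proof. by rewrite addr_ge0 ?mulr_ge0 ?snorm_ge0. Qed.

(** The derivatives of [G (Q s) y1] and [S (iota (q s)) f0] are controlled by the
    very quantity to be bounded, so [q_energy] is the hypothesis of
    [bootstrap]. *)
Lemma q_bound t : 0 <= t -> nE (v t - v 0) (q t) <= C * t.
Proof.
move=> t0; have [wy yv cy cv hA] := ev.
pose m0 := nE (v 0) (y 0) + nE (v 0) (y 0) + t * nG y1.
apply: (@bootstrap [set s | 0 <= s <= t] (fun s => nE (v s - v 0) (q s)) (C * t) m0).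
- by rewrite mulr_ge0.
- move=> s /andP[s0 st]; rewrite nE_ge0/=.
  have -> : v s - v 0 = v s + (-1 *: v 0 + 0) by rewrite addr0 scaleN1r.
  have -> : q s = y s + (-1 *: y 0 + (- s) *: y1).
    by rewrite scaleN1r scaleNr addrA.
  rewrite (le_trans (nED _ _ _ _))// (energy_conservation ev s0) /m0 -addrA lerD2l.
  rewrite (le_trans (nED _ _ _ _))// nEZ normrN1 mul1r lerD2l.
  rewrite (le_trans (nE_le _ _))// snorm0// add0r snormZ// normrN ger0_norm//.
  by rewrite ler_wpM2r ?snorm_ge0.
- move=> m hm s /andP[s0 st]; rewrite sqr_nE q_energy//.
  have hqm r : 0 <= r <= s -> nG (q r) <= m.
    move=> /andP[r0 rs]; apply: le_trans (nG_le_nE (v r - v 0) _) _.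
    by apply: hm; rewrite /= r0 (le_trans rs).
  have hvm r : 0 <= r <= s -> nS (v r - iota y1) <= m.
    move=> /andP[r0 rs]; have -> : nS (v r - iota y1) = nS (v r - v 0).
      apply/eqP; rewrite eq_le; apply/andP; split.
        by rewrite (le_trans (snorm_triangle hS _ (v 0) _))// vy1 addr0.
      by rewrite (le_trans (snorm_triangle hS _ (iota y1) _))// (snormB hS (iota y1)) vy1 addr0.
    apply: le_trans (nS_le_nE _ (q r)) _.
    by apply: hm; rewrite /= r0 (le_trans rs).
  have m00 : 0 <= m by apply: le_trans (hqm 0 _); rewrite ?snorm_ge0// lexx.
  have dq : cderiv nS (iota \o q) (fun r => v r - iota y1).
    have -> : iota \o q = (fun r => 1 *: (iota \o y) r + ((-1) *: (r *: iota y1) + - iota (y 0))).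
      apply/funext => r; rewrite /q /= !linearB linearZ/= scale1r scaleN1r.
      by rewrite -addrA; congr (_ + _); rewrite addrC.
    have -> : (fun r => v r - iota y1) = (fun r => 1 *: v r + ((-1) *: iota y1 + 0)).
      by apply/funext => r; rewrite scale1r scaleN1r addr0.
    apply: cderiv_affine => //; apply: cderiv_affine => //; first exact: cderiv_linear.
    exact: cderiv_cst.
  have dQ : cderiv nG Q q.
    have -> : Q = (fun r => 1 *: w r + ((-1) *: (r *: y 0) + ((-1) *: ((r ^+ 2 / 2) *: y1) + - w 0))).
      apply/funext => r; rewrite /Q scale1r !scaleN1r -!addrA; congr (_ + _).
      by rewrite addrC -!addrA.
    have -> : q = (fun r => 1 *: y r + ((-1) *: y 0 + ((-1) *: (r *: y1) + 0))).
      by apply/funext => r; rewrite /q scale1r !scaleN1r addr0 -addrA.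
    apply: cderiv_affine => //; apply: cderiv_affine => //; first exact: cderiv_linear.
    apply: cderiv_affine => //; [exact: cderiv_square|exact: cderiv_cst].
  have Q0 : Q 0 = 0 by rewrite /Q subrr expr0n mul0r !scale0r !subr0.
  have q0 : q 0 = 0 by rewrite /q subrr scale0r subr0.
  have b1 : `|G (Q s) y1| <= s * (m * nG y1).
    have := @sderiv_mean _ _ _ s (m * nG y1) s0 (sderiv_sipr y1 hG dQ).
    rewrite Q0 (sip0l hG) subr0; apply => r rs.
    rewrite (le_trans (cauchy_schwarz hG _ _))// ler_wpM2r ?snorm_ge0//; exact: hqm.
  have b2 : `|S (iota (q s)) f0| <= s * (m * nS f0).
    have := @sderiv_mean _ _ _ s (m * nS f0) s0 (sderiv_sipr f0 hS dq).
    rewrite /= q0 linear0 (sip0l hS) subr0; apply => r rs.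
    rewrite (le_trans (cauchy_schwarz hS _ _))// ler_wpM2r ?snorm_ge0//; exact: hvm.
  have b3 : `|s * G (q s) y1| <= s * (m * nG y1).
    rewrite normrM ger0_norm// ler_wpM2l// (le_trans (cauchy_schwarz hG _ _))//.
    by rewrite ler_wpM2r ?snorm_ge0// hqm// s0 lexx.
  apply: (@le_trans _ _ (C * s * m)); last by rewrite ler_wpM2r// ler_wpM2l.
  move: b1 b2 b3; rewrite /C !ler_norml => /andP[_ b1] /andP[_ b2] /andP[b3 _]; lra.
- by rewrite /= t0 lexx.
Qed.

(** With regular initial data, the difference quotients of the solution have
    bounded energy: the energy is conserved, and at time [0] it is [q_bound]. *)
Lemma diffq_energy_bound k t : 0 < k -> 0 <= t ->
  nE (diffq k v t) (diffq k y t) <= C + nG y1.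
Proof.
move=> k0 t0; rewrite (energy_conservation (evolution_diffq k0 ev) t0).
rewrite /diffq !add0r nEZ gtr0_norm ?invr_gt0// ler_pdivrMl//.
have -> : v k - v 0 = (v k - v 0) + 0 by rewrite addr0.
have -> : y k - y 0 = q k + k *: y1 by rewrite /q subrK.
rewrite (le_trans (nED _ _ _ _))// mulrDr mulrC lerD//; first exact/q_bound/ltW.
by rewrite (le_trans (nE_le _ _))// snorm0// add0r snormZ// gtr0_norm.
Qed.

End InitialData.

Variables (X : H -> V -> R) (cX cP : R).
Hypotheses (cX0 : 0 <= cX) (cP0 : 0 <= cP).
Hypothesis Xl : forall c u v w, X (c *: u + v) w = c * X u w + X v w.
Hypothesis Xr : forall c u v w, X w (c *: u + v) = c * X w u + X w v.
Hypothesis X_young : forall u v, `|2 * X u v| <= S u u + cX * G v v.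
Hypothesis poincare : forall u, S (iota u) (iota u) <= cP * G u u.

(** [X_young] applied to multiples of [u] and [v] of norm almost one. *)
Lemma X_bounded u v : `|X u v| <= (1 + cX) * (nS u * nG v).
Proof.
apply/ler_addgt0Pl => e e0.
set a := nS u; set b := nG v; set c := 1 + cX.
have a0 : 0 <= a := snorm_ge0 S u; have b0 : 0 <= b := snorm_ge0 G v.
have c0 : 0 < c by rewrite ltr_pwDl.
pose h := Num.min 1 (e / (c * (a + b + 1))).
have m0 : 0 < c * (a + b + 1) by rewrite mulr_gt0// ltr_wpDl// addr_ge0.
have h0 : 0 < h by rewrite lt_min ltr01 divr_gt0.
have h1 : h <= 1 by rewrite ge_min lexx.
have he : h * (c * (a + b + 1)) <= e by rewrite -ler_pdivlMr// ge_min lexx orbT.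
have ah : 0 < a + h by rewrite ltr_wpDl.
have bh : 0 < b + h by rewrite ltr_wpDl.
have := X_young ((a + h)^-1 *: u) ((b + h)^-1 *: v).
rewrite (bilZl Xl) (bilZr Xr) (sipZl hS) (sipZr hS) (sipZl hG) (sipZr hG).
rewrite -!sqr_snorm// -/a -/b => hX.
have a1 : (a + h)^-1 * ((a + h)^-1 * a ^+ 2) <= 1.
  rewrite mulrA -expr2 -exprMn exprn_ile1//; first by rewrite mulr_ge0 ?invr_ge0// ltW.
  by rewrite mulrC ler_pdivrMr// mul1r lerDl ltW.
have b1 : (b + h)^-1 * ((b + h)^-1 * b ^+ 2) <= 1.
  rewrite mulrA -expr2 -exprMn exprn_ile1//; first by rewrite mulr_ge0 ?invr_ge0// ltW.
  by rewrite mulrC ler_pdivrMr// mul1r lerDl ltW.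
have {hX} : `|2 * ((a + h)^-1 * ((b + h)^-1 * X u v))| <= c.
  by apply: le_trans hX _; rewrite lerD// -[leRHS]mulr1 ler_wpM2l.
rewrite !normrM (ger0_norm (ler0n R 2)) (gtr0_norm (_ : 0 < (a + h)^-1)) ?invr_gt0//.
rewrite (gtr0_norm (_ : 0 < (b + h)^-1)) ?invr_gt0// => hX.
have {hX} : 2 * `|X u v| <= c * ((a + h) * (b + h)).
  rewrite mulrA -ler_pdivrMr// -ler_pdivrMr//; apply: le_trans hX.
  by rewrite le_eqVlt; apply/orP; left; apply/eqP; field; rewrite !gt_eqF.
move=> hX; have : `|X u v| <= c * ((a + h) * (b + h)) by have := normr_ge0 (X u v); lra.
move=> /le_trans; apply.
have -> : c * ((a + h) * (b + h)) = h * (c * (a + b + h)) + c * (a * b) by ring.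
rewrite lerD2r (le_trans _ he)// ler_wpM2l ?(ltW h0)// ler_wpM2l ?(ltW c0)//.
by rewrite lerD2l.
Qed.

Lemma nS_iota u : nS (iota u) <= Num.sqrt cP * nG u.
Proof. by rewrite -sqrtrM// ler_sqrt// mulr_ge0// sip_ge0. Qed.

Lemma ccont_iota y : ccont nG y -> ccont nS (iota \o y).
Proof.
move=> cy t t0 e e0.
have [d d0 hd] := cy t t0 (e / (Num.sqrt cP + 1)) (divr_gt0 e0 (ltr_wpDl (sqrtr_ge0 _) ltr01)).
exists d => // s s0 st; rewrite /= -linearB (le_trans (nS_iota _))//.
rewrite (le_trans (ler_wpM2l (sqrtr_ge0 _) (hd s s0 st)))// mulrCA ler_piMr ?(ltW e0)//.
by rewrite ler_pdivrMr ?ltr_wpDl ?sqrtr_ge0// mul1r lerDl.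
Qed.

Lemma cderiv_iota y v : cderiv nG y v -> cderiv nS (iota \o y) (iota \o v).
Proof.
move=> cy t t0 e e0.
have [d d0 hd] := cy t t0 (e / (Num.sqrt cP + 1)) (divr_gt0 e0 (ltr_wpDl (sqrtr_ge0 _) ltr01)).
exists d => // s s0 st; rewrite /= -linearZ -!linearB (le_trans (nS_iota _))//.
rewrite (le_trans (ler_wpM2l (sqrtr_ge0 _) (hd s s0 st)))// mulrA ler_wpM2r//.
rewrite mulrCA ler_piMr ?(ltW e0)//.
by rewrite ler_pdivrMr ?ltr_wpDl ?sqrtr_ge0// mul1r lerDl.
Qed.

(** [L d] is an average of the flux over a neighbourhood of length [d] of the end
    where it is observed; it is continuous on [V], which the trace is not. *)
Variables (L : R -> V -> R) (K M e1 B cA : R) (cL : R -> R).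
Hypotheses (K0 : 0 <= K) (e10 : 0 < e1) (cA0 : 0 <= cA) (cL0 : forall d, 0 <= cL d).
Hypothesis LB : forall d u v, L d (u - v) = L d u - L d v.
Hypothesis L_bounded : forall d u, 0 < d -> d <= 2^-1 -> `|L d u| <= cL d * nG u.
Hypothesis multiplier_V : forall u, 2 * X (iota u) u <= - (1 - M - K) * S (iota u) (iota u).
Hypothesis B_bound : forall p q, 0 <= p -> 0 <= q ->
  p + cX * q + K / 4 * (p + cP * q) <= B / 4 * (p + q).

(** [d] is the normal derivative of [z]: it satisfies the inequality given by the
    multiplier, and [e1 * d] is approximated by averages at a rate that depends on
    [f = A z] only through its norm. *)
Definition istrace z f d := 2 * X f z <= e1 * d ^+ 2 - (1 - M) * G z z /\
  forall r, 0 < r -> r <= 2^-1 -> `|L r z - e1 * d| <= cA * Num.sqrt r * nS f.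

Hypothesis trace_exists : forall z f, A z f -> exists d, istrace z f d.

(** The multiplier method for the strong solution [z = diffq k w].  The functional
    [F = 2 X(z', z) - (K / 2) S(z, z')] has derivative
    [2 X(A z, z) + 2 X(z', z') - (K / 2) (S(z', z') - G(z, z))], at most
    [e1 d ^ 2 - (2 - K - 2 M) / 2 E], where the term in [K / 2] balances the
    coefficients of the two parts of the energy [E]; and [|F| <= (B / 4) E]. *)
Lemma multiplier_inequality w y v k T h : evolution w y v -> 0 < k -> 0 < T ->
  itg `]0, T[ h ->
  (forall t d, 0 < t < T -> istrace (diffq k w t) (diffq k v t) d -> e1 * d ^+ 2 <= h t) ->
  (T * (2 - K - 2 * M) - B) / 2 * energy2 (diffq k (iota \o y) 0) (diffq k w 0)
    <= \int[lebesgue_measure]_(t in `]0, T[) h t.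
Proof.
move=> ev k0 T0 ih hh; have [wy yv cy cv hA] := ev.
set E := energy2 _ _.
set z := diffq k w; set y' := diffq k (iota \o y); set u := diffq k y; set a := diffq k v.
have y'E t : y' t = iota (u t) by exact: diffq_iota.
have EE t : 0 <= t -> S (y' t) (y' t) + G (z t) (z t) = E.
  move=> t0; have := strong_energy ev k0 t0 => /(congr1 (fun x => x ^+ 2)).
  by rewrite !sqr_nE.
pose F t := 2 * X (y' t) (z t) + (- (K / 2)) * S (iota (z t)) (y' t).
pose F' t := 2 * (X (a t) (z t) + X (y' t) (u t)) +
  (- (K / 2)) * (S (iota (u t)) (y' t) + S (iota (z t)) (a t)).
have dz : cderiv nG z u by exact: cderiv_diffq.
have dy' : cderiv nS y' a by exact: cderiv_diffq.
have diz : cderiv nS (iota \o z) (iota \o u) by exact: cderiv_iota.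
have cu : ccont nG u by exact: ccont_diffq.
have ca : ccont nS a by exact: ccont_diffq.
have cz : ccont nG z by exact: cderiv_cont dz.
have cy' : ccont nS y' by exact: cderiv_cont dy'.
have ciu : ccont nS (iota \o u) by exact: ccont_iota.
have ciz : ccont nS (iota \o z) by exact: ccont_iota.
have Xb := X_bounded; have Xc0 : 0 <= 1 + cX by rewrite addr_ge0.
have Sl c u1 u2 u3 : S (c *: u1 + u2) u3 = c * S u1 u3 + S u2 u3 by exact: sipl.
have Sr c u1 u2 u3 : S u3 (c *: u1 + u2) = c * S u3 u1 + S u3 u2.
  by rewrite (sipDr hS) (sipZr hS).
have Sb u1 u2 : `|S u1 u2| <= 1 * (nS u1 * nS u2) by rewrite mul1r cauchy_schwarz.
have dF : sderiv F F'.
  apply: sderivD; apply: sderivZ.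
    exact: (cderiv_bilin snS snG Xl Xr Xc0 Xb dy' dz).
  exact: (cderiv_bilin snS snS Sl Sr ler01 Sb diz dy').
have sD f1 f2 c : scont f1 -> scont f2 -> scont (fun t => c * f1 t + f2 t).
  by move=> c1 c2; exact: (ccont_affine (@normr_seminorm R) c c1 c2).
have cF' : scont F'.
  apply: (sD); last first.
    have -> : (fun t => - (K / 2) * (S (iota (u t)) (y' t) + S (iota (z t)) (a t))) =
      (fun t => - (K / 2) * S (iota (u t)) (y' t) + (- (K / 2) * S (iota (z t)) (a t) + 0)).
      by apply/funext => t; rewrite addr0 mulrDr.
    apply: (sD); first exact: (ccont_bilin snS snS Sl Sr ler01 Sb ciu cy').
    apply: (sD); first exact: (ccont_bilin snS snS Sl Sr ler01 Sb ciz ca).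
    exact: (cderiv_cont (@normr_seminorm R) (cderiv_cst (@normr_seminorm R) 0)).
  have -> : (fun t => X (a t) (z t) + X (y' t) (u t)) =
     (fun t => 1 * X (a t) (z t) + X (y' t) (u t)).
    by apply/funext => t; rewrite mul1r.
  apply: (sD); first exact: (ccont_bilin snS snG Xl Xr Xc0 Xb ca cz).
  exact: (ccont_bilin snS snG Xl Xr Xc0 Xb cy' cu).
pose h' t := h t + - ((2 - K - 2 * M) / 2 * E).
have ic : itg `]0, T[ (fun=> - ((2 - K - 2 * M) / 2 * E)) by exact: itg_cst_oo.
have ih' : itg `]0, T[ h'.
  exact: itgD.
have F'h t : 0 < t < T -> F' t <= h' t.
  move=> tT; have t0 : 0 <= t by case/andP: tT => /ltW.
  have hs := evolution_strong k0 ev t0; rewrite -/z -/a in hs.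
  have [d [d1 d2]] := trace_exists hs.
  have hd := hh t d tT (conj d1 d2).
  have := multiplier_V (u t); have := green (z t) hs; have := EE t t0.
  rewrite /h' /F' y'E (sipC hS (iota (z t))) => q1 q2 q3.
  rewrite q2 -q1; move: hd d1 q3; rewrite -/z -/a; lra.
have := sderiv_integral_le T0 dF cF' ih' F'h.
have -> : \int[lebesgue_measure]_(t in `]0, T[) h' t =
  \int[lebesgue_measure]_(t in `]0, T[) h t - (2 - K - 2 * M) / 2 * E * T.
  by rewrite /h' RintegralD// Rint_cst_oo ?(ltW T0)// subr0 mulNr.
have FB t : 0 <= t -> `|F t| <= B / 4 * E.
  move=> t0; rewrite -(EE t t0) (le_trans (ler_normD _ _))//.
  have h1 := X_young (y' t) (z t); have h2 := poincare (z t).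
  have p0 := sip_ge0 hS (y' t); have g0 := sip_ge0 hG (z t).
  apply: le_trans (B_bound p0 g0); rewrite lerD//.
  rewrite normrM normrN (ger0_norm (_ : 0 <= K / 2)) ?divr_ge0//.
  have h3 : `|S (iota (z t)) (y' t)| <= 2^-1 * (S (y' t) (y' t) + S (iota (z t)) (iota (z t))).
    have := sip_ge0 hS (y' t - iota (z t)); have := sip_ge0 hS (y' t + iota (z t)).
    rewrite !(sipDl hS) !(sipDr hS) !(sipNl hS) !(sipNr hS) (sipC hS (iota (z t)) (y' t)) => q1 q2.
    by rewrite ler_norml; apply/andP; split; lra.
  have -> : K / 4 = K / 2 / 2 by field.
  rewrite -mulrA ler_wpM2l ?divr_ge0//; lra.
have := FB T (ltW T0); have := FB 0 (lexx 0); rewrite !ler_norml.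
move=> /andP[f1 f2] /andP[f3 f4]; lra.
Qed.

Section Observability.
Variables (w y : R -> V) (v : R -> H) (f0 : H) (y1 : V) (T : R) (tau : R -> R).
Hypothesis ev : evolution w y v.
Hypothesis rw : forall t, 0 <= t -> riemann y t (w t).
Hypothesis Ay0 : A (y 0) f0.
Hypothesis vy1 : nS (v 0 - iota y1) = 0.
Hypothesis T0 : 0 < T.
Hypothesis itau : itg `]0, T[ (fun t => tau t ^+ 2).
Hypothesis trace_tau : forall t, 0 < t < T -> forall e, 0 < e -> exists2 d0 : R, 0 < d0 &
  forall d, 0 < d -> d < d0 -> `|L d (y t) - e1 * tau t| <= e.

Let C : R := 4 * nG y1 + 2 * nS f0 + nG y1.

Let C0 : 0 <= C.
Proof. by rewrite !addr_ge0 ?mulr_ge0 ?snorm_ge0. Qed.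

(** The solution is Lipschitz in [V], so its means over [[t, t + k]] are within
    [O(k)] of [y t]. *)
Lemma diffq_w_bound k t : 0 < k -> 0 <= t -> nG (diffq k w t - y t) <= cl * C * k.
Proof.
move=> k0 t0.
have -> : diffq k w t - y t = k^-1 *: (w (t + k) - w t - k *: y t).
  by rewrite [RHS]scalerBr scalerA mulVf ?gt_eqF// scale1r.
rewrite snormZ// gtr0_norm ?invr_gt0// ler_pdivrMl//.
have kE : k = (t + k) - t by rewrite addrAC subrr add0r.
rewrite [X in X *: _]kE.
have -> : k * (cl * C * k) = cl * ((t + k - t) * (C * k)) by rewrite -kE; ring.
have tk : t <= t + k by rewrite lerDl ltW.
apply: (riemann_increment (y := y)) => //; [exact: rw|apply: rw; exact: le_trans tk|].
move=> xi /andP[]; rewrite le_eqVlt => /predU1P[<- _|txi xik].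
  by rewrite subrr snorm0// mulr_ge0// ltW.
have xt : 0 < xi - t by rewrite subr_gt0.
have := diffq_energy_bound ev Ay0 vy1 xt t0; rewrite -/C => /(le_trans (nG_le_nE _ _)).
rewrite /diffq [t + _]addrC subrK snormZ// gtr0_norm ?invr_gt0// ler_pdivrMl// => /le_trans; apply.
by rewrite mulrC ler_wpM2l// lerBlDl.
Qed.

Lemma trace_L k t r d : 0 < k -> 0 <= t -> 0 < r -> r <= 2^-1 ->
  istrace (diffq k w t) (diffq k v t) d ->
  `|L r (y t) - e1 * d| <= cL r * (cl * C) * k + cA * C * Num.sqrt r.
Proof.
move=> k0 t0 r0 r2 [_ hd].
have -> : L r (y t) - e1 * d = - L r (diffq k w t - y t) + (L r (diffq k w t) - e1 * d).
  by rewrite LB opprB addrA subrK.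
rewrite (le_trans (ler_normD _ _))// normrN lerD//.
  by rewrite (le_trans (L_bounded _ r0 r2))// -mulrA ler_wpM2l// diffq_w_bound.
rewrite (le_trans (hd r r0 r2))// -!mulrA ler_wpM2l// mulrC ler_wpM2r ?sqrtr_ge0//.
exact: le_trans (nS_le_nE _ _) (diffq_energy_bound ev Ay0 vy1 k0 t0).
Qed.

Lemma L_trace t r : 0 < t < T -> 0 < r -> r <= 2^-1 ->
  `|L r (y t) - e1 * tau t| <= 2 * (cA * C) * Num.sqrt r.
Proof.
move=> tT r0 r2; have t0 : 0 <= t by case/andP: tT => /ltW.
apply/ler_addgt0Pl => e e0.
have e2 : 0 < e / 2 by rewrite divr_gt0.
have [d0 d00 hd] := trace_tau tT e2.
pose r' := Num.min (d0 / 2) r.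
have r'0 : 0 < r' by rewrite lt_min divr_gt0.
have r'r : r' <= r by rewrite ge_min lexx orbT.
have r'2 : r' <= 2^-1 by apply: le_trans r'r r2.
have r'd : r' < d0.
  by apply: (@le_lt_trans _ _ (d0 / 2)); [rewrite ge_min lexx|rewrite ltr_pdivrMr// ltr_pMr// ltr1n].
have {}hd := hd r' r'0 r'd.
pose m := (cL r + cL r') * (cl * C).
have m0 : 0 <= m by rewrite mulr_ge0 ?addr_ge0// mulr_ge0.
pose k := e / 2 / (m + 1).
have k0 : 0 < k by rewrite divr_gt0// ltr_wpDl.
have [d dk] := trace_exists (evolution_strong k0 ev t0).
have h1 := trace_L k0 t0 r0 r2 dk; have h2 := trace_L k0 t0 r'0 r'2 dk.
have sr : cA * C * Num.sqrt r' <= cA * C * Num.sqrt r.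
  by rewrite ler_wpM2l ?mulr_ge0// ler_sqrt// ltW.
have mk : m * k <= e / 2.
  by rewrite /k mulrCA ler_piMr ?(ltW e2)// ler_pdivrMr ?ltr_wpDl// mul1r lerDl.
move: h1 h2 hd sr mk; rewrite /m !ler_norml.
move=> /andP[a1 a2] /andP[a3 a4] /andP[a5 a6] sr mk.
by apply/andP; split; lra.
Qed.

(** The traces of the regularized solutions tend to [tau] uniformly in time.  The
    radius [r] of the averages is chosen first, which makes the two errors in
    [sqrt r] small, and then [k] is taken small for that fixed [r]. *)
Lemma trace_uniform e : 0 < e -> exists2 k0 : R, 0 < k0 &
  forall k t d, 0 < k -> k < k0 -> 0 < t < T ->
    istrace (diffq k w t) (diffq k v t) d -> `|d - tau t| <= e.
Proof.
move=> ep; have e2 : 0 < e1 * e / 2 by rewrite divr_gt0// mulr_gt0.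
pose m := 3 * (cA * C).
have m0 : 0 <= m by rewrite mulr_ge0// mulr_ge0.
pose s := Num.min 2^-1 (e1 * e / 2 / (m + 1)).
have s0 : 0 < s by rewrite lt_min invr_gt0 ltr0n/= divr_gt0// ltr_wpDl.
have s2 : s <= 2^-1 by rewrite ge_min lexx.
pose r := s ^+ 2.
have r0 : 0 < r by rewrite exprn_gt0.
have r2 : r <= 2^-1.
  apply: (le_trans _ s2); rewrite /r expr2 ler_piMr ?(ltW s0)//.
  by apply: (le_trans s2); rewrite invf_le1// ler1n.
have ms : m * Num.sqrt r <= e1 * e / 2.
  rewrite sqrtr_sqr gtr0_norm// (@le_trans _ _ (m * (e1 * e / 2 / (m + 1))))//.
    by rewrite ler_wpM2l// ge_min lexx orbT.
  by rewrite mulrCA ler_piMr ?(ltW e2)// ler_pdivrMr ?ltr_wpDl// mul1r lerDl.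
pose m' := cL r * (cl * C); have m'0 : 0 <= m' by rewrite mulr_ge0// mulr_ge0.
exists (e1 * e / 2 / (m' + 1)); first by rewrite divr_gt0// ltr_wpDl.
move=> k t d k0 kk tT dk; have t0 : 0 <= t by case/andP: tT => /ltW.
have mk : m' * k <= e1 * e / 2.
  move: kk; rewrite ltr_pdivlMr ?ltr_wpDl// mulrDr mulr1 mulrC => /ltW; apply: le_trans.
  by rewrite lerDl ltW.
have h1 := trace_L k0 t0 r0 r2 dk; have h2 := L_trace tT r0 r2.
rewrite -(ler_pM2l e10) -[X in X * `|_|](gtr0_norm e10) -normrM.
move: h1 h2 ms mk; rewrite /m /m' !ler_norml.
move=> /andP[a1 a2] /andP[a3 a4] ms mk.
by apply/andP; split; lra.
Qed.

(** [multiplier_inequality] with [h] close to [e1 * tau ^ 2], as [k] tends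
    to [0]. *)
Theorem evolution_observability :
  (T * (2 - K - 2 * M) - B) / 2 * energy2 (v 0) (y 0)
    <= e1 * \int[lebesgue_measure]_(t in `]0, T[) (tau t ^+ 2).
Proof.
have [wy yv cy cv hA] := ev.
set I := Rintegral _ _ _; set c := (_ - B) / 2.
have I0 : 0 <= I by apply: Rintegral_ge0 => t _; exact: sqr_ge0.
pose m := e1 * I + 2 * e1 * T + `|c|.
have m0 : 0 <= m by rewrite !addr_ge0// !mulr_ge0// ltW.
suff key e : 0 < e -> e <= 1 -> c * energy2 (v 0) (y 0) <= e * m + e1 * I.
  apply/ler_addgt0Pl => e e0.
  have em : 0 < Num.min 1 (e / (m + 1)) by rewrite lt_min ltr01 divr_gt0// ltr_wpDl.
  apply: le_trans (key _ em _) _; first by rewrite ge_min lexx.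
  rewrite lerD2r; apply: (@le_trans _ _ (e / (m + 1) * m)).
    by rewrite ler_wpM2r// ge_min lexx orbT.
  by rewrite mulrAC -mulrA ler_piMr ?(ltW e0)// ler_pdivrMr ?ltr_wpDl// mul1r lerDl.
move=> e0 e11.
have [k0 k00 hk] := trace_uniform e0.
pose n := nE (v 0) (y 0); have n0 : 0 <= n by exact: nE_ge0.
pose g := Num.min 1 (e / (2 * n + 1)).
have n1 : 0 < 2 * n + 1 by rewrite ltr_wpDl// mulr_ge0.
have g0 : 0 < g by rewrite lt_min ltr01 divr_gt0.
have g2 : 0 < g / 2 by rewrite divr_gt0.
have [d1 d10 h1] := diffq_near snG (lexx 0) wy g2.
have [d2 d20 h2] := diffq_near snS (lexx 0) yv g2.
pose d := Num.min k0 (Num.min d1 d2).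
have d0 : 0 < d by rewrite !lt_min k00 d10.
pose k := d / 2; have kp : 0 < k by rewrite divr_gt0.
have : k < d by rewrite ltr_pdivrMr// ltr_pMr// ltr1n.
rewrite !lt_min => /and3P[kk0 /(h1 k kp) {}h1 /(h2 k kp) {}h2].
pose h t := e1 * (1 + e) * tau t ^+ 2 + 2 * e1 * e.
have ic : itg `]0, T[ (fun=> 2 * e1 * e) by exact: itg_cst_oo.
have it : itg `]0, T[ (fun t => e1 * (1 + e) * tau t ^+ 2) by exact: itgZ.
have ih : itg `]0, T[ h by exact: itgD.
have hh t d' : 0 < t < T -> istrace (diffq k w t) (diffq k v t) d' -> e1 * d' ^+ 2 <= h t.
  move=> tT dk; have := hk k t d' kp kk0 tT dk.
  move=> hd; have -> : h t = e1 * ((1 + e) * tau t ^+ 2 + 2 * e) by rewrite /h; ring.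
  rewrite ler_pM2l//.
  have hd2 : `|d'| <= `|tau t| + e.
    by rewrite -[d'](subrK (tau t)) (le_trans (ler_normD _ _))// addrC lerD2l.
  have : `|d'| ^+ 2 <= (`|tau t| + e) ^+ 2.
    by rewrite ler_pXn2r// nnegrE ?addr_ge0// ltW.
  rewrite sqrrD !real_normK ?num_real// => /le_trans; apply.
  have q1 : `|tau t| * 2 <= tau t ^+ 2 + 1.
    have := sqr_ge0 (`|tau t| - 1); rewrite sqrrB1 real_normK ?num_real//; lra.
  have : `|tau t| * e *+ 2 <= e * (tau t ^+ 2 + 1).
    by rewrite -mulr_natr mulrAC mulrC ler_wpM2l ?(ltW e0).
  have : e ^+ 2 <= e by rewrite expr2 ler_piMr ?(ltW e0).
  lra.
have := multiplier_inequality ev kp T0 ih hh; rewrite -/c.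
have -> : \int[lebesgue_measure]_(t in `]0, T[) h t = e1 * (1 + e) * I + 2 * e1 * e * T.
  by rewrite /h RintegralD// RintegralZl// Rint_cst_oo ?(ltW T0)// subr0.
rewrite -!sqr_nE -/n; set nk := nE _ _ => hc.
have nkn : `|nk - n| <= g.
  by rewrite (splitr g) (le_trans (nE_dist _ _ _ _))// addrC lerD.
have g1 : g <= 1 by rewrite ge_min lexx.
have ge : g * (2 * n + 1) <= e by rewrite -ler_pdivlMr// ge_min lexx orbT.
have nk0 : 0 <= nk by exact: nE_ge0.
have nke : `|nk ^+ 2 - n ^+ 2| <= e.
  rewrite subr_sqr normrM (ger0_norm (addr_ge0 nk0 n0)); apply: le_trans ge.
  rewrite ler_pM ?addr_ge0//.
  by move: nkn; rewrite ler_norml => /andP[_]; lra.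
have : c * (n ^+ 2 - nk ^+ 2) <= `|c| * e.
  rewrite (le_trans (ler_norm _))// normrM ler_wpM2l// distrC//.
rewrite /m; lra.
Qed.

End Observability.
End Evolution.

(** * Weighted spaces *)

Section Subspaces.
Context {R : realType}.

(** Function spaces are turned into module types so that the abstract results apply
    to them; vector operations are those of functions, by conversion. *)
Record funspace := FunSpace {
  sp_pred : (R -> R) -> Prop;
  sp_lin : forall c u v, sp_pred u -> sp_pred v -> sp_pred (fun x => c * u x + v x);
  sp_0 : sp_pred (fun=> 0) }.

Variable E : funspace.

Definition sp_mem : {pred R -> R^o} := [pred u | `[< sp_pred E u >]].

Lemma sp_memP u : reflect (sp_pred E u) (u \in sp_mem).
Proof. by rewrite inE; exact: asboolP. Qed.

Lemma sp_submod_closed : submod_closed sp_mem.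
Proof.
split; first by apply/sp_memP; exact: sp_0.
by move=> c u v /sp_memP hu /sp_memP hv; apply/sp_memP; exact: sp_lin.
Qed.

HB.instance Definition _ := GRing.isSubmodClosed.Build R (R -> R^o) sp_mem sp_submod_closed.

Record elt := Elt { elt_val :> R -> R^o; elt_valP : elt_val \in sp_mem }.
HB.instance Definition _ := [isSub for elt_val].
HB.instance Definition _ := [Choice of elt by <:].
HB.instance Definition _ := [SubChoice_isSubLmodule of elt by <:].

Lemma eltP (u : elt) : sp_pred E u.
Proof. by apply/sp_memP; exact: elt_valP. Qed.

Definition mk (u : R -> R) (h : sp_pred E u) : elt := Elt (introT (sp_memP u) h).

Lemma elt_linE (c : R) (u v : elt) : elt_val (c *: u + v) = (fun x => c * u x + v x).
Proof. by []. Qed.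

Lemma elt_subE (u v : elt) : elt_val (u - v) = (fun x => u x - v x).
Proof. by []. Qed.

End Subspaces.

Section WeightedL2.
Context {R : realType}.
Local Notation mu := (@lebesgue_measure R).
Local Notation I01 := `]0%R, 1%R[%classic.
Implicit Types (f g u v w rho : R -> R) (x s r e d c k : R).

Definition Lw rho u := measurable_fun (I01 : set R) u /\ itg I01 (fun x => u x ^+ 2 * rho x).
(** The forms of the problem are all integrals of [u v rho] over [(0, 1)], applied
    to functions or to their weak derivatives. *)
Definition ipw rho u v := \int[mu]_(x in I01) (u x * v x * rho x).

Variable rho : R -> R.
Hypothesis mrho : measurable_fun (I01 : set R) rho.
Hypothesis rho0 : forall x, 0 < x < 1 -> 0 <= rho x.

Lemma Lw_mul u v : Lw rho u -> Lw rho v -> itg I01 (fun x => u x * v x * rho x).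
Proof.
move=> [mu_ iu] [mv iv]; apply: (itg_le _ _ _ (itgD _ iu iv)) => //.
  by apply: measurable_funM => //; apply: measurable_funM.
move=> x /=; rewrite in_itv/= => x01; rewrite normrM (ger0_norm (rho0 x01)) -mulrDl.
rewrite ler_wpM2r ?rho0// normrM.
have := sqr_ge0 (`|u x| - `|v x|); rewrite sqrrB !real_normK ?num_real// -mulr_natr.
by have := mulr_ge0 (normr_ge0 (u x)) (normr_ge0 (v x)); lra.
Qed.

Lemma Lw_lin c u v : Lw rho u -> Lw rho v -> Lw rho (fun x => c * u x + v x).
Proof.
move=> hu hv; have [mu_ iu] := hu; have [mv iv] := hv.
split; first by apply: measurable_funD => //; apply: measurable_funM.
have h := itgD (measurable_itv _) (itgZ (c ^+ 2) (measurable_itv _) iu)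
  (itgD (measurable_itv _) (itgZ (2 * c) (measurable_itv _) (Lw_mul hu hv)) iv).
by apply: itg_eq h => // x _; ring.
Qed.

Lemma Lw0 : Lw rho (fun=> 0).
Proof.
split=> //; apply: (itg_eq _ _ (@itg_cst_oo R 0 1 0)) => // x _.
by rewrite expr0n/= mul0r.
Qed.

Lemma ipw_lin c u v w : Lw rho u -> Lw rho v -> Lw rho w ->
  ipw rho (fun x => c * u x + v x) w = c * ipw rho u w + ipw rho v w.
Proof.
move=> hu hv hw; rewrite /ipw -RintegralZl//; last exact: Lw_mul.
rewrite -RintegralD//; [|by apply: itgZ => //; exact: Lw_mul|exact: Lw_mul].
by apply: eq_Rintegral => x _; ring.
Qed.

Lemma ipwC u v : ipw rho u v = ipw rho v u.
Proof. by apply: eq_Rintegral => x _; ring. Qed.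

Lemma ipw_ge0 u : 0 <= ipw rho u u.
Proof.
apply: Rintegral_ge0 => x /=; rewrite in_itv/= => x01.
by rewrite mulr_ge0 ?rho0// -expr2 sqr_ge0.
Qed.

Lemma Lw_ae u v : measurable_fun (I01 : set R) v -> {ae mu, forall x, x \in `]0, 1[ -> u x = v x} ->
  Lw rho u -> Lw rho v.
Proof.
move=> mv uv [mu_ iu]; split => //; move/integrableP : (iu) => [mf foo].
apply/integrableP; split.
  by apply/measurable_EFinP; apply: measurable_funM => //; apply: measurable_funX.
suff -> : (\int[mu]_(x in I01) `|(EFin \o (fun x => v x ^+ 2 * rho x)%R) x| =
    \int[mu]_(x in I01) `|(EFin \o (fun x => u x ^+ 2 * rho x)%R) x|)%E by [].
apply: ae_eq_integral => //.
- apply: measurableT_comp => //; apply/measurable_EFinP.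
  by apply: measurable_funM => //; apply: measurable_funX.
- by apply: measurableT_comp.
- by apply: ae_imp uv => x h Ix /=; rewrite h.
Qed.

Lemma ipw_ae u u' v : {ae mu, forall x, x \in `]0, 1[ -> u x = u' x} ->
  Lw rho u -> Lw rho u' -> Lw rho v -> ipw rho u v = ipw rho u' v.
Proof.
move=> uu hu hu' hv; apply: itg_ae_eq => //; [|exact: Lw_mul|exact: Lw_mul].
by apply: ae_imp uu => x h Ix; rewrite h.
Qed.

(** Finiteness of the extended integral, as in the definitions of the spaces. *)
Lemma Lw_lty u : measurable_fun (I01 : set R) u ->
  (\int[mu]_(x in I01) (u x ^+ 2 * rho x)%:E < +oo)%E <-> Lw rho u.
Proof.
move=> mu_; rewrite -itg_ge0_lty//.
- by split=> [|[]//]; split.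
- by apply: measurable_funM => //; apply: measurable_funX.
- by move=> x /=; rewrite in_itv/= => x01; rewrite mulr_ge0 ?sqr_ge0 ?rho0.
Qed.

Lemma EFin_ipw u : Lw rho u -> (\int[mu]_(x in I01) (u x ^+ 2 * rho x)%:E)%E = (ipw rho u u)%:E.
Proof. by move=> [_ iu]; rewrite EFin_Rintegral. Qed.

End WeightedL2.

Section Spaces.
Context {R : realType}.
Local Notation mu := (@lebesgue_measure R).
Local Notation I01 := `]0%R, 1%R[%classic.
Implicit Types (f g h u v w phi rho : R -> R) (x s r e d c k m : R).

Local Notation one := (fun=> 1 : R).

Lemma one_ge0 x : 0 < x < 1 -> 0 <= one x. Proof. by []. Qed.

Lemma L2_onE u : L2_on I01 u <-> Lw one u.
Proof.
split=> [[mu_ h]|h]; last first.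
  split; first by case: h.
  have := (Lw_lty (measurable_cst _) one_ge0 (proj1 h)).2 h.
  by under eq_integral do rewrite mulr1.
apply/(Lw_lty (measurable_cst _) one_ge0 mu_).
by under eq_integral do rewrite mulr1.
Qed.

Lemma Lw_mono rho rho' c u : measurable_fun (I01 : set R) rho -> measurable_fun (I01 : set R) rho' ->
  (forall x, 0 < x < 1 -> 0 <= rho' x <= c * rho x) -> Lw rho u -> Lw rho' u.
Proof.
move=> mr mr' rr [mu_ iu]; split=> //.
apply: (itg_le _ _ _ (itgZ c _ iu)) => //.
  by apply: measurable_funM => //; apply: measurable_funX.
move=> x /=; rewrite in_itv/= => x01; have /andP[r0 r1] := rr x x01.
have u0 := sqr_ge0 (u x); rewrite ger0_norm; last exact: mulr_ge0.
by rewrite [X in _ <= X]mulrCA ler_wpM2l.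
Qed.

Lemma ipw_mono rho rho' c u : measurable_fun (I01 : set R) rho -> measurable_fun (I01 : set R) rho' ->
  (forall x, 0 < x < 1 -> 0 <= rho' x <= c * rho x) -> Lw rho u -> ipw rho' u u <= c * ipw rho u u.
Proof.
move=> mr mr' rr hu; have [_ iu'] := Lw_mono mr mr' rr hu; have [_ iu] := hu.
rewrite /ipw -RintegralZl//; apply: le_Rintegral => //; first exact: itgZ.
move=> x /=; rewrite in_itv/= => x01; have /andP[r0 r1] := rr x x01.
by rewrite mulrCA ler_wpM2l// -expr2 sqr_ge0.
Qed.

(** The squared distance to a test function in [H^1]. *)
Definition H1dist u phi : R :=
  ipw one (fun x => u x - phi x) (fun x => u x - phi x) +
  ipw one (fun x => wderiv u x - derive1 phi x) (fun x => wderiv u x - derive1 phi x).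

Lemma Lw_one_lin c u v : Lw one u -> Lw one v -> Lw one (fun x => c * u x + v x).
Proof. by apply: Lw_lin => //; exact: one_ge0. Qed.

Lemma Lw_one_sub u v : Lw one u -> Lw one v -> Lw one (fun x => u x - v x).
Proof.
move=> hu hv; have := Lw_one_lin (-1) hv hu.
by congr (Lw _ _); apply/funext => x; rewrite mulN1r addrC.
Qed.

Lemma test_Lw rho phi : measurable_fun (I01 : set R) rho ->
  (forall x, 0 < x < 1 -> 0 <= rho x) -> loc_integrable rho -> test_fun phi -> Lw rho phi.
Proof.
move=> mr r0 ir tphi; have cphi := test_continuous tphi.
have mphi : measurable_fun (I01 : set R) phi.
  by apply: measurable_funTS; exact: continuous_measurable_fun.
split=> //; have [C C0 hC] := test_bounded tphi.
have h := itg_test ir tphi.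
apply: (itg_eq _ _ (itg_mul_bounded _ mphi (fun x _ => hC x) h)) => // x _; ring.
Qed.

Lemma test_L2 phi : test_fun phi -> Lw one phi.
Proof. by apply: test_Lw => //; exact: (@loc_integrable_one R). Qed.

Lemma H1distE u phi : Lw one u -> Lw one (wderiv u) -> test_fun phi ->
  (\int[mu]_(x in I01) ((u x - phi x) ^+ 2 + (wderiv u x - derive1 phi x) ^+ 2)%:E)%E =
  (H1dist u phi)%:E.
Proof.
move=> hu hu' tphi; have [_ h1] := Lw_one_sub hu (test_L2 tphi).
have [_ h2] := Lw_one_sub hu' (test_L2 (test_derive tphi)).
rewrite /H1dist -RintegralD// -EFin_Rintegral//; last exact: itgD.
by apply: eq_integral => x _; rewrite !mulr1 !expr2.
Qed.

(** The closure of the test functions, with a single approximation at each scale in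
    place of a sequence. *)
Lemma H10E u : H10 u <-> [/\ Lw one u, has_weak_deriv u, Lw one (wderiv u) &
  forall e, 0 < e -> exists2 phi, test_fun phi & H1dist u phi <= e].
Proof.
split=> [[/L2_onE hu du /L2_onE hu' [phi tphi cphi]]|[hu du hu' h]]; split=> //; try exact/L2_onE.
  move=> e e0; have h0 : (0 < e%:E)%E by rewrite lte_fin.
  have := cphi _ (@nbhs_open_ereal_lt _ 0 (fun=> e) e0).
  case=> n _ /(_ n (leqnn _)) /= hn; exists (phi n) => //.
  by move: hn; rewrite H1distE// lte_fin => /ltW.
have hn n : exists2 phi, test_fun phi & H1dist u phi <= n.+1%:R^-1 by apply: h; rewrite invr_gt0.
have /choice[phi hphi] : forall n, exists phi, test_fun phi /\ H1dist u phi <= n.+1%:R^-1.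
  by move=> n; have [phi] := hn n; exists phi.
exists phi; first by move=> n; case: (hphi n).
apply: (@squeeze_cvge _ _ _ _ (fun=> 0%E) _ (fun n => (n.+1%:R^-1)%:E)).
- near=> n; apply/andP; split.
    by apply: integral_ge0 => x _; rewrite lee_fin addr_ge0// sqr_ge0.
  by have [t1 t2] := hphi n; rewrite H1distE// lee_fin.
- exact: cvg_cst.
- by apply/cvg_EFin; [near=> n|exact: cvg_harmonic].
Unshelve. all: by end_near. Qed.

Lemma H1dist_lin c u v phi psi : Lw one u -> Lw one v -> has_weak_deriv u -> has_weak_deriv v ->
  Lw one (wderiv u) -> Lw one (wderiv v) -> Lw one (wderiv (fun x => c * u x + v x)) ->
  test_fun phi -> test_fun psi ->
  H1dist (fun x => c * u x + v x) (fun x => c * phi x + psi x) <=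
  2 * c ^+ 2 * H1dist u phi + 2 * H1dist v psi.
Proof.
move=> hu hv du dv hu' hv' hw tphi tpsi.
have key f1 f2 f3 : Lw one f1 -> Lw one f2 -> Lw one f3 ->
    {ae mu, forall x, x \in `]0, 1[ -> f3 x = c * f1 x + f2 x} ->
    ipw one f3 f3 <= 2 * c ^+ 2 * ipw one f1 f1 + 2 * ipw one f2 f2.
  move=> h1 h2 h3 ae; have h12 := Lw_one_lin c h1 h2.
  have m1 := @measurable_cst _ _ R R I01 1.
  rewrite (ipw_ae m1 one_ge0 ae h3 h12 h3) ipwC.
  rewrite (ipw_ae m1 one_ge0 ae h3 h12 h12).
  have [_ i1] := h1; have [_ i2] := h2; have [_ i12] := h12.
  rewrite /ipw -!RintegralZl// -RintegralD//; [|exact: itgZ|exact: itgZ].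
  apply: le_Rintegral => //; first by apply: itgD => //; exact: itgZ.
  by move=> x _; have := sqr_ge0 (c * f1 x - f2 x); rewrite !mulr1 -!expr2 => h; lra.
have dphi' : derive1 (fun x => c * phi x + psi x) = (fun x => c * derive1 phi x + derive1 psi x).
  apply: is_derive_derive1 => x.
  have h := is_deriveD (is_deriveZ c (test_is_derive x tphi)) (test_is_derive x tpsi).
  exact: h.
have Lt := test_L2 tphi; have Lt' := test_L2 (test_derive tphi).
have Ls := test_L2 tpsi; have Ls' := test_L2 (test_derive tpsi).
have h1 := key _ _ (fun x => c * u x + v x - (c * phi x + psi x)) (Lw_one_sub hu Lt) (Lw_one_sub hv Ls)
  (Lw_one_sub (Lw_one_lin c hu hv) (Lw_one_lin c Lt Ls)) _.
have h2 := key _ _ (fun x => wderiv (fun x => c * u x + v x) x - derive1 (fun x => c * phi x + psi x) x)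
  (Lw_one_sub hu' Lt') (Lw_one_sub hv' Ls') _ _.
rewrite /H1dist !mulrDr addrACA lerD//.
  by apply: h1; apply: aeW => x _; ring.
apply: h2.
  by rewrite dphi'; apply: Lw_one_sub => //; exact: Lw_one_lin.
apply: ae_imp (wderiv_lin c du dv) => x hx x01.
by rewrite hx// dphi'; ring.
Qed.

Lemma H10_lin c u v : H10 u -> H10 v -> H10 (fun x => c * u x + v x).
Proof.
move=> /H10E[hu du hu' au] /H10E[hv dv hv' av]; apply/H10E.
have dw := has_weak_deriv_lin c du dv.
have hw' : Lw one (wderiv (fun x => c * u x + v x)).
  apply: (Lw_ae (measurable_cst _) _ _ (Lw_one_lin c hu' hv')).
    by apply: loc_integrable_measurable; case: (wderivP dw).
  apply: ae_imp (wderiv_lin c du dv) => x hx x01.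
  by rewrite hx.
split; [exact: Lw_one_lin|exact: dw|exact: hw'|].
move=> e e0; pose k := 2 * c ^+ 2 + 2.
have k0 : 0 < k by rewrite ltr_wpDl// mulr_ge0// sqr_ge0.
have ek : 0 < e / k by rewrite divr_gt0.
have [phi tphi dphi] := au _ ek; have [psi tpsi dpsi] := av _ ek.
exists (fun x => c * phi x + psi x); first exact: test_lin.
apply: le_trans (H1dist_lin hu hv du dv hu' hv' hw' tphi tpsi) _.
have -> : e = 2 * c ^+ 2 * (e / k) + 2 * (e / k) by rewrite -mulrDl mulrCA divff ?mulr1// gt_eqF.
have c20 : 0 <= 2 * c ^+ 2 by rewrite mulr_ge0 ?sqr_ge0.
exact: (lerD (ler_wpM2l c20 dphi) (ler_wpM2l (ler0n R 2) dpsi)).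
Qed.

Lemma test_H10 phi : test_fun phi -> H10 phi.
Proof.
move=> tphi; apply/H10E; have tphi' := test_derive tphi.
have dphi : has_weak_deriv phi by exists (derive1 phi); exact: test_weak_deriv.
have m1 := @measurable_cst _ _ R R I01 1.
have aeE : {ae mu, forall x, x \in `]0, 1[ -> derive1 phi x = wderiv phi x}.
  by apply: ae_imp (test_wderiv tphi) => x hx x01; rewrite hx.
have hw : Lw one (wderiv phi).
  apply: (Lw_ae m1 _ aeE (test_L2 tphi')).
  by apply: loc_integrable_measurable; case: (wderivP dphi).
split=> //; first exact: test_L2.
move=> e e0; exists phi => //; rewrite /H1dist.
have z : ipw one (fun x => phi x - phi x) (fun x => phi x - phi x) = 0.
  rewrite /ipw (@eq_Rintegral _ _ _ mu _ (fun=> 0)); last by move=> x _; rewrite subrr !mul0r.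
  by rewrite Rint_cst_oo// mul0r.
have h0 := @Lw0 R one.
have z' : ipw one (fun x => wderiv phi x - derive1 phi x) (fun x => wderiv phi x - derive1 phi x) = 0.
  rewrite (ipw_ae m1 one_ge0 (u' := fun=> 0)) => //.
  - rewrite /ipw (@eq_Rintegral _ _ _ mu _ (fun=> 0)); last by move=> x _; rewrite !mul0r.
    by rewrite Rint_cst_oo// mul0r.
  - by apply: ae_imp aeE => x hx x01; rewrite hx// subrr.
  - by apply: Lw_one_sub => //; exact: test_L2.
  - by apply: Lw_one_sub => //; exact: test_L2.
by rewrite z z' addr0 ltW.
Qed.

Lemma test_0 : test_fun (fun=> 0 : R).
Proof.
split.
  by apply/Cn_derive1n => n; exact: Cn_cst.
by exists 2^-1, 2^-1; split=> //; rewrite ?invr_gt0// invf_lt1// ltr1n.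
Qed.

End Spaces.

Lemma norm_mul2_le {R : realType} (x y : R) : `|2 * (x * y)| <= x ^+ 2 + y ^+ 2.
Proof.
have h1 := sqr_ge0 (x + y); have h2 := sqr_ge0 (x - y).
by rewrite ler_norml; apply/andP; split; nra.
Qed.

(** * The energy spaces *)

Section EnergySpaces.
Context {R : realType} (p : @coefficients R).
Local Notation mu := (@lebesgue_measure R).
Local Notation I01 := `]0%R, 1%R[%classic.
Local Notation a := (ca p).
Local Notation b := (cb p).
Local Notation eta := (eta a b).
Local Notation sigma := (sigma a b).
Local Notation one := (fun=> 1 : R).
Implicit Types (f g h phi rho : R -> R) (x s r e d c k m : R).

(** For a bounded weight all functions of [L^2] are admissible; [eta] and
    [x / sigma] are bounded weights, [1 / sigma] is not. *)
Definition bounded_weight c rho :=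
  measurable_fun (I01 : set R) rho /\ forall x, 0 < x < 1 -> 0 <= rho x <= c.

Lemma bw_ge0 c rho : bounded_weight c rho -> forall x, 0 < x < 1 -> 0 <= rho x.
Proof. by move=> [_ h] x /h/andP[]. Qed.

Lemma bw_Lw c rho (u : R -> R) : bounded_weight c rho -> Lw one u -> Lw rho u.
Proof.
move=> [mr h]; apply: (Lw_mono (c := c)) => // x x01.
by rewrite mulr1; exact: h.
Qed.

Lemma bw_ipw c rho (u : R -> R) : bounded_weight c rho -> Lw one u -> ipw rho u u <= c * ipw one u u.
Proof.
move=> [mr h]; apply: ipw_mono => // x x01.
by rewrite mulr1; exact: h.
Qed.

Definition isig x := (sigma x)^-1.
Definition xsig x := x / sigma x.

Lemma I01_oc x : 0 < x < 1 -> 0 < x <= 1.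
Proof. by move=> /andP[-> /ltW]. Qed.

Lemma I01_cc x : 0 < x < 1 -> 0 <= x <= 1.
Proof. by move=> /andP[/ltW -> /ltW]. Qed.

Lemma isig_continuous x : 0 < x < 1 -> {for x, continuous isig}.
Proof.
move=> x01; apply: cvgV; last exact: sigma_continuous.
by rewrite gt_eqF// sigma_gt0// I01_oc.
Qed.

Lemma isig_gt0 x : 0 < x < 1 -> 0 < isig x.
Proof. by move=> /I01_oc /sigma_gt0; rewrite invr_gt0. Qed.

Lemma isig_ge0 x : 0 < x < 1 -> 0 <= isig x.
Proof. by move=> /isig_gt0/ltW. Qed.

Lemma isig_measurable : measurable_fun (I01 : set R) isig.
Proof. exact: measurable_I01 isig_continuous. Qed.

Lemma sigma_le : exists2 c, 0 < c & forall x, 0 < x < 1 -> sigma x <= c.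
Proof.
have [z _ hz] := EVT_max ler01 (@sigma_within R p); exists (Num.max 1 (sigma z)).
  by rewrite lt_max ltr01.
by move=> x /I01_cc x01; rewrite le_max hz ?orbT// in_itv.
Qed.

Lemma isig_one : exists2 c, 0 < c & forall u, Lw isig u -> Lw one u /\ ipw one u u <= c * ipw isig u u.
Proof.
have [c c0 hc] := sigma_le; exists c => // v hv.
have h x : 0 < x < 1 -> 0 <= (1 : R) <= c * isig x.
  move=> x01; have s0 := sigma_gt0 p (I01_oc x01).
  by rewrite ler01 ler_pdivlMr// mul1r hc.
split; first by apply: Lw_mono h hv => //; exact: isig_measurable.
by apply: ipw_mono h hv => //; exact: isig_measurable.
Qed.

Lemma xsig_bw : bounded_weight (max_eta a b / a 1) xsig.
Proof.
split.
  by apply: measurable_funM => //; exact: isig_measurable.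
move=> x x01; rewrite x_div_sigma ?I01_oc// andbT divr_ge0//.
  by case/andP: x01 => /ltW.
by rewrite ltW// sigma_gt0// I01_oc.
Qed.

Lemma eta_bw : bounded_weight (max_eta a b) eta.
Proof.
split; first by apply: measurable_I01 => x; exact: eta_continuous.
by move=> x /I01_cc x01; rewrite max_eta_ub// andbT ltW// eta_gt0.
Qed.

Lemma one_bw : bounded_weight 1 one.
Proof. by split=> // x _; rewrite ler01 lexx. Qed.

(** The spaces [L^2_(1/sigma)] and [H^1_(1/sigma)] on which the abstract evolution
    takes place, and the inclusion [emb]. *)
Definition L2sp : funspace := @FunSpace R (Lw isig)
  (fun c u v => @Lw_lin R isig isig_measurable isig_ge0 c u v) (@Lw0 R isig).

Lemma H1sp_lin c (u v : R -> R) : Lw isig u /\ H10 u -> Lw isig v /\ H10 v ->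
  Lw isig (fun x => c * u x + v x) /\ H10 (fun x => c * u x + v x).
Proof.
move=> [u1 u2] [v1 v2]; split; last exact: H10_lin.
by apply: Lw_lin => //; [exact: isig_measurable|exact: isig_ge0].
Qed.

Lemma H1sp_0 : Lw isig (fun=> 0) /\ H10 (fun=> 0 : R).
Proof. by split; [exact: Lw0|apply: test_H10; exact: test_0]. Qed.

Definition H1sp : funspace := @FunSpace R (fun u => Lw isig u /\ H10 u) H1sp_lin H1sp_0.

Local Notation H := (elt L2sp).
Local Notation V := (elt H1sp).
Implicit Types (u v w z : V).

Definition emb (u : V) : H := @mk R L2sp u (proj1 (eltP u)).

Lemma emb_linear : linear emb.
Proof. by move=> c u v; apply: val_inj. Qed.

HB.instance Definition _ := GRing.isLinear.Build R V H _ emb emb_linear.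

Lemma HLw (f : H) : Lw isig f.
Proof. exact: (eltP f). Qed.

Lemma Hone (f : H) : Lw one f.
Proof. by have [c _ h] := isig_one; case: (h f (HLw f)). Qed.

Lemma Vone u : Lw one u.
Proof. exact: (Hone (emb u)). Qed.

Lemma VH10 u : [/\ Lw one u, has_weak_deriv u, Lw one (wderiv u) &
  forall e, 0 < e -> exists2 phi, test_fun phi & H1dist u phi <= e].
Proof. by apply/H10E; case: (eltP u). Qed.

Lemma Vwd u : has_weak_deriv u.
Proof. by case: (VH10 u). Qed.

Lemma Vd u : Lw one (wderiv u).
Proof. by case: (VH10 u). Qed.

Lemma Vd_lin c u v : {ae mu, forall x, x \in `]0, 1[ ->
  wderiv (c *: u + v : V) x = c * wderiv u x + wderiv v x}.
Proof. exact: (wderiv_lin c (Vwd u) (Vwd v)). Qed.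

(** [ipS] and [ipG] make up the energy, [ipD] is the unweighted Dirichlet form and
    [ipX] the multiplier form. *)
Definition ipS (f g : H) : R := ipw isig f g.
Definition Gw rho u v : R := ipw rho (wderiv u) (wderiv v).
Definition ipG := Gw eta.
Definition ipX (f : H) v : R := ipw xsig f (wderiv v).

Lemma ipS_inner : semi_inner ipS.
Proof.
split=> [c u v w|u v|u].
- by apply: ipw_lin; [exact: isig_measurable|exact: isig_ge0|exact: HLw|exact: HLw|exact: HLw].
- exact: ipwC.
- by apply: ipw_ge0; exact: isig_ge0.
Qed.

Lemma ipw_wderiv_lin c rho k u v (w : R -> R) : bounded_weight c rho -> Lw one w ->
  ipw rho (wderiv (k *: u + v : V)) w = k * ipw rho (wderiv u) w + ipw rho (wderiv v) w.
Proof.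
move=> hr hw; have r0 := bw_ge0 hr; have [mr _] := hr.
have L f (hf : Lw one f) := bw_Lw hr hf.
rewrite (ipw_ae mr r0 (u' := fun x => k * wderiv u x + wderiv v x))//.
- by apply: ipw_lin => //; apply: L => //; exact: Vd.
- exact: Vd_lin.
- by apply: L; exact: Vd.
- by apply: Lw_lin => //; apply: L; exact: Vd.
- exact: L.
Qed.

Lemma Gw_inner c rho : bounded_weight c rho -> semi_inner (Gw rho).
Proof.
move=> hr; split=> [k u v w|u v|u].
- by apply: (ipw_wderiv_lin _ _ _ hr); exact: Vd.
- exact: ipwC.
- by apply: ipw_ge0; exact: bw_ge0 hr.
Qed.

Lemma ipG_inner : semi_inner ipG.
Proof. exact: Gw_inner eta_bw. Qed.

Definition ipD := Gw one.

Lemma ipD_inner : semi_inner ipD.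
Proof. exact: Gw_inner one_bw. Qed.

Lemma ipG_le u : ipG u u <= max_eta a b * ipD u u.
Proof. by apply: (bw_ipw eta_bw); exact: Vd. Qed.

Lemma ipD_le u : ipD u u <= (min_eta a b)^-1 * ipG u u.
Proof.
apply: ipw_mono => //; [by case: eta_bw| |by apply: (bw_Lw eta_bw); exact: Vd].
move=> x x01; rewrite ler01 mulrC ler_pdivlMr ?min_eta_gt0// mul1r.
by rewrite min_eta_lb// I01_cc.
Qed.

Lemma ipXl c (u v : H) w : ipX (c *: u + v) w = c * ipX u w + ipX v w.
Proof.
have r0 := bw_ge0 xsig_bw; have [mr _] := xsig_bw.
by apply: ipw_lin => //; apply: (bw_Lw xsig_bw); [exact: Hone|exact: Hone|exact: Vd].
Qed.

Lemma ipXr c u v (w : H) : ipX w (c *: u + v) = c * ipX w u + ipX w v.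
Proof.
rewrite /ipX !(ipwC _ (elt_val w)); apply: ipw_wderiv_lin xsig_bw _.
exact: Hone.
Qed.

Lemma a1_gt0 : 0 < a 1.
Proof. by apply: a_gt0; rewrite ltr01 lexx. Qed.

(** Pointwise, [2 f (x v') / sigma <= f ^ 2 / sigma + (x v') ^ 2 / sigma], and
    [x ^ 2 / sigma = x ^ 2 eta / a <= eta / a 1]. *)
Lemma ipX_young (f : H) v : `|2 * ipX f v| <= ipS f f + (a 1)^-1 * ipG v v.
Proof.
have [_ iS] := HLw f; have [_ iG] := bw_Lw eta_bw (Vd v).
have [mr _] := xsig_bw; have r0 := bw_ge0 xsig_bw.
have iX := Lw_mul mr r0 (bw_Lw xsig_bw (Hone f)) (bw_Lw xsig_bw (Vd v)).
rewrite /ipX /ipS /ipG /Gw /ipw -RintegralZl// -RintegralZl// -RintegralD//; last exact: itgZ.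
have key x : 0 < x < 1 -> `|2 * (elt_val f x * wderiv v x * xsig x)| <=
    elt_val f x * elt_val f x * isig x + (a 1)^-1 * (wderiv v x * wderiv v x * eta x).
  move=> x01; set F : R := elt_val f x; set D : R := wderiv v x.
  have s0 := sigma_gt0 p (I01_oc x01); have i0 := isig_ge0 x01; have /andP[x0 x1] := x01.
  have ax := a_gt0 p (I01_oc x01); have e0 := eta_gt0 p x.
  have -> : 2 * (F * D * xsig x) = 2 * (F * (x * D)) * isig x by rewrite /xsig /isig; ring.
  rewrite normrM (ger0_norm i0).
  have h1 : `|2 * (F * (x * D))| <= F ^+ 2 + (x * D) ^+ 2.
    exact: norm_mul2_le.
  apply: le_trans (ler_wpM2r i0 h1) _; rewrite mulrDl lerD2l.
  have -> : (x * D) ^+ 2 * isig x = (x / a x) * (x * (D * D * eta x)).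
    by rewrite /isig /Defs.sigma; field; rewrite !gt_eqF.
  have h2 : 0 <= D * D * eta x by apply: mulr_ge0; [rewrite -expr2 sqr_ge0|exact: ltW].
  apply: ler_pM.
  - by rewrite divr_ge0// ltW.
  - by rewrite mulr_ge0// ltW.
  - by apply: x_div_a; exact: I01_oc.
  - by rewrite ler_piMl// ltW.
apply: le_trans (le_normr_Rintegral _ _) _ => //; first exact: itgZ.
apply: le_Rintegral; [by []|by apply: itg_norm => //; exact: itgZ|by apply: itgD => //; exact: itgZ|].
by move=> x /=; rewrite in_itv/=; exact: key.
Qed.

End EnergySpaces.

Lemma perturb_le {R : realType} (A B n1 n2 e w1 w2 : R) : 0 <= A ->
  w1 <= A * n1 -> w2 <= B * e -> n1 <= n2 + e -> w1 + w2 <= A * n2 + (A + B) * e.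
Proof.
move=> A0 h1 h2 h3; rewrite mulrDl addrA -mulrDr lerD//.
by apply: le_trans h1 _; rewrite ler_wpM2l.
Qed.

(** * Density of test functions and the Poincare inequality *)

Section Density.
Context {R : realType} (p : @coefficients R).
Local Notation mu := (@lebesgue_measure R).
Local Notation I01 := `]0%R, 1%R[%classic.
Local Notation a := (ca p).
Local Notation b := (cb p).
Local Notation eta := (eta a b).
Local Notation sigma := (sigma a b).
Local Notation one := (fun=> 1 : R).
Local Notation H := (elt (L2sp p)).
Local Notation V := (elt (H1sp p)).
Implicit Types (f g h phi rho : R -> R) (x s r e d c k m : R) (u v w z : V).
Local Notation Cm := (max_eta a b / a 1).

Lemma snorm_le (E : lmodType R) (B1 B2 : E -> E -> R) c (u : E) : 0 <= c ->
  B1 u u <= c * B2 u u -> snorm B1 u <= Num.sqrt c * snorm B2 u.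
Proof.
move=> c0 h; rewrite /snorm -sqrtrM//; exact: ler_wsqrtr.
Qed.

Lemma test_V phi : test_fun phi -> Lw (isig p) phi /\ H10 phi.
Proof.
move=> tphi; split; last exact: test_H10.
apply: test_Lw => //; [exact: isig_measurable|exact: isig_ge0|].
by apply: loc_integrable_continuous => x; exact: isig_continuous.
Qed.

Definition mktest phi (tphi : test_fun phi) : V := @mk R (H1sp p) phi (test_V tphi).

Lemma Vd_sub u v : {ae mu, forall x, x \in `]0, 1[ ->
  wderiv (u - v : V) x = wderiv u x - wderiv v x}.
Proof.
apply: ae_imp (Vd_lin (-1) v u) => x h x01.
by have := h x01; rewrite scaleN1r addrC => ->; rewrite mulN1r addrC.
Qed.

Definition ipV rho u v := ipw rho u v.

Lemma ipV_inner c rho : bounded_weight c rho -> semi_inner (ipV rho).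
Proof.
move=> hr; have r0 := bw_ge0 hr; have [mr _] := hr; split=> [k u v w|u v|u].
- by apply: ipw_lin => //; apply: (bw_Lw hr); exact: Vone.
- exact: ipwC.
- exact: ipw_ge0.
Qed.

Lemma test_dense u e : 0 < e -> exists phi (tphi : test_fun phi),
  snorm (@ipD R p) (u - mktest tphi) <= e /\ snorm (ipV one) (u - mktest tphi) <= e.
Proof.
move=> e0; have e2 : 0 < e ^+ 2 by rewrite exprn_gt0.
have [_ _ _ /(_ _ e2) [phi tphi hd]] := VH10 u; exists phi, tphi.
have s k : 0 <= k -> k <= e ^+ 2 -> Num.sqrt k <= e.
  by move=> k0 ke; rewrite -(ger0_norm (ltW e0)) -sqrtr_sqr ler_wsqrtr.
have h1 : 0 <= ipV one (u - mktest tphi) (u - mktest tphi) := ipw_ge0 (@one_ge0 R) _.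
have h2 : 0 <= ipD (u - mktest tphi) (u - mktest tphi) := sip_ge0 (ipD_inner p) _.
suff E : H1dist u phi = ipV one (u - mktest tphi) (u - mktest tphi) +
    ipD (u - mktest tphi) (u - mktest tphi).
  by split; apply: s => //; apply: le_trans hd; rewrite E ?lerDl ?lerDr.
rewrite /H1dist; congr (_ + _); rewrite /ipD /Gw.
have ae : {ae mu, forall x, x \in `]0, 1[ ->
    wderiv (u - mktest tphi) x = wderiv u x - derive1 phi x}.
  apply: (@filterS2 _ _ (ae_filter_ringOfSetsType mu)) (Vd_sub u (mktest tphi)) (test_wderiv tphi).
  by move=> x h k x01; rewrite h// k.
have m1 := @measurable_cst _ _ R R I01 1.
have L1 : Lw one (fun x => wderiv u x - derive1 phi x).
  by apply: Lw_one_sub; [exact: Vd|apply: test_L2; exact: test_derive].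
have L2 := Vd (u - mktest tphi).
by rewrite (ipw_ae m1 (@one_ge0 R) ae)// ipwC (ipw_ae m1 (@one_ge0 R) ae)// ipwC.
Qed.

(** [phi x] is the integral of the derivative over [[0, x]]; the square of that
    derivative minus its mean [phi x / x] has nonnegative integral. *)
Lemma test_pointwise phi x : test_fun phi -> 0 < x < 1 ->
  phi x ^+ 2 <= x * ipw one (derive1 phi) (derive1 phi).
Proof.
move=> tphi /andP[x0 x1]; have cphi' := test_continuous (test_derive tphi).
have [_ [c [d [c0 d1 out]]]] := tphi.
have phi0 : phi 0 = 0 by apply: out; rewrite in_itv/= leNgt c0.
have [_ FTC] := ac_on_test 0 x tphi; have {}FTC := FTC 0 x (lexx _) (ltW x0) (lexx _).
set D : R -> R := derive1 phi in cphi' FTC *; pose k := phi x / x.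
have cD2 : continuous (fun s => D s * D s * 1).
  by move=> s; apply: cvgM; [apply: cvgM; exact: cphi'|exact: cvg_cst].
have i1 (lo hi : R) : itg `[lo, hi] (fun s => D s * D s * 1).
  by apply: itg_cont; exact: continuous_subspaceT.
have i2 (lo hi : R) : itg `[lo, hi] D.
  by apply: itg_cont; exact: continuous_subspaceT.
have h : 0 <= \int[mu]_(s in `[0, x]) (D s - k) ^+ 2.
  by apply: Rintegral_ge0 => s _; exact: sqr_ge0.
have e1 : \int[mu]_(s in `[0, x]) (D s - k) ^+ 2 =
    \int[mu]_(s in `[0, x]) (D s * D s * 1) + ((- (2 * k)) * \int[mu]_(s in `[0, x]) D s + k ^+ 2 * (x - 0)).
  rewrite (@eq_Rintegral _ _ _ mu _ (fun s => D s * D s * 1 + (- (2 * k) * D s + k ^+ 2))); last first.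
    by move=> s _; ring.
  rewrite RintegralD//; [|exact: i1|by apply: itgD => //; [apply: itgZ => //; exact: i2|exact: itg_cst]].
  rewrite RintegralD//; [|by apply: itgZ => //; exact: i2|exact: itg_cst].
  by rewrite RintegralZl//; [rewrite Rint_cst_cc// ltW|exact: i2].
have e2 : \int[mu]_(s in `[0, x]) (D s * D s * 1) <= ipw one D D.
  rewrite /ipw Rint_itv_oo_cc// (Rint_itv_cat (ltW x0) (ltW x1))// lerDl.
  by apply: Rintegral_ge0 => s _; rewrite mulr1 -expr2 sqr_ge0.
have : x * k = phi x by rewrite /k mulrCA divff ?mulr1// gt_eqF.
move: h; rewrite e1 -FTC phi0 !subr0 => h e3.
have e4 : x * (- (2 * k) * phi x + k ^+ 2 * x) = - phi x ^+ 2 by rewrite -e3; ring.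
rewrite -subr_ge0; apply: le_trans (_ : x * (ipw one D D + (- (2 * k) * phi x + k ^+ 2 * x)) <= _).
  by apply: mulr_ge0; [exact: ltW|apply: le_trans h _; rewrite lerD2r].
by rewrite mulrDr e4.
Qed.

Lemma Cm_gt0 : 0 < Cm.
Proof.
rewrite divr_gt0 ?a1_gt0// (lt_le_trans (eta_gt0 p 0))// max_eta_ub// lexx ler01//.
Qed.

(** [phi x ^ 2 / sigma x] is at most [x / sigma x], which is bounded, times the
    Dirichlet form. *)
Lemma test_poincare phi : test_fun phi ->
  ipw (isig p) phi phi <= Cm * ipw one (derive1 phi) (derive1 phi).
Proof.
move=> tphi; set D := ipw one _ _; have [[_ iphi] _] := test_V tphi.
have D0 : 0 <= D := ipw_ge0 (@one_ge0 R) _.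
have -> : Cm * D = \int[mu]_(x in I01) (Cm * D) by rewrite Rint_cst_oo// subr0 mulr1.
apply: le_Rintegral => //; first exact: itg_cst_oo.
move=> x /=; rewrite in_itv/= => x01.
have h := test_pointwise tphi x01; rewrite -/D in h.
have i0 := isig_ge0 p x01.
apply: (@le_trans _ _ (x * D * isig p x)); first by rewrite ler_wpM2r// -expr2.
rewrite mulrAC ler_wpM2r//.
by have [_ /(_ x x01)/andP[_]] := xsig_bw p.
Qed.

Lemma ipD_test phi (tphi : test_fun phi) :
  ipD (mktest tphi) (mktest tphi) = ipw one (derive1 phi) (derive1 phi).
Proof.
have m1 := @measurable_cst _ _ R R I01 1.
have L1 := test_L2 (test_derive tphi); have L2 := Vd (mktest tphi).
have ae := test_wderiv tphi.
by rewrite /ipD /Gw (ipw_ae m1 (@one_ge0 R) ae)// ipwC (ipw_ae m1 (@one_ge0 R) ae)// ipwC.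
Qed.

(** The weight [1 / sigma] is unbounded, so convergence in [L^2] does not pass to
    it; its restriction to [[d, 1]] is bounded. *)
Definition trunc_weight d x := if d <= x then isig p x else 0.

Lemma trunc_bw d : 0 < d -> bounded_weight (Cm / d) (trunc_weight d).
Proof.
move=> d0; split.
  apply: measurable_fun_if => //.
  - by apply: measurable_fun_ler.
  - by apply: measurable_funS (isig_measurable p) => //; exact: subIsetl.
move=> x x01; rewrite /trunc_weight; case: ifPn => dx; last first.
  by rewrite lexx divr_ge0 ?(ltW d0)// ltW// Cm_gt0.
rewrite isig_ge0//= ler_pdivlMr//.
have [_ /(_ x x01)/andP[_ h]] := xsig_bw p; apply: le_trans h.
by rewrite /xsig mulrC ler_wpM2r// isig_ge0.
Qed.

(** [test_poincare] passes to the closure for each truncated weight, with a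
    constant independent of the truncation. *)
Lemma poincare_D u : ipS (emb u) (emb u) <= Cm * ipD u u.
Proof.
have [_ iu] := HLw (emb u).
apply: tail_le => // d d0 d2.
have d1 : d < 1 by rewrite (le_lt_trans d2)// invf_lt1// ltr1n.
have hb := trunc_bw d0; pose T := ipV (trunc_weight d).
have hT : semi_inner T := ipV_inner hb.
have -> : \int[mu]_(x in `[d, 1]) (emb u x * emb u x * isig p x) = T u u.
  have -> : T u u = \int[mu]_(x in `[d, 1[) (u x * u x * trunc_weight d x).
    apply: Rint_restrict => //.
      by move=> x /=; rewrite !in_itv/= => /andP[dx ->]; rewrite (lt_le_trans d0).
    move=> x /=; rewrite !in_itv/= => /andP[x0 x1] /negP; rewrite x1 andbT => h.
    by rewrite /trunc_weight (negbTE h) mulr0.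
  rewrite -Rintegral_itv_bndo_bndc//.
    apply: eq_Rintegral => x /set_mem /=; rewrite in_itv/= => /andP[dx _].
    by rewrite /trunc_weight dx.
  apply: itgS (itg_oo_cc iu) => // x /=; rewrite !in_itv/= => /andP[dx /ltW ->].
  by rewrite (le_trans (ltW d0) dx).
rewrite -(sqr_snorm hT) -[Cm]sqr_sqrtr ?(ltW Cm_gt0)// -(sqr_snorm (ipD_inner p)) -exprMn.
rewrite ler_pXn2r// ?nnegrE ?mulr_ge0 ?snorm_ge0 ?sqrtr_ge0//.
have hc : 0 <= Num.sqrt Cm + Num.sqrt (Cm / d) by rewrite addr_ge0// sqrtr_ge0.
apply: (le_addeps hc) => e e0; have [phi [tphi [h1 h2]]] := test_dense u e0.
set v := mktest tphi in h1 h2.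
have -> : u = v + (u - v) by rewrite addrC subrK.
apply: le_trans (snormD hT _ _) _.
have k1 : snorm T v <= Num.sqrt Cm * snorm (@ipD R p) v.
  apply: snorm_le; first exact: (ltW Cm_gt0).
  rewrite ipD_test; apply: le_trans (test_poincare tphi).
  apply: le_trans (_ : 1 * ipw (isig p) phi phi <= _); last by rewrite mul1r.
  apply: ipw_mono; [exact: isig_measurable|by case: hb| |by case: (test_V tphi)].
  move=> x x01; rewrite mul1r /trunc_weight; have := isig_ge0 p x01.
  by case: ifP => _ ->; rewrite ?lexx.
have k2 : snorm T (u - v) <= Num.sqrt (Cm / d) * e.
  apply: le_trans (_ : Num.sqrt (Cm / d) * snorm (ipV one) (u - v) <= _).
    apply: snorm_le; first by rewrite divr_ge0 ?(ltW d0)// (ltW Cm_gt0).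
    by apply: (bw_ipw hb); exact: Vone.
  by rewrite ler_wpM2l// sqrtr_ge0.
have k3 : snorm (@ipD R p) v <= snorm (@ipD R p) (v + (u - v)) + e.
  have := snormD (ipD_inner p) (v + (u - v)) (v - u).
  have -> : v + (u - v) + (v - u) = v by rewrite -addrA subrKA subrr addr0.
  by rewrite (snormB (ipD_inner p) v u) => /le_trans; apply; rewrite lerD2l.
exact: (perturb_le (sqrtr_ge0 _) k1 k2 k3).
Qed.

(** The constant of the Poincare inequality for [ipG]. *)
Definition cP := max_eta a b / (a 1 * min_eta a b).

Lemma cP_ge0 : 0 <= cP.
Proof.
have h := ltW Cm_gt0; rewrite /cP invfM mulrA mulr_ge0// invr_ge0; exact: (ltW (min_eta_gt0 p)).
Qed.

Lemma poincare u : ipS (emb u) (emb u) <= cP * ipG u u.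
Proof.
apply: le_trans (poincare_D u) _.
have := ler_wpM2l (ltW Cm_gt0) (ipD_le u).
by rewrite mulrA /cP invfM mulrA.
Qed.

Lemma test_dense_G u e : 0 < e -> exists phi (tphi : test_fun phi),
  snorm (@ipG R p) (u - mktest tphi) <= e.
Proof.
move=> e0; pose c := Num.sqrt (max_eta a b).
have c0 : 0 < c.
  by rewrite sqrtr_gt0 (lt_le_trans (eta_gt0 p 0))// max_eta_ub// lexx ler01.
have [phi [tphi [h _]]] := test_dense u (divr_gt0 e0 c0); exists phi, tphi.
apply: le_trans (_ : c * snorm (@ipD R p) (u - mktest tphi) <= _).
  apply: snorm_le; last exact: ipG_le.
  by rewrite (le_trans (ltW (eta_gt0 p 0)))// max_eta_ub// lexx ler01.
by rewrite mulrC -ler_pdivlMr.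
Qed.

End Density.

(** * The operator *)

Section QuadraticDensity.
Context {R : realType} {E : lmodType R} (G : E -> E -> R) (hG : semi_inner G).

Lemma linear_eq0 (l : E -> R) (C : R) u : (forall v w, l (v - w) = l v - l w) ->
  (forall v, `|l v| <= C * snorm G v) ->
  (forall e, 0 < e -> exists2 phi, snorm G (u - phi) <= e & l phi = 0) -> l u = 0.
Proof.
move=> lB lC h; apply/eqP; rewrite -normr_le0; apply: (le_addeps (normr_ge0 C)) => e e0.
have [phi hphi lphi] := h e e0.
have -> : l u = l (u - phi) by rewrite lB lphi subr0.
rewrite add0r (le_trans (lC _))// (le_trans (ler_wpM2r (snorm_ge0 _ _) (ler_norm C)))//.
by rewrite ler_wpM2l.
Qed.

(** A bounded quadratic form that is nonpositive on a dense set is nonpositive. *)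
Lemma quadratic_le0 (B : E -> E -> R) (C : R) u :
  (forall v w z, B (v + w) z = B v z + B w z) -> (forall v w z, B z (v + w) = B z v + B z w) ->
  0 <= C -> (forall v w, `|B v w| <= C * (snorm G v * snorm G w)) ->
  (forall e, 0 < e -> exists2 phi, snorm G (u - phi) <= e & B phi phi <= 0) -> B u u <= 0.
Proof.
move=> Bl Br C0 BC h.
have n0 := snorm_ge0 G u.
have c0 : 0 <= C * (2 * snorm G u + 1) by rewrite mulr_ge0// addr_ge0// mulr_ge0.
apply: (le_addeps c0) => e e0; rewrite add0r.
have d0 : 0 < Num.min e 1 by rewrite lt_min e0 ltr01.
have [phi hphi hB] := h _ d0; set w := u - phi in hphi.
move: hphi; rewrite le_min => /andP[we w1].
have eu : u = phi + w by rewrite /w addrC subrK.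
have -> : B u u = B phi phi + B phi w + B w u by rewrite -Br -eu -Bl -eu.
have hphi : snorm G phi <= snorm G u + 1.
  have := snormD hG u (- w); rewrite (snormN hG) {1}eu addrK => /le_trans; apply.
  by rewrite lerD2l.
have h1 := le_trans (ler_norm _) (BC phi w); have h2 := le_trans (ler_norm _) (BC w u).
have w0 := snorm_ge0 G w.
have h3 : snorm G phi * snorm G w <= (snorm G u + 1) * e by rewrite ler_pM// snorm_ge0.
have h4 : snorm G w * snorm G u <= e * snorm G u by rewrite ler_wpM2r.
have h5 := ler_wpM2l C0 h3; have h6 := ler_wpM2l C0 h4.
have -> : C * (2 * snorm G u + 1) * e = C * ((snorm G u + 1) * e) + C * (e * snorm G u) by ring.
by rewrite -addrA -[leRHS]add0r lerD// lerD// (le_trans h1, le_trans h2).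
Qed.

End QuadraticDensity.

Section Operator.
Context {R : realType} (p : @coefficients R).
Local Notation mu := (@lebesgue_measure R).
Local Notation I01 := `]0%R, 1%R[%classic.
Local Notation a := (ca p).
Local Notation b := (cb p).
Local Notation eta := (eta a b).
Local Notation sigma := (sigma a b).
Local Notation one := (fun=> 1 : R).
Local Notation H := (elt (L2sp p)).
Local Notation V := (elt (H1sp p)).
Local Notation nG := (snorm (@ipG R p)).
Local Notation nS := (snorm (@ipS R p)).
Implicit Types (g h phi rho : R -> R) (x s r e d c k m : R) (u v w z : V) (f : H).

(** [eta z'], so that [A z = sigma (flux z)']. *)
Definition flux z x := eta x * wderiv z x.

(** The operator as a relation: [f] represents [A z] up to equality almost
    everywhere.  Membership of [z] in [H^1_(1/sigma)] and of [f] in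
    [L^2_(1/sigma)] is part of their types. *)
Definition opArel z f := has_weak_deriv (flux z) /\
  {ae mu, forall x, x \in `]0, 1[ -> elt_val f x = opA a b z x}.

Lemma loc_integrable_wderiv (u : R -> R) : has_weak_deriv u -> loc_integrable (wderiv u).
Proof. by move=> /wderivP[]. Qed.

Lemma loc_integrable_flux z : loc_integrable (flux z).
Proof.
move=> c d c0 d1; apply: itg_mul_bounded => //.
- apply: measurable_funS (proj1 (eta_bw p)) => // x /=; rewrite !in_itv/= => /andP[cx xd].
  by rewrite (lt_le_trans c0 cx) (le_lt_trans xd d1).
- move=> x /=; rewrite in_itv/= => /andP[cx xd].
  have x01 : 0 <= x <= 1 by rewrite (le_trans (ltW c0) cx) (le_trans xd (ltW d1)).
  by rewrite ger0_norm ?(ltW (eta_gt0 p x))//; exact: max_eta_ub.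
- exact: (loc_integrable_wderiv (Vwd z)).
Qed.

Lemma opArel_affine c z f z' f' : opArel z f -> opArel z' f' -> opArel (c *: z + z') (c *: f + f').
Proof.
move=> [hz ez] [hz' ez'].
have h := weak_deriv_lin c (wderivP hz) (wderivP hz').
have ae : {ae mu, forall x, x \in `]0, 1[ ->
    c * flux z x + flux z' x = flux (c *: z + z') x}.
  apply: ae_imp (Vd_lin c z z') => x hx x01.
  by rewrite /flux hx//; ring.
have hw := weak_deriv_ae (@loc_integrable_flux (c *: z + z')) ae h.
have hw' : has_weak_deriv (flux (c *: z + z')) by eexists; exact: hw.
have au := weak_deriv_unique (wderivP hw') hw; split; first exact: hw'.
apply: (@filterS3 _ _ (ae_filter_ringOfSetsType mu)) ez ez' au => x h1 h2 h3 x01.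
rewrite /opA -/(flux (c *: z + z')) h3// elt_linE h1// h2// /opA.
by rewrite [RHS]mulrDr [X in _ = X + _]mulrCA.
Qed.

Lemma itg_isig_flux z f : opArel z f ->
  {ae mu, forall x, x \in `]0, 1[ -> elt_val f x * isig p x = wderiv (flux z) x}.
Proof.
move=> [_ ez]; apply: ae_imp ez => x h x01.
rewrite h// /opA -/(flux z) /isig mulrAC mulfV ?mul1r// gt_eqF// sigma_gt0//.
by apply: I01_oc; rewrite in_itv/= in x01.
Qed.

(** The definition of the weak derivative of the flux. *)
Lemma green_test z f phi (tphi : test_fun phi) : opArel z f ->
  ipS f (emb (mktest p tphi)) = - ipG z (mktest p tphi).
Proof.
move=> hz; have [hw _] := hz; have [_ ig gz] := wderivP hw.
have tphi' := test_derive tphi.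
have -> : ipS f (emb (mktest p tphi)) = \int[mu]_(x in I01) (wderiv (flux z) x * phi x).
  apply: itg_ae_eq => //.
  - apply: ae_imp (itg_isig_flux hz) => x h x01.
    by rewrite -h// mulrAC.
  - by apply: Lw_mul; [exact: isig_measurable|exact: isig_ge0|exact: HLw|exact: (HLw (emb _))].
  - exact: itg_test.
suff -> : ipG z (mktest p tphi) = \int[mu]_(x in I01) (flux z x * derive1 phi x).
  by rewrite gz// opprK.
have r0 := bw_ge0 (eta_bw p); have [mr _] := eta_bw p.
apply: itg_ae_eq => //.
- apply: ae_imp (test_wderiv tphi) => x h x01.
  by rewrite /= h// /flux; ring.
- by apply: Lw_mul => //; apply: (bw_Lw (eta_bw p)); exact: Vd.
- by apply: itg_test => //; exact: loc_integrable_flux.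
Qed.

Lemma nS_nG u : nS (emb u) <= Num.sqrt (cP p) * nG u.
Proof.
rewrite /snorm -sqrtrM ?cP_ge0//; apply: ler_wsqrtr; exact: poincare.
Qed.

Lemma green z f v : opArel z f -> ipS f (emb v) = - ipG z v.
Proof.
move=> hz; apply/eqP; rewrite -addr_eq0; apply/eqP.
apply: (linear_eq0 (G := @ipG R p) (l := fun v => ipS f (emb v) + ipG z v)
  (C := nS f * Num.sqrt (cP p) + nG z)).
- move=> u w; have -> : emb (u - w) = emb u - emb w by apply: val_inj.
  by rewrite (sipBr (ipS_inner p)) (sipBr (ipG_inner p)) opprD addrACA.
- move=> w; apply: le_trans (ler_normD _ _) _; rewrite mulrDl; apply: lerD.
    apply: le_trans (cauchy_schwarz (ipS_inner p) _ _) _.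
    by rewrite -mulrA ler_wpM2l ?snorm_ge0// nS_nG.
  exact: (cauchy_schwarz (ipG_inner p)).
- move=> e e0; have [phi [tphi h]] := test_dense_G v e0; exists (mktest p tphi) => //.
  by rewrite (green_test tphi hz) addrC subrr.
Qed.

(** Since [sigma = a / eta] and [eta' / eta = b / a]. *)
Lemma xsig_derive x : 0 < x < 1 -> is_derive x 1 (xsig p)
  (isig p x * (1 - x * derive1 a x / a x + x * b x / a x)).
Proof.
move=> x01; have /andP[x0 x1] := x01; have ax := a_gt0 p (I01_oc x01); have e0 := eta_gt0 p x.
have an : a x != 0 by rewrite gt_eqF.
have dV : is_derive x 1 (fun z : R => (a z)^-1) (- (a x) ^- 2 * derive1 a x).
  by apply: (is_deriveV an); exact: a_derive.
have h := is_deriveM (is_derive_id x 1) (is_deriveM (eta_derive p x01) dV).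
have -> : xsig p = (id \* (eta \* (fun z : R => (a z)^-1))).
  apply/funext => z; rewrite /xsig /Defs.sigma /=.
  by rewrite invfM invrK (mulrC (a z)^-1).
have E : (eta * (fun z : R => (a z)^-1)) x = eta x * (a x)^-1 by [].
apply: (is_derive_eq h); rewrite E /GRing.scale/= /isig /Defs.sigma; field.
by rewrite !gt_eqF.
Qed.

(** [2 phi phi' x / sigma] is [(phi ^ 2)' x / sigma]; an integration by parts leaves
    [- phi ^ 2 (x / sigma)'], and [(x / sigma)' >= (1 - M - K) / sigma]. *)
Lemma multiplier_test phi (tphi : test_fun phi) :
  2 * ipX (emb (mktest p tphi)) (mktest p tphi) <=
  - (1 - cM p - cK p) * ipS (emb (mktest p tphi)) (emb (mktest p tphi)).
Proof.
have [t2 d2] := test_sqr tphi; set v := mktest p tphi.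
pose q' x := isig p x * (1 - x * derive1 a x / a x + x * b x / a x).
have cq' x : 0 < x < 1 -> {for x, continuous q'}.
  move=> x01; have an : a x != 0 by rewrite gt_eqF// a_gt0// I01_oc.
  have cV : {for x, continuous (fun z : R => (a z)^-1)} by apply: cvgV => //; exact: a_continuous.
  apply: cvgM; first exact: isig_continuous.
  apply: cvgD; [apply: cvgB; [exact: cvg_cst|]|].
    by apply: cvgM => //; apply: cvgM; [exact: cvg_id|exact: a'_continuous].
  by apply: cvgM => //; apply: cvgM; [exact: cvg_id|exact: b_continuous].
have m1 := proj1 (xsig_bw p); have r0 := bw_ge0 (xsig_bw p).
have L1 := bw_Lw (xsig_bw p) (test_L2 (test_derive tphi)).
have L2 := bw_Lw (xsig_bw p) (Vd v); have L3 := bw_Lw (xsig_bw p) (Vone v).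
have -> : ipX (emb v) v = ipw (xsig p) phi (derive1 phi).
  by rewrite /ipX ipwC (ipw_ae m1 r0 (test_wderiv tphi))// ipwC.
have -> : 2 * ipw (xsig p) phi (derive1 phi) = - \int[mu]_(x in I01) (q' x * (phi x * phi x)).
  rewrite -(loc_ac_ibp (loc_ac_C1 xsig_derive cq') t2) d2 /ipw -RintegralZl//; last exact: Lw_mul.
  by apply: eq_Rintegral => x _; ring.
rewrite mulNr lerN2 /ipS /ipw -RintegralZl//; last by case: (HLw (emb v)).
apply: le_Rintegral => //.
- by apply: itgZ => //; case: (HLw (emb v)).
- by apply: itg_test => //; exact: loc_integrable_continuous.
move=> x /=; rewrite in_itv/= => x01; have /andP[x0 x1] := x01.
have ax := a_gt0 p (I01_oc x01).
have -> : (1 - cM p - cK p) * (phi x * phi x * isig p x) =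
  isig p x * (1 - cM p - cK p) * (phi x * phi x) by ring.
rewrite ler_wpM2r// -?expr2 ?sqr_ge0// /q' ler_wpM2l ?isig_ge0//.
have h1 : x * derive1 a x / a x <= cK p.
  rewrite ler_pdivrMr//; apply: le_trans (degK_bound p x01).
  by rewrite ler_wpM2l ?(ltW x0)// ler_norm.
have h2 : - cM p <= x * b x / a x.
  have := x_b_div_a p x01; rewrite -lerN2 => /le_trans; apply.
  rewrite -!mulrA -mulrN ler_wpM2l ?(ltW x0)// -mulNr ler_wpM2r ?invr_ge0 ?(ltW ax)//.
  by rewrite lerNl ler_normr lexx orbT.
lra.
Qed.

Lemma a1V_ge0 : 0 <= (a 1)^-1.
Proof. by rewrite invr_ge0 ltW// a1_gt0. Qed.

Lemma ipX_bounded f v : `|ipX f v| <= (1 + (a 1)^-1) * (nS f * nG v).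
Proof.
exact: (X_bounded (ipS_inner p) (ipG_inner p) a1V_ge0 (@ipXl R p) (@ipXr R p) (@ipX_young R p)).
Qed.

(** [multiplier_test] extended by density. *)
Lemma multiplier_V u : 2 * ipX (emb u) u <= - (1 - cM p - cK p) * ipS (emb u) (emb u).
Proof.
set k := 1 - cM p - cK p; rewrite mulNr -subr_le0 opprK.
pose B v w := 2 * ipX (emb v) w + k * ipS (emb v) (emb w).
set c := Num.sqrt (cP p).
have c0 : 0 <= c := sqrtr_ge0 _.
have a0 := a1V_ge0.
apply: (quadratic_le0 (ipG_inner p) (B := B) (C := 2 * (1 + (a 1)^-1) * c + `|k| * c ^+ 2)).
- move=> v w z; have e1 : emb (v + w) = emb v + emb w by apply: val_inj.
  rewrite /B e1 (sipDl (ipS_inner p)).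
  by have := ipXl 1 (emb v) (emb w) z; rewrite scale1r mul1r => ->; rewrite !mulrDr addrACA.
- move=> v w z; have e1 : emb (v + w) = emb v + emb w by apply: val_inj.
  rewrite /B e1 (sipDr (ipS_inner p)).
  by have := ipXr 1 v w (emb z); rewrite scale1r mul1r => ->; rewrite !mulrDr addrACA.
- by rewrite addr_ge0 ?mulr_ge0 ?addr_ge0 ?sqr_ge0.
- move=> v w; rewrite /B; apply: le_trans (ler_normD _ _) _; rewrite [leRHS]mulrDl; apply: lerD.
    rewrite normrM ger0_norm// -!mulrA ler_wpM2l//.
    apply: le_trans (ipX_bounded _ _) _; rewrite ler_wpM2l ?addr_ge0//.
    by rewrite mulrA ler_wpM2r ?snorm_ge0// nS_nG.
  rewrite normrM -mulrA ler_wpM2l//.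
  apply: le_trans (cauchy_schwarz (ipS_inner p) _ _) _.
  rewrite [c ^+ 2]expr2 [leRHS]mulrACA.
  by rewrite ler_pM ?snorm_ge0 ?nS_nG.
- move=> e e0; have [phi [tphi h]] := test_dense_G u e0; exists (mktest p tphi) => //.
  by have := multiplier_test tphi; rewrite mulNr -/k -subr_le0 opprK.
Qed.

Lemma ipD_test_ibp u phi (tphi : test_fun phi) :
  ipD u (mktest p tphi) = - ipw one u (derive1 (derive1 phi)).
Proof.
have m1 := @measurable_cst _ _ R R I01 1.
have L1 := test_L2 (test_derive tphi); have L2 := Vd (mktest p tphi).
have -> : ipD u (mktest p tphi) = ipw one (wderiv u) (derive1 phi).
  rewrite /ipD /Gw ipwC (ipw_ae m1 (@one_ge0 R) (test_wderiv tphi) L2 L1 (Vd u)); exact: ipwC.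
have [_ _ h] := wderivP (Vwd u).
have h1 := h _ (test_derive tphi).
rewrite /ipw (@eq_Rintegral _ _ _ mu _ (fun x => wderiv u x * derive1 phi x)); last by move=> x _; rewrite mulr1.
rewrite [in RHS](@eq_Rintegral _ _ _ mu _ (fun x => u x * derive1 (derive1 phi) x)); last by move=> x _; rewrite mulr1.
by rewrite h1 opprK.
Qed.

Definition cl := Num.sqrt (max_eta a b) * Num.sqrt (min_eta a b)^-1.

Lemma cl_ge0 : 0 <= cl.
Proof. by rewrite mulr_ge0// sqrtr_ge0. Qed.

Lemma max_eta_ge0 : 0 <= max_eta a b.
Proof. by rewrite (le_trans (ltW (eta_gt0 p 0)))// max_eta_ub// lexx ler01. Qed.

(** Against a test function the Dirichlet form is an integral of [u] times a second
    derivative, hence is continuous for [L^2]; so the functional [ipD u] is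
    bounded on test functions by the bound of the approximations. *)
Lemma lsc u m : (forall e, 0 < e -> exists r : V, nS (emb (u - r)) <= e /\ nG r <= m) ->
  nG u <= cl * m.
Proof.
move=> h; pose nD := snorm (@ipD R p); pose m' := Num.sqrt (min_eta a b)^-1 * m.
have [r0 [_ hr0]] := h 1 ltr01.
have m0 : 0 <= m' by rewrite mulr_ge0 ?sqrtr_ge0// (le_trans (snorm_ge0 _ _) hr0).
have hone := ipV_inner p (@one_bw R).
have hDG v : nD v <= Num.sqrt (min_eta a b)^-1 * nG v.
  by apply: snorm_le; [rewrite invr_ge0 ltW// min_eta_gt0|exact: ipD_le].
have [c c0 hc] := isig_one p.
have key phi (tphi : test_fun phi) : `|ipD u (mktest p tphi)| <= m' * nD (mktest p tphi).
  set ps := mktest p (test_derive (test_derive tphi)).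
  have C0 : 0 <= Num.sqrt c * snorm (ipV one) ps by rewrite mulr_ge0 ?sqrtr_ge0.
  apply: (le_addeps C0) => e e0; have [r [hr1 hr2]] := h e e0.
  have -> : ipD u (mktest p tphi) = ipD r (mktest p tphi) + - ipV one (u - r) ps.
    rewrite !ipD_test_ibp -opprD; congr (- _).
    by rewrite (sipBl hone) addrC subrK.
  apply: le_trans (ler_normD _ _) _; apply: lerD.
    apply: le_trans (cauchy_schwarz (ipD_inner p) _ _) _.
    rewrite ler_wpM2r ?snorm_ge0//; apply: le_trans (hDG r) _.
    by rewrite ler_wpM2l ?sqrtr_ge0.
  rewrite normrN; apply: le_trans (cauchy_schwarz hone _ _) _.
  rewrite mulrAC ler_wpM2r ?snorm_ge0//.
  apply: le_trans (_ : Num.sqrt c * nS (emb (u - r)) <= _); last by rewrite ler_wpM2l ?sqrtr_ge0.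
  rewrite /snorm -sqrtrM ?(ltW c0)//; apply: ler_wsqrtr.
  by have [_] := hc _ (HLw (emb (u - r))).
have hu : nD u <= m'.
  have [u0|u0] := eqVneq (nD u) 0; first by rewrite u0.
  have up : 0 < nD u by rewrite lt_def u0 snorm_ge0.
  rewrite -(ler_pM2r up) -expr2 (sqr_snorm (ipD_inner p)).
  have c1 : 0 <= m' + nD u by rewrite addr_ge0// ltW.
  apply: (le_addeps c1) => e e0; have [phi [tphi [h1 _]]] := test_dense u e0.
  set v := mktest p tphi in h1.
  have -> : ipD u u = ipD u v + ipD u (u - v).
    by rewrite -(sipDr (ipD_inner p)) addrC subrK.
  have k1 := le_trans (ler_norm _) (key _ tphi); rewrite -/v in k1.
  have k2 := le_trans (ler_norm _) (cauchy_schwarz (ipD_inner p) u (u - v)).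
  have k3 : nD v <= nD u + e.
    have := snormD (ipD_inner p) u (v - u).
    rewrite addrC subrK (snormB (ipD_inner p) v u) => /le_trans; apply.
    by rewrite lerD2l.
  have k4 := ler_wpM2l m0 k3; have k5 := ler_wpM2l (ltW up) h1.
  have -> : m' * nD u + (m' + nD u) * e = m' * (nD u + e) + nD u * e by ring.
  exact: (lerD (le_trans k1 k4) (le_trans k2 k5)).
rewrite /cl -mulrA; apply: le_trans (_ : Num.sqrt (max_eta a b) * nD u <= _).
  by apply: snorm_le; [exact: max_eta_ge0|exact: ipG_le].
by rewrite ler_wpM2l ?sqrtr_ge0.
Qed.

End Operator.

(** The functions need not belong to the energy spaces, so this is Cauchy-Schwarz in
    the space of all functions that are square integrable for [rho]. *)
Lemma ipw_cs {R : realType} (rho u v : R -> R) :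
  measurable_fun (`]0, 1[%classic : set R) rho -> (forall x, 0 < x < 1 -> 0 <= rho x) ->
  Lw rho u -> Lw rho v ->
  `|ipw rho u v| <= Num.sqrt (ipw rho u u) * Num.sqrt (ipw rho v v).
Proof.
move=> mr r0 hu hv.
pose E := @FunSpace R (Lw rho) (fun c u v => @Lw_lin R rho mr r0 c u v) (@Lw0 R rho).
pose F (f g : elt E) := ipw rho f g.
have hF : semi_inner F.
  split=> [c f g k|f g|f].
  - by apply: ipw_lin => //; [exact: (eltP f)|exact: (eltP g)|exact: (eltP k)].
  - exact: ipwC.
  - exact: ipw_ge0.
exact: (cauchy_schwarz hF (@mk R E u hu) (@mk R E v hv)).
Qed.

(** * The normal trace *)

Section Trace.
Context {R : realType} (p : @coefficients R).
Local Notation mu := (@lebesgue_measure R).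
Local Notation I01 := `]0%R, 1%R[%classic.
Local Notation a := (ca p).
Local Notation b := (cb p).
Local Notation eta := (eta a b).
Local Notation sigma := (sigma a b).
Local Notation one := (fun=> 1 : R).
Local Notation H := (elt (L2sp p)).
Local Notation V := (elt (H1sp p)).
Local Notation nG := (snorm (@ipG R p)).
Local Notation nS := (snorm (@ipS R p)).
Local Notation Cm := (max_eta a b / a 1).
Implicit Types (g h q phi rho : R -> R) (x s r e d c k m : R) (u v w z : V) (f : H).

Definition chi s x : R := if s <= x then 1 else 0.

Lemma chi_bw s : bounded_weight 1 (chi s).
Proof.
split; last by move=> x _; rewrite /chi; case: ifP => _; rewrite ?lexx ler01.
by apply: measurable_fun_if => //; apply: measurable_fun_ler.
Qed.

Lemma chi_sq s x : chi s x * chi s x = chi s x.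
Proof. by rewrite /chi; case: ifP => _; rewrite ?mulr1 ?mulr0. Qed.

Lemma chi_Lw s : Lw one (chi s).
Proof.
have [mc hc] := chi_bw s; split=> //.
apply: (itg_le _ _ _ (@itg_cst_oo R 0 1 1)) => //.
  by apply: measurable_funM => //; apply: measurable_funX.
move=> x _; rewrite mulr1 expr2 chi_sq /chi; case: ifP => _; rewrite ?normr1 ?normr0//.
Qed.

Lemma Rint_chi h s : 0 < s < 1 -> itg I01 h ->
  \int[mu]_(x in I01) (h x * chi s x) = \int[mu]_(x in `[s, 1]) h x.
Proof.
move=> /andP[s0 s1] ih.
rewrite -Rintegral_itv_bndo_bndc//; last first.
  apply: itgS (itg_oo_cc ih) => // x /=; rewrite !in_itv/= => /andP[sx /ltW ->].
  by rewrite (le_trans (ltW s0) sx).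
rewrite (@Rint_restrict R I01 `[s, 1[%classic)//.
- apply: eq_Rintegral => x /set_mem /=; rewrite in_itv/= => /andP[sx _].
  by rewrite /chi sx mulr1.
- by move=> x /=; rewrite !in_itv/= => /andP[sx ->]; rewrite (lt_le_trans s0).
- move=> x /=; rewrite !in_itv/= => /andP[x0 x1] /negP; rewrite x1 andbT => h1.
  by rewrite /chi (negbTE h1) mulr0.
Qed.

(** The mean of the flux over [[1 - d, 1]], as an integral over [(0, 1)] so that it is
    linear in [z] for every [d]. *)
Definition avg d z := d^-1 * ipw eta (wderiv z) (chi (1 - d)).

Lemma avgB d u v : avg d (u - v) = avg d u - avg d v.
Proof.
rewrite /avg -mulrBr; congr (_ * _).
have := ipw_wderiv_lin (-1) v u (eta_bw p) (chi_Lw (1 - d)).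
by rewrite scaleN1r addrC => ->; rewrite mulN1r addrC.
Qed.

Lemma avg_bounded d u : `|avg d u| <= `|d^-1| * Num.sqrt (max_eta a b) * nG u.
Proof.
rewrite /avg normrM -mulrA ler_wpM2l//.
have r0 := bw_ge0 (eta_bw p); have [mr _] := eta_bw p.
have hc := bw_Lw (eta_bw p) (chi_Lw (1 - d)).
apply: le_trans (ipw_cs mr r0 (bw_Lw (eta_bw p) (Vd u)) hc) _.
rewrite mulrC ler_wpM2r ?sqrtr_ge0//; apply: ler_wsqrtr.
apply: le_trans (bw_ipw (eta_bw p) (chi_Lw _)) _.
rewrite ler_piMr ?max_eta_ge0//.
apply: (@le_trans _ _ (\int[mu]_(x in I01) 1)); last by rewrite Rint_cst_oo// subr0 mulr1.
apply: le_Rintegral => //; [by case: (chi_Lw (1 - d))|exact: itg_cst_oo|].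
move=> x _; rewrite mulr1 chi_sq /chi; case: ifP => //.
Qed.

Lemma itg_L2 (u : R -> R) : Lw one u -> itg I01 u.
Proof.
move=> [mu_ iu]; apply: (itg_le _ _ _ (itgD _ iu (@itg_cst_oo R 0 1 1))) => // x _.
have := sqr_ge0 (`|u x| - 1); rewrite sqrrB1 real_normK ?num_real// mulr1 => h.
have := normr_ge0 (u x); lra.
Qed.

Lemma itg_flux z : itg I01 (flux z).
Proof.
apply: itg_mul_bounded; [by []|by case: (eta_bw p)| |by apply: itg_L2; exact: Vd].
move=> x /=; rewrite in_itv/= => x01.
by rewrite ger0_norm ?(ltW (eta_gt0 p x))//; apply: max_eta_ub; exact: I01_cc.
Qed.

Lemma avg_near z q c e d : 0 < d -> d <= 2^-1 -> itg `[1 - d, 1] q ->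
  {ae mu, forall x, x \in `]0, 1[ -> flux z x = q x} ->
  (forall s, 1 - d <= s <= 1 -> `|q s - c| <= e) -> `|avg d z - c| <= e.
Proof.
move=> d0 d2 iq fq hq; set s := 1 - d in iq hq *.
have d1 : d < 1 by rewrite (le_lt_trans d2)// invf_lt1// ltr1n.
have s01 : 0 < s < 1 by rewrite subr_gt0 d1 ltrBlDr ltrDl.
have s1 : s <= 1 by case/andP: s01 => _ /ltW.
rewrite /avg -/s; have -> : ipw eta (wderiv z) (chi s) = \int[mu]_(x in `[s, 1]) q x.
  transitivity (\int[mu]_(x in `[s, 1]) flux z x).
    rewrite -(Rint_chi s01 (itg_flux z)); apply: eq_Rintegral => x _.
    by rewrite /flux; ring.
  rewrite -Rint_itv_oo_cc//; last first.
    apply: itgS (itg_oo_cc (itg_flux z)) => // x /=; rewrite !in_itv/= => /andP[sx ->].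
    by case/andP: s01 => /ltW /le_trans ->.
  rewrite -[RHS]Rint_itv_oo_cc//.
  apply: itg_ae_eq => //.
  - apply: ae_imp fq => x h /= xs; apply: h.
    move: xs; rewrite !in_itv/= => /andP[sx ->]; rewrite andbT.
    by case/andP: s01 => /lt_trans ->.
  - apply: itgS (itg_flux z) => // x /=; rewrite !in_itv/= => /andP[sx ->].
    by case/andP: s01 => /lt_trans ->.
  - by apply: itgS iq => //; exact: subset_itv_oo_cc.
have ds : 1 - s = d by rewrite /s opprB addrC subrK.
have -> : d^-1 * \int[mu]_(x in `[s, 1]) q x - c = d^-1 * \int[mu]_(x in `[s, 1]) (q x - c).
  rewrite RintegralB//; last exact: itg_cst.
  by rewrite Rint_cst_cc// ds mulrBr (mulrC c) mulKf// gt_eqF.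
rewrite normrM gtr0_norm ?invr_gt0// mulrC ler_pdivrMr//.
rewrite -{1}ds -Rint_cst_cc//.
have iqc := itgB (measurable_itv _) iq (@itg_cst R s 1 c).
apply: le_trans (le_normr_Rintegral _ _) _ => //.
apply: le_Rintegral; [by []|exact: itg_norm|exact: itg_cst|].
by move=> x /=; rewrite in_itv/=; exact: hq.
Qed.

(** The derivative of the flux of [z] when [f] represents [A z]. *)
Definition rhs f x := elt_val f x * isig p x.

Lemma isig_le d x : 0 < d -> d <= x -> x < 1 -> isig p x <= Cm / d.
Proof.
move=> d0 dx x1; have x01 : 0 < x < 1 by rewrite (lt_le_trans d0).
rewrite ler_pdivlMr//; have [_ /(_ x x01)/andP[_ h]] := xsig_bw p; apply: le_trans h.
by rewrite /xsig mulrC ler_wpM2r// (isig_ge0 p).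
Qed.

Lemma itg_rhs f d : 0 < d -> itg `[d, 1] (rhs f).
Proof.
move=> d0; apply: itg_oo_cc.
have sub : `]d, 1[%classic `<=` (I01 : set R).
  by move=> x /=; rewrite !in_itv/= => /andP[dx ->]; rewrite (lt_trans d0).
have [mf iF] := HLw f; have mi := isig_measurable p.
apply: (itg_le _ _ _ (itgD _ (itgS _ _ sub iF) (@itg_cst_oo R d 1 (Cm / d)))) => //.
  by apply: measurable_funM => //; [exact: measurable_funS mf|exact: measurable_funS mi].
move=> x /= xd; have := sub x xd; rewrite /= in_itv/= => x01.
move: xd; rewrite in_itv/= => /andP[dx x1].
have i0 := isig_ge0 p x01; have i1 := isig_le d0 (ltW dx) x1.
rewrite normrM (ger0_norm i0); set F : R := elt_val f x.
have h0 := sqr_ge0 (`|F| - 1); rewrite sqrrB1 real_normK ?num_real// in h0.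
have h1 : `|F| <= F ^+ 2 + 1 by have := normr_ge0 F; lra.
by have := ler_wpM2r i0 h1; rewrite mulrDl mul1r => /le_trans; apply; rewrite lerD2l.
Qed.

(** The flux is an indefinite integral of [f / sigma], which is integrable away from
    [0]; this representative is continuous up to [1] and defines the trace. *)
Lemma flux_rep z f : opArel z f -> exists2 g,
  {ae mu, forall x, x \in `]0, 1[ -> flux z x = g x} &
  forall d, 0 < d -> d <= 2^-1 -> ac_on d 1 g (rhs f).
Proof.
move=> hz; have [hw _] := hz; have [iu ig gz] := wderivP hw.
have il : loc_integrable (rhs f).
  move=> c d c0 d1; apply: itgS (itg_rhs f c0) => // x /=; rewrite !in_itv/= => /andP[-> xd].
  by rewrite (le_trans xd (ltW d1)).
have hwd : weak_deriv (flux z) (rhs f).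
  split=> // phi tphi; rewrite gz//; congr (- _); apply: itg_ae_eq => //.
  - apply: ae_imp (itg_isig_flux hz) => x h x01.
    by rewrite -h.
  - exact: itg_test.
  - exact: itg_test.
have [k hk] := weak_deriv_primitive hwd.
exists (fun x => k + primitive (rhs f) x) => // d d0 d2; split; first exact: itg_rhs.
move=> x y dx xy y1; have /andP[_ h21] := @half01 R; have d21 : d <= (2^-1 : R) <= 1 by rewrite d2.
rewrite -(primitiveB d21 dx xy y1 (itg_rhs f d0)); ring.
Qed.

(** The constant of the rate in [istrace]: [1 / sigma <= 2 (x / sigma)] on
    [[1/2, 1]]. *)
Definition cA := Num.sqrt (2 * Cm).

(** Cauchy-Schwarz for the weight [1 / sigma], whose integral over [[s, 1]] is of
    order [1 - s]; this gives the rate of [istrace]. *)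
Lemma rhs_tail f s : 2^-1 <= s -> s < 1 ->
  `|\int[mu]_(x in `[s, 1]) rhs f x| <= cA * Num.sqrt (1 - s) * nS f.
Proof.
move=> s2 s1; have s0 : 0 < s by rewrite (lt_le_trans _ s2)// invr_gt0.
have s01 : 0 < s < 1 by rewrite s0.
have half0 : 0 < (2^-1 : R) by rewrite invr_gt0.
have mi := isig_measurable p; have i0 := isig_ge0 p.
have tb := trunc_bw p s0; have [mt _] := tb.
have mc : measurable_fun (I01 : set R) (chi s) by case: (chi_bw s).
have ich : itg I01 (fun x => chi s x * isig p x).
  have := bw_Lw tb (chi_Lw s) => -[_ h]; apply: itg_eq h => // x _.
  rewrite expr2 chi_sq /trunc_weight /chi; case: ifP => _; rewrite ?mul0r//.
have hc : Lw (isig p) (chi s).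
  by split=> //; apply: itg_eq ich => // x _; rewrite expr2 chi_sq.
have hf := HLw f.
have ir := itg_rhs f s0.
have -> : \int[mu]_(x in `[s, 1]) rhs f x = ipw (isig p) f (chi s).
  have e : \int[mu]_(x in `[s, 1[) (f x * chi s x * isig p x) = \int[mu]_(x in `[s, 1[) rhs f x.
    apply: eq_Rintegral => x /set_mem /=; rewrite in_itv/= => /andP[sx _].
    by rewrite /chi sx mulr1.
  rewrite -Rintegral_itv_bndo_bndc//; last first.
    by apply: itgS ir => // x /=; rewrite !in_itv/= => /andP[-> /ltW].
  rewrite -e; apply/esym; apply: Rint_restrict => //.
    by move=> x /=; rewrite !in_itv/= => /andP[sx ->]; rewrite (lt_le_trans s0).
  move=> x /=; rewrite !in_itv/= => /andP[x0 x1] /negP; rewrite x1 andbT => h1.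
  by rewrite /chi (negbTE h1) mulr0 mul0r.
apply: le_trans (ipw_cs mi i0 hf hc) _.
have C0 : 0 <= Cm := ltW (Cm_gt0 p); have C2 : 0 <= 2 * Cm by apply: mulr_ge0.
rewrite mulrC ler_wpM2r ?sqrtr_ge0// /cA -sqrtrM//.
apply: ler_wsqrtr.
have -> : 2 * Cm * (1 - s) = \int[mu]_(x in `[s, 1]) (2 * Cm) by rewrite Rint_cst_cc// ltW.
rewrite -(Rint_chi s01 (@itg_cst_oo R 0 1 (2 * Cm))).
apply: le_Rintegral => //.
- by case: hc.
- by apply: itgZ => //; apply: itg_L2; exact: chi_Lw.
move=> x /=; rewrite in_itv/= => /andP[x0 x1].
rewrite chi_sq mulrC /chi; case: ifPn => sx; last by rewrite !mulr0.
rewrite !mulr1; apply: le_trans (isig_le s0 sx x1) _.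
rewrite mulrC ler_wpM2r//.
by rewrite -[leRHS]invrK lef_pV2// posrE.
Qed.

(** [(x / eta)' = (1 - x b / a) / eta], because [eta' / eta = b / a]. *)
Lemma weight_ac d : 0 < d -> d <= 2^-1 -> ac_on d 1 (fun x => x / eta x)
  (fun x => (1 - x * b x / a x) / eta x).
Proof.
move=> d0 d2; have d1 : d < 1 by rewrite (le_lt_trans d2)// invf_lt1// ltr1n.
have sub : `[d, 1]%classic `<=` `[(0 : R), 1]%classic.
  by move=> x /=; rewrite !in_itv/= => /andP[dx ->]; rewrite (le_trans (ltW d0)).
have ce := continuous_subspaceW sub (@eta_within R p).
have cav := continuous_subspaceW sub (@ca_cont R p).
have cbv := continuous_subspaceW sub (@cb_cont R p).
have cid : {within `[d, 1], continuous (fun x : R => x)}.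
  by apply: continuous_subspaceT => x; exact: cvg_id.
have apos x : x \in `[d, 1] -> a x != 0.
  by rewrite in_itv/= => /andP[dx x1]; rewrite gt_eqF// a_gt0// (lt_le_trans d0).
have cw (k : R -> R) : {within `[d, 1], continuous k} ->
    forall x, x \in `[d, 1] -> k y @[y --> within `[d, 1] (nbhs x)] --> k x.
  by move=> /subspace_continuousP h x; exact: h.
have cei : {within `[d, 1], continuous (fun x => (eta x)^-1)}.
  apply/subspace_continuousP => x xd; apply: cvgV; last exact: cw.
  by rewrite gt_eqF// eta_gt0.
have cai : {within `[d, 1], continuous (fun x => (a x)^-1)}.
  by apply/subspace_continuousP => x xd; apply: cvgV; [exact: apos|exact: cw].
apply: ac_on_C1.
- by apply/subspace_continuousP => x xd; apply: cvgM; exact: cw.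
- apply/subspace_continuousP => x xd; apply: cvgM; last exact: cw.
  apply: cvgB; first exact: cvg_cst.
  by apply: cvgM; [apply: cvgM; exact: cw|exact: cw].
move=> x /andP[dx x1]; have x01 : 0 < x < 1 by rewrite (lt_trans d0).
have en : eta x != 0 by rewrite gt_eqF// eta_gt0.
have dV : is_derive x 1 (fun z : R => (eta z)^-1) (- (eta x) ^- 2 * (eta x * (b x / a x))).
  by apply: (is_deriveV en); exact: eta_derive.
have h := is_deriveM (is_derive_id x 1) dV; apply: (is_derive_eq h).
rewrite /GRing.scale/=; field.
by rewrite en gt_eqF// a_gt0// I01_oc.
Qed.

(** With [g] the continuous flux and [d = g 1 / eta 1], the product rule for
    [(x / eta) g ^ 2] on [[s, 1]] has a boundary term at [1] equal to
    [eta 1 * d ^ 2] and one at [s] of favourable sign.  The remaining integrand is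
    [2 x f z' / sigma + (1 - x b / a) eta z' ^ 2], and [x |b| / a <= M]. *)
Lemma trace_exists z f : opArel z f ->
  exists d, istrace (@ipS R p) (@ipG R p) (@ipX R p) avg (cM p) (eta 1) cA z f d.
Proof.
move=> hz; have [g gz gac] := flux_rep hz.
have e10 := eta_gt0 p 1; exists (g 1 / eta 1); split; last first.
  move=> r r0 r2.
  have r1 : r < 1 by rewrite (le_lt_trans r2)// invf_lt1// ltr1n.
  have -> : eta 1 * (g 1 / eta 1) = g 1 by rewrite mulrC mulfVK// gt_eqF.
  have ac1 : ac_on (1 - r) 1 g (rhs f).
    by apply: ac_onS (gac 2^-1 _ _) => //; rewrite ?invr_gt0//; lra.
  have lr : 1 - r <= 1 by rewrite lerBlDr lerDl ltW.
  apply: (avg_near r0 r2 _ gz).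
    by apply: itg_cont; exact: ac_on_continuous ac1.
  move=> s /andP[s1 s2]; rewrite -normrN opprB.
  have [_ acg] := ac1; rewrite acg//.
  move: s2; rewrite le_eqVlt => /predU1P[->|s2].
    have -> : \int[mu]_(x in `[(1 : R), 1]) rhs f x = 0 by rewrite set_itv1 Rintegral_set1.
    by rewrite normr0 !mulr_ge0 ?sqrtr_ge0.
  apply: le_trans (rhs_tail f _ s2) _; first lra.
  rewrite ler_wpM2r ?sqrtr_ge0// ler_wpM2l ?sqrtr_ge0//.
  by apply: ler_wsqrtr; lra.
pose k x := 2 * (elt_val f x * wderiv z x * xsig p x) + (1 - x * b x / a x) * (wderiv z x * wderiv z x * eta x).
have mx := proj1 (xsig_bw p); have x0 := bw_ge0 (xsig_bw p).
have iX := Lw_mul mx x0 (bw_Lw (xsig_bw p) (Hone f)) (bw_Lw (xsig_bw p) (Vd z)).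
have [_ iG] := bw_Lw (eta_bw p) (Vd z).
have mw : measurable_fun (I01 : set R) (fun x => 1 - x * b x / a x).
  apply: measurable_I01 => x x01; apply: cvgB; first exact: cvg_cst.
  have an : a x != 0 by rewrite gt_eqF// a_gt0// I01_oc.
  apply: cvgM; first by apply: cvgM; [exact: cvg_id|exact: b_continuous].
  by apply: cvgV => //; exact: a_continuous.
have wb x : 0 < x < 1 -> `|x * b x / a x| <= cM p.
  move=> x01; apply: le_trans (x_b_div_a p x01).
  have ax := a_gt0 p (I01_oc x01); have /andP[xp _] := x01.
  by rewrite !normrM (gtr0_norm xp) (gtr0_norm (_ : 0 < (a x)^-1)) ?invr_gt0.
have iW : itg I01 (fun x => (1 - x * b x / a x) * (wderiv z x * wderiv z x * eta x)).
  apply: (itg_mul_bounded (k := 1 + cM p)) => // x /=; rewrite in_itv/= => /wb h.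
  by apply: le_trans (ler_normB _ _) _; rewrite normr1 lerD2l.
have ik : itg I01 k by apply: itgD => //; exact: itgZ.
have low : 2 * ipX f z + (1 - cM p) * ipG z z <= \int[mu]_(x in I01) k x.
  rewrite /ipX /ipG /Gw /ipw -!RintegralZl// -RintegralD//; [|exact: itgZ|exact: itgZ].
  apply: le_Rintegral => //; first by apply: itgD => //; exact: itgZ.
  move=> x /=; rewrite in_itv/= => x01; rewrite /k lerD2l ler_wpM2r//.
    by rewrite mulr_ge0 ?(ltW (eta_gt0 p x))// -expr2 sqr_ge0.
  by rewrite lerD2l lerN2 (le_trans (ler_norm _) (wb x x01)).
rewrite lerBrDr; apply: le_trans low _.
apply: tail_le => // d d0 d2.
have d1 : d < 1 by rewrite (le_lt_trans d2)// invf_lt1// ltr1n.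
have acg := gac d d0 d2; have acw := weight_ac d0 d2.
have acgg := ac_on_prod (ltW d1) acg acg.
have := ac_on_mul (ltW d1) acw acgg.
set K := fun s : R => g s * g s * _ + _ => e.
have -> : \int[mu]_(x in `[d, 1]) k x = \int[mu]_(x in `[d, 1]) K x.
  have sub : `]d, 1[%classic `<=` (I01 : set R).
    by move=> x /=; rewrite !in_itv/= => /andP[dx ->]; rewrite (lt_trans d0).
  have iK : itg `[d, 1] K by case: (ac_on_prod (ltW d1) acw acgg).
  have ikd : itg `[d, 1] k.
    apply: itgS (itg_oo_cc ik) => // x /=; rewrite !in_itv/= => /andP[dx ->].
    by rewrite (le_trans (ltW d0)).
  rewrite -!Rint_itv_oo_cc//; apply: itg_ae_eq => //.
  - apply: ae_imp gz => x h xd.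
    have := sub x xd; rewrite /= in_itv/= => x01; have xi : x \in `]0, 1[ by rewrite in_itv.
    have {}h := h xi.
    rewrite /k /K -h /flux /rhs /xsig /isig; field.
    by rewrite !gt_eqF ?eta_gt0// ?sigma_gt0 ?a_gt0 ?I01_oc.
  - by apply: itgS ik.
  - by apply: itgS iK => //; exact: subset_itv_oo_cc.
rewrite -e div1r.
have -> : eta 1 * (g 1 / eta 1) ^+ 2 = (eta 1)^-1 * (g 1 * g 1).
  by field; rewrite gt_eqF.
rewrite lerBlDr lerDl -expr2; apply: mulr_ge0; last exact: sqr_ge0.
exact: (divr_ge0 (ltW d0) (ltW (eta_gt0 p d))).
Qed.

End Trace.

(** * Solutions as abstract evolutions *)

Section Translation.
Context {R : realType} (p : @coefficients R).
Local Notation mu := (@lebesgue_measure R).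
Local Notation I01 := `]0%R, 1%R[%classic.
Local Notation a := (ca p).
Local Notation b := (cb p).
Local Notation eta := (eta a b).
Local Notation sigma := (sigma a b).
Local Notation one := (fun=> 1 : R).
Local Notation H := (elt (L2sp p)).
Local Notation V := (elt (H1sp p)).
Local Notation nG := (snorm (@ipG R p)).
Local Notation nS := (snorm (@ipS R p)).
Local Notation Cm := (max_eta a b / a 1).
Implicit Types (g h q phi rho : R -> R) (x s t r e d c k m T : R) (u v w z : V) (f : H).

Lemma sqnormL2wE (u : R -> R) : Lw (isig p) u -> sqnormL2w a b u = (ipw (isig p) u u)%:E.
Proof. exact: EFin_ipw. Qed.

Lemma L2wE (u : R -> R) : L2w a b u <-> Lw (isig p) u.
Proof.
split=> [[[mu_ _] h]|h].
  exact/(Lw_lty (isig_measurable p) (isig_ge0 p) mu_).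
split; last by rewrite sqnormL2wE// ltry.
by apply/L2_onE; have [c _ hc] := isig_one p; case: (hc u h).
Qed.

Lemma H1wE (u : R -> R) : H1w a b u <-> Lw (isig p) u /\ H10 u.
Proof. by split=> -[/L2wE]. Qed.

Lemma sqnormH1wE u : sqnormH1w a b u = (ipS (emb u) (emb u) + ipD u u)%:E.
Proof.
rewrite /sqnormH1w (sqnormL2wE (HLw (emb u))) EFinD; congr (_ + _)%E.
rewrite -(EFin_ipw (Vd u)); apply: eq_integral => x _; by rewrite mulr1.
Qed.

Lemma asV_subproof (u : R -> R) : exists v : V, H1w a b u -> elt_val v = u.
Proof.
have [h|h] := pselect (H1w a b u); last by exists 0.
by exists (@mk R (H1sp p) u (proj1 (H1wE u) h)).
Qed.

Lemma asH_subproof (u : R -> R) : exists f : H, L2w a b u -> elt_val f = u.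
Proof.
have [h|h] := pselect (L2w a b u); last by exists 0.
by exists (@mk R (L2sp p) u (proj1 (L2wE u) h)).
Qed.

(** Elements of the spaces with a prescribed underlying function; the value is
    arbitrary for a function outside the space.  Choice keeps the conversion
    checker from comparing membership proofs. *)
Definition asV (u : R -> R) : V := sval (cid (asV_subproof u)).
Definition asH (u : R -> R) : H := sval (cid (asH_subproof u)).

Lemma asVE (u : R -> R) : H1w a b u -> elt_val (asV u) = u.
Proof. exact: (svalP (cid (asV_subproof u))). Qed.

Lemma asHE (u : R -> R) : L2w a b u -> elt_val (asH u) = u.
Proof. exact: (svalP (cid (asH_subproof u))). Qed.

Lemma cvg0_lt (F : set_system R) (f : R -> \bar R) (e : R) : Filter F -> f x @[x --> F] --> 0%E -> 0 < e ->
  \forall x \near F, (f x < e%:E)%E.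
Proof. by move=> FF cf e0; have := cf _ (@nbhs_open_ereal_lt _ 0 (fun=> e) e0). Qed.

Lemma near_within_ge0 t (P : R -> Prop) : (\forall s \near within `[0, +oo[ (nbhs t), P s) ->
  exists2 d : R, 0 < d & forall s, 0 <= s -> `|s - t| < d -> P s.
Proof.
move=> [d /= d0 hd]; exists d => // s s0 st; apply: hd; rewrite /= ?in_itv/= ?s0//.
by rewrite distrC.
Qed.

Lemma near_within_ge0' t (P : R -> Prop) : (\forall s \near within `[0, +oo[ t^', P s) ->
  exists2 d : R, 0 < d & forall s, 0 <= s -> s != t -> `|s - t| < d -> P s.
Proof.
move=> [d /= d0 hd]; exists d => // s s0 sn st; apply: hd; rewrite /= ?in_itv/= ?s0//.
by rewrite distrC.
Qed.

Lemma snorm_le_sq (E : lmodType R) (B : E -> E -> R) (u : E) e : 0 <= e -> B u u <= e ^+ 2 -> snorm B u <= e.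
Proof.
by move=> e0 h; rewrite -(ger0_norm e0) -sqrtr_sqr; exact: ler_wsqrtr.
Qed.

Section Mild.
Variables (y0 y1 : R -> R) (y : R -> R -> R).
Hypothesis my : mild_solution a b y0 y1 y.

Lemma time_derivP t : 0 <= t -> L2w a b (time_deriv a b y t) /\
  curve_deriv (sqnormL2w a b) y t (time_deriv a b y t).
Proof.
have [_ [[_ h _] _] _ _] := my; move=> /h hv.
exact: (xgetPex 0 hv).
Qed.

Definition state t : V := asV (y t).
Definition velocity t : H := asH (time_deriv a b y t).

Lemma stateE t : 0 <= t -> elt_val (state t) = y t.
Proof. by have [_ [_ [h _]] _ _] := my => /h; exact: asVE. Qed.

Lemma velocityE t : 0 <= t -> elt_val (velocity t) = time_deriv a b y t.
Proof. by move=> /time_derivP[h _]; exact: asHE. Qed.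

Lemma y0E : elt_val (asV y0) = y0. Proof. by have [[h _] _ _ _] := my; exact: asVE. Qed.
Lemma y1E : elt_val (asH y1) = y1. Proof. by have [[_ h] _ _ _] := my; exact: asHE. Qed.

Lemma velocity_cderiv : cderiv nS ((@emb R p) \o state) velocity.
Proof.
move=> t t0 e e0; have [_ dy] := time_derivP t0.
have e2 : 0 < e ^+ 2 by rewrite exprn_gt0.
have [d d0 hd] := near_within_ge0' (cvg0_lt _ dy e2); exists d => // s s0 st.
have [->|sn] := eqVneq s t.
  by rewrite !subrr scale0r subr0 normr0 mulr0 (snorm0 (ipS_inner p)).
have {}hd := hd s s0 sn st.
have sn0 : s - t != 0 by rewrite subr_eq0.
pose f := (s - t)^-1 *: (emb (state s) - emb (state t)) - velocity t.
have ef : elt_val f = (fun x => (y s x - y t x) / (s - t) - time_deriv a b y t x).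
  apply/funext => x; rewrite -(stateE s0) -(stateE t0) -(velocityE t0).
  by rewrite mulrC.
have hf : nS f <= e.
  apply: snorm_le_sq; first exact: ltW.
  by move: hd; rewrite -ef (sqnormL2wE (HLw f)) lte_fin => /ltW.
rewrite [X in nS X](_ : _ = (s - t) *: f); last first.
  by rewrite /f scalerBr scalerA mulfV// scale1r.
by rewrite (snormZ (ipS_inner p)) mulrC ler_wpM2r.
Qed.

Lemma state_ccont : ccont nG state.
Proof.
have [_ [_ [_ cy]] _ _] := my.
move=> t t0 e e0.
have mp : 0 < max_eta a b by rewrite (lt_le_trans (eta_gt0 p 0))// max_eta_ub// lexx ler01.
have e2 : 0 < e ^+ 2 / max_eta a b by rewrite divr_gt0// exprn_gt0.
have [d d0 hd] := near_within_ge0 (cvg0_lt _ (cy t t0) e2); exists d => // s s0 st.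
apply: snorm_le_sq; first exact: ltW.
apply: le_trans (ipG_le _) _; rewrite mulrC -ler_pdivlMr//.
have ef : elt_val (state s - state t) = (fun x => y s x - y t x).
  by apply/funext => x; rewrite -(stateE s0) -(stateE t0).
have := hd s s0 st; rewrite -ef sqnormH1wE lte_fin => /ltW; apply: le_trans.
by rewrite lerDr (sip_ge0 (ipS_inner p)).
Qed.

Lemma velocity_ccont : ccont nS velocity.
Proof.
have [_ [[_ _ cv] _] _ _] := my.
move=> t t0 e e0; have e2 : 0 < e ^+ 2 by rewrite exprn_gt0.
have [d d0 hd] := near_within_ge0 (cvg0_lt _ (cv t t0) e2); exists d => // s s0 st.
apply: snorm_le_sq; first exact: ltW.
have ef : elt_val (velocity s - velocity t) = (fun x => time_deriv a b y s x - time_deriv a b y t x).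
  by apply/funext => x; rewrite -(velocityE s0) -(velocityE t0).
by have := hd s s0 st; rewrite -ef (sqnormL2wE (HLw _)) lte_fin => /ltW.
Qed.

(** The integrals in the definition of a mild solution, for all times at once. *)
Lemma primitive_exists : exists w : R -> V, forall t, 0 <= t ->
  riemann (@emb R p) (@ipS R p) state t (w t) /\ opArel (w t) (velocity t - asH y1).
Proof.
have [_ _ _ hw] := my.
suff hc : forall t, exists w : V, 0 <= t ->
    riemann (@emb R p) (@ipS R p) state t w /\ opArel w (velocity t - asH y1).
  by have [w h] := boolp.choice hc; exists w.
move=> t; have [t0|t0] := leP 0 t; last by exists 0.
have [w [iw dw ew]] := hw t t0; exists (asV w) => _.
have [hw1 hw2 hw3] := dw; have wE := asVE hw1.
split.
  move=> e e0; have e2 : 0 < e ^+ 2 by rewrite exprn_gt0.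
  have [d d0 hd] := iw _ e2; exists d => // n q xi q0 qn hq.
  apply: snorm_le_sq; first exact: ltW.
  have xi0 i : (i < n)%N -> 0 <= xi i.
    have q0' j : (j <= n)%N -> 0 <= q j.
      elim: j => [|j IH] jn; first by rewrite q0.
      have [/andP[h1 h2] _] := hq j jn; exact: le_trans (IH (ltnW jn)) (le_trans h1 h2).
    by move=> ni; have [/andP[h1 h2] _] := hq i ni; apply: le_trans h1; apply: q0'; exact: ltnW.
  have ef : elt_val (emb (asV w - \sum_(i < n) (q i.+1 - q i) *: state (xi i))) =
      (fun x => w x - \sum_(i < n) (q i.+1 - q i) * y (xi i) x).
    apply/funext => x; rewrite -[in RHS]wE /=.
    rewrite [LHS](_ : _ = elt_val (asV w) x - elt_val (\sum_(i < n) (q i.+1 - q i) *: state (xi i)) x)//.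
    congr (_ - _).
    have : forall m : nat, (m <= n)%N -> elt_val (\sum_(i < m) (q i.+1 - q i) *: state (xi i)) x =
        \sum_(i < m) (q i.+1 - q i) * y (xi i) x.
      elim=> [|m IH] mn; first by rewrite !big_ord0.
      by rewrite !big_ord_recr/= -(IH (ltnW mn)) -(stateE (xi0 m mn)).
    exact.
  by have := hd n q xi q0 qn hq; rewrite -ef (sqnormL2wE (HLw _)) lte_fin => /ltW.
split; first by rewrite /flux wE.
apply: ae_imp ew => x h x01.
rewrite elt_subE (velocityE t0) y1E h// wE; ring.
Qed.

Lemma mild_evolution : exists w : R -> V,
  [/\ evolution (@emb R p) (@opArel R p) (@ipS R p) (@ipG R p) w state velocity,
      forall t, 0 <= t -> riemann (@emb R p) (@ipS R p) state t (w t) &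
      opArel (w 0) (velocity 0 - asH y1)].
Proof.
have [w hw] := primitive_exists; exists w; split.
- split.
  + apply: (riemann_cderiv (iota := (@emb R p)) (cl := cl p) (ipS_inner p) (ipG_inner p) (cl_ge0 p)).
    * exact: lsc.
    * exact: state_ccont.
    * by move=> t /hw[].
  + exact: velocity_cderiv.
  + exact: state_ccont.
  + exact: velocity_ccont.
  + move=> s t s0 t0; have [_ hs] := hw s s0; have [_ ht] := hw t t0.
    have := opArel_affine (-1) hs ht.
    by rewrite !scaleN1r opprB addrC [in X in opArel _ X]addrC addrA subrK.
- by move=> t /hw[].
- by have [] := hw 0 (lexx 0).
Qed.

(** The primitive [w 0] is the limit of empty Riemann sums, hence null; then [A (w 0)]
    is orthogonal to test functions by [green], and it equals
    [velocity 0 - y1]. *)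
Lemma velocity0 : {ae mu, forall x, x \in `]0, 1[ -> time_deriv a b y 0 x = y1 x}.
Proof.
have [w [_ rw w0]] := mild_evolution.
have nw : nS (emb (w 0)) = 0.
  apply/eqP; rewrite eq_le snorm_ge0 andbT; apply/ler_addgt0Pl => e e0; rewrite addr0.
  have [d d0 hd] := rw 0 (lexx 0) e e0.
  have h0 := hd 0%N (fun=> 0) (fun=> 0) erefl erefl.
  have h1 : w 0 - \sum_(i < 0) ((0 : R) - 0) *: state 0 = w 0 by rewrite big_ord0 subr0.
  by rewrite -h1; exact: h0.
have gw v : ipG (w 0) v = 0.
  apply: (snorm_null_sip (ipG_inner p)); rewrite /snorm.
  have := green (w 0) w0; rewrite (sipC (ipS_inner p)) (snorm_null_sip (ipS_inner p))// => h.
  by have -> : ipG (w 0) (w 0) = 0 by [apply/eqP; rewrite -oppr_eq0 -h]; rewrite sqrtr0.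
set f := velocity 0 - asH y1 in w0.
have il : loc_integrable (rhs f).
  move=> c d c0 d1; apply: itgS (itg_rhs f c0) => // x /=; rewrite !in_itv/= => /andP[-> xd].
  by rewrite (le_trans xd (ltW d1)).
have h := variation_eq0 il.
have {}h : {ae mu, forall x, x \in `]0, 1[ -> rhs f x = 0}.
  apply: h => phi tphi; have := green (mktest p tphi) w0; rewrite gw oppr0 => g0; rewrite -[RHS]g0.
  by apply: eq_Rintegral => x _; rewrite /rhs mulrAC.
apply: ae_imp h => x h x01.
have := h x01; rewrite /rhs => /eqP; rewrite mulf_eq0 => /orP[|i0]; last first.
  by move: x01; rewrite in_itv/= => /(isig_gt0 p); rewrite (eqP i0) ltxx.
rewrite /f elt_subE (velocityE (lexx 0)) y1E subr_eq0 => /eqP //.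
Qed.

Lemma nS_velocity0 : nS (velocity 0 - asH y1) = 0.
Proof.
have i0 := isig_ge0 p; have mi := isig_measurable p.
have L0 := @Lw0 R (isig p); have Lf := HLw (velocity 0 - asH y1).
have ae : {ae mu, forall x, x \in `]0, 1[ -> elt_val (velocity 0 - asH y1) x = 0}.
  apply: ae_imp velocity0 => x h x01.
  by rewrite elt_subE (velocityE (lexx 0)) y1E h// subrr.
rewrite /snorm /ipS (ipw_ae mi i0 ae Lf L0 Lf) /ipw.
rewrite (@eq_Rintegral _ _ _ mu _ (fun=> 0)); last by move=> x _; rewrite !mul0r.
by rewrite Rint_cst_oo// mul0r sqrtr0.
Qed.

Lemma wderiv_state0 : wderiv (y 0) = wderiv y0.
Proof.
have [[hy0 _] [_ [hy _]] ae _] := my.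
have := VH10 (state 0); rewrite (stateE (lexx 0)) => -[_ d1 _ _].
have := VH10 (asV y0); rewrite y0E => -[_ d2 _ _].
by apply: wderiv_ae => //; [case: (wderivP d1)|case: (wderivP d2)].
Qed.

Lemma ipS_velocity0 : ipS (velocity 0) (velocity 0) = ipS (asH y1) (asH y1).
Proof.
have h f : ipS (velocity 0) f = ipS (asH y1) f.
  apply/eqP; rewrite -subr_eq0 -(sipBl (ipS_inner p)); apply/eqP.
  by apply: (snorm_null_sip (ipS_inner p)); exact: nS_velocity0.
by rewrite h (sipC (ipS_inner p)) h.
Qed.

Lemma wderiv_asV0 : wderiv (state 0) = wderiv (asV y0).
Proof.
have e (u : V) (g : R -> R) : elt_val u = g -> wderiv u = wderiv g by move=> ->.
exact: etrans (e _ _ (stateE (lexx 0))) (etrans wderiv_state0 (esym (e _ _ y0E))).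
Qed.

Lemma ipG_state0 : ipG (state 0) (state 0) = ipG (asV y0) (asV y0).
Proof.
have e u v : wderiv u = wderiv v -> ipG u u = ipG v v by rewrite /ipG /Gw => ->.
exact: e wderiv_asV0.
Qed.

Lemma energy2_0 : energy2 (@ipS R p) (@ipG R p) (velocity 0) (state 0) =
  energy2 (@ipS R p) (@ipG R p) (asH y1) (asV y0).
Proof. exact: congr2 ipS_velocity0 ipG_state0. Qed.

(** The energy at time [0] depends on the data only, although [y 0] and the velocity
    agree with them only almost everywhere. *)
Lemma energy0 : energy a b y 0 =
  (2^-1 * energy2 (@ipS R p) (@ipG R p) (asH y1) (asV y0))%:E.
Proof.
have [_ iS] := HLw (velocity 0); have [_ iG] := bw_Lw (eta_bw p) (Vd (state 0)).
rewrite /energy EFinM; congr (_ * _)%E.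
rewrite -energy2_0 /energy2 /ipS /ipG /Gw /ipw -RintegralD//.
rewrite -EFin_Rintegral//; last exact: itgD.
apply: eq_integral => x _; congr EFin.
by rewrite (velocityE (lexx 0)) (stateE (lexx 0)) /isig !expr2 (mulrC (eta x)).
Qed.

Lemma opArel_y0 : domA a b y0 -> exists f, opArel (state 0) f.
Proof.
move=> [_ h1 h2]; exists (asH (opA a b y0)); split.
  by rewrite /flux (stateE (lexx 0)) wderiv_state0.
by apply: aeW => x _; rewrite (asHE h2) (stateE (lexx 0)) /opA wderiv_state0.
Qed.

(** Two representatives of the weak derivative agree almost everywhere, so [eta g] is a
    continuous representative of the flux and its means tend to its value
    at [1]. *)
Lemma normal_deriv_avg t d : 0 <= t -> normal_deriv_at1 (y t) d -> forall e, 0 < e ->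
  exists2 d0 : R, 0 < d0 & forall r, 0 < r -> r < d0 -> `|avg r (state t) - eta 1 * d| <= e.
Proof.
move=> t0 [g [ug cg <-]] e e0.
have iuq := weak_deriv_unique (wderivP (Vwd (state t))).
have {}iuq : {ae mu, forall x, x \in `]0, 1[ -> wderiv (state t) x = g x}.
  by apply: iuq; rewrite (stateE t0).
pose q x := eta x * g x.
have sub : `]0, 1]%classic `<=` `[(0 : R), 1]%classic by exact: subset_itv_oc_cc.
have ce := continuous_subspaceW sub (@eta_within R p).
have cq : {within `]0, 1], continuous q}.
  apply/subspace_continuousP => x xd; apply: cvgM.
    by move/subspace_continuousP : ce; exact.
  by move/subspace_continuousP : cg; exact.
have /subspace_continuousP/(_ 1) := cq.
have oc1 : (1 : R) \in `]0, 1] by rewrite in_itv/= ltr01 lexx.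
move=> /(_ oc1) /cvgrPdist_lt /(_ e e0) [d0 /= d00 hd].
exists (Num.min d0 2^-1); first by rewrite lt_min d00 invr_gt0 ltr0n.
move=> r r0; rewrite lt_min => /andP[rd r2].
have r1 : r < 1 by rewrite (lt_trans r2)// invf_lt1// ltr1n.
have near s : 1 - r <= s <= 1 -> s \in `]0, 1].
  by move=> /andP[s1 s2]; rewrite in_itv/= s2 andbT (lt_le_trans _ s1)// subr_gt0.
apply: (avg_near (q := q)) => //.
- exact: ltW.
- apply: itg_cont; apply: continuous_subspaceW cq => s /=; rewrite in_itv/= => h.
  exact: near.
- apply: ae_imp iuq => x h x01.
  by rewrite /flux h.
- move=> s h; rewrite distrC; apply/ltW; apply: hd; last exact: near.
  move: h => /andP[s1 s2] /=; rewrite ger0_norm ?subr_ge0//.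
  by apply: le_lt_trans rd; lra.
Qed.

End Mild.
End Translation.

(** * Passage to mild solutions *)

Section Limit.
Context {R : realType}.
Local Notation mu := (@lebesgue_measure R).
Implicit Types (e c k : R).

(** Absorbing form of the triangle inequality, for quadratic quantities. *)
Lemma sip_split (E : lmodType R) (S : E -> E -> R) (u v : E) e : semi_inner S -> 0 < e ->
  S u u <= (1 + e) * S v v + (1 + e^-1) * S (u - v) (u - v).
Proof.
move=> hS e0; have eu : u = v + (u - v) by rewrite addrC subrK.
rewrite [in leLHS]eu; move: (u - v) => w {eu}.
have h := sip_ge0 hS (e *: v - w).
rewrite (sipBl hS) !(sipBr hS) !(sipZl hS) !(sipZr hS) (sipC hS w v) in h.
rewrite (sipDl hS) !(sipDr hS) (sipC hS w v).
have ei : 0 < e^-1 by rewrite invr_gt0.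
have := mulr_ge0 (ltW ei) h; move: (S v v) (S v w) (S w w) {h} => x y z.
have -> : e^-1 * (e * (e * x) - e * y - (e * y - z)) = e * x - 2 * y + e^-1 * z.
  by field; rewrite gt_eqF.
move=> h; lra.
Qed.

Lemma sip_swap (E : lmodType R) (S : E -> E -> R) (u v : E) : semi_inner S ->
  S (u - v) (u - v) = S (v - u) (v - u).
Proof. by move=> hS; rewrite -(opprB v u) (sipNl hS) (sipNr hS) opprK. Qed.

Lemma sqrB_le (x y : R) : (x - y) ^+ 2 <= 2 * (x ^+ 2 + y ^+ 2).
Proof.
have -> : 2 * (x ^+ 2 + y ^+ 2) = (x - y) ^+ 2 + (x + y) ^+ 2 by ring.
by rewrite lerDl sqr_ge0.
Qed.

Lemma sqr_split (x y : R) e : 0 < e -> x ^+ 2 <= (1 + e) * y ^+ 2 + (1 + e^-1) * (x - y) ^+ 2.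
Proof.
move=> e0; have ei : 0 < e^-1 by rewrite invr_gt0.
have h := mulr_ge0 (ltW ei) (sqr_ge0 (e * y - (x - y))).
have h2 : e^-1 * (e * y - (x - y)) ^+ 2 = e * y ^+ 2 - 2 * (y * (x - y)) + e^-1 * (x - y) ^+ 2.
  by field; rewrite gt_eqF.
rewrite h2 in h; have h3 : x ^+ 2 = y ^+ 2 + 2 * (y * (x - y)) + (x - y) ^+ 2 by ring.
rewrite h3; lra.
Qed.

(** The bookkeeping of the limit: [En] and [In] are the energies and observations
    of approximations at distance [e] from [E0] and [I]. *)
Lemma limit_le (k e1 E0 I En In dE dI e : R) : 0 <= k -> 0 <= e1 -> 0 <= I -> 0 < e -> e <= 1 ->
  E0 <= (1 + e) * En + (1 + e^-1) * dE -> In <= (1 + e) * I + (1 + e^-1) * dI ->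
  dE <= e ^+ 2 -> dI <= e ^+ 2 -> k * En <= e1 * In ->
  k * E0 <= e1 * I + (3 * (e1 * I) + 4 * e1 + 2 * k) * e.
Proof.
move=> k0 e10 I0 e0 e11 hE hI hdE hdI hk.
have ei : 0 < 1 + e^-1 by rewrite addr_gt0// invr_gt0.
have tw : (1 + e^-1) * e ^+ 2 <= 2 * e.
  have -> : (1 + e^-1) * e ^+ 2 = e * e + e by field; rewrite gt_eqF.
  have := ler_wpM2l (ltW e0) e11; lra.
have {}hE : E0 <= (1 + e) * En + 2 * e.
  apply: le_trans hE _; rewrite lerD2l; apply: le_trans tw.
  by rewrite ler_wpM2l// ltW.
have {}hI : In <= (1 + e) * I + 2 * e.
  apply: le_trans hI _; rewrite lerD2l; apply: le_trans tw.
  by rewrite ler_wpM2l// ltW.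
have h1 := ler_wpM2l k0 hE; have h2 := ler_wpM2l e10 hI.
have h3 : (1 + e) * (k * En) <= (1 + e) * (e1 * ((1 + e) * I + 2 * e)).
  by rewrite ler_wpM2l ?addr_ge0 ?(ltW e0)//; exact: le_trans h2.
apply: le_trans h1 _.
have -> : k * ((1 + e) * En + 2 * e) = (1 + e) * (k * En) + 2 * k * e by ring.
have J0 : 0 <= e1 * I by apply: mulr_ge0.
have s1 : e * e <= e by rewrite ler_piMr// ltW.
have s2 := ler_wpM2r J0 s1; have s3 := ler_wpM2r e10 s1.
have -> : e1 * I + (3 * (e1 * I) + 4 * e1 + 2 * k) * e =
  e1 * I + 3 * (e * (e1 * I)) + 4 * (e * e1) + 2 * k * e by ring.
rewrite lerD2r; apply: le_trans h3 _.
have -> : (1 + e) * (e1 * ((1 + e) * I + 2 * e)) =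
  e1 * I + 2 * (e * (e1 * I)) + e * e * (e1 * I) + 2 * (e * e1) + 2 * (e * e * e1) by ring.
lra.
Qed.

Lemma L2_itg (D : set R) (f : R -> R) : measurable D -> L2_on D f -> itg D (fun x => f x ^+ 2).
Proof.
move=> mD [mf h]; apply/itg_ge0_lty => //; last by move=> x _; exact: sqr_ge0.
exact: measurable_funX.
Qed.

End Limit.

Section Main.
Context {R : realType} (p : @coefficients R).
Local Notation mu := (@lebesgue_measure R).
Local Notation I01 := `]0%R, 1%R[%classic.
Local Notation a := (ca p).
Local Notation b := (cb p).
Local Notation eta := (eta a b).
Implicit Types (tau : R -> R) (x t e c k T : R).

(** The constant subtracted from [T (2 - K - 2 M)] in the theorem. *)
Definition Bconst := 8 * Num.max 1 (Num.max (a 1)^-1 (cK p * max_eta a b / (a 1 * min_eta a b))).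
Local Notation E2 := (energy2 (@ipS R p) (@ipG R p)).

Lemma Bconst_gt0 : 0 < Bconst.
Proof. by rewrite mulr_gt0// lt_max ltr01. Qed.

(** Each of [1], [1 / a 1] and [K cP] is at most [Bconst / 8], and [K <= 1]. *)
Lemma Bconst_bound (s g : R) : 0 <= s -> 0 <= g ->
  s + (a 1)^-1 * g + cK p / 4 * (s + cP p * g) <= Bconst / 4 * (s + g).
Proof.
move=> s0 g0; rewrite /Bconst; set m := Num.max _ _.
have m1 : 1 <= m by rewrite le_max lexx.
have m2 : (a 1)^-1 <= m by rewrite !le_max lexx orbT.
have m3 : cK p * cP p <= m by rewrite /cP mulrA !le_max lexx !orbT.
have /andP[/ltW K0 K1] := cK_itv p.
have h1 := ler_wpM2r s0 m1; have h2 := ler_wpM2r g0 m2; have h3 := ler_wpM2r g0 m3.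
have h4 := ler_wpM2r s0 (le_trans K1 m1).
have -> : 8 * m / 4 * (s + g) = 2 * (m * s) + 2 * (m * g) by field.
have -> : s + (a 1)^-1 * g + cK p / 4 * (s + cP p * g) =
  s + (a 1)^-1 * g + (cK p * s) / 4 + (cK p * cP p * g) / 4.
  by field; rewrite gt_eqF// a1_gt0.
have hms := mulr_ge0 (le_trans ler01 m1) s0; have hmg := mulr_ge0 (le_trans ler01 m1) g0.
move: h1 h2 h3 h4 hms hmg; move: (cK p * s) (cK p * cP p * g) ((a 1)^-1 * g) (m * s) (m * g) => *.
lra.
Qed.

Lemma classical_observability T (y0 y1 : R -> R) (y : R -> R -> R) tau : 0 < T -> classical_solution a b y0 y1 y ->
  L2_on `]0, T[ tau -> (forall t, t \in `]0, T[ -> normal_deriv_at1 (y t) (tau t)) ->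
  (T * (2 - cK p - 2 * cM p) - Bconst) / 2 * E2 (asH p y1) (asV p y0) <=
    eta 1 * \int[mu]_(t in `]0, T[) (tau t ^+ 2).
Proof.
move=> T0 [my dy0 hy1] L2tau ntau.
have [w [ev rw _]] := mild_evolution my.
have [f0 Ay0] := opArel_y0 my dy0.
have /andP[/ltW K0 _] := cK_itv p.
have vy1 : snorm (@ipS R p) (velocity p y 0 - emb (asV p y1)) = 0.
  have -> : emb (asV p y1) = asH p y1.
    apply: val_inj => /=; rewrite (asVE hy1) (asHE _)//.
    by have [[_ h] _ _ _] := my.
  exact: nS_velocity0 my.
have cA0 : 0 <= cA p := sqrtr_ge0 _.
have cL0 (d : R) : 0 <= `|d^-1| * Num.sqrt (max_eta a b) by rewrite mulr_ge0// sqrtr_ge0.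
have tt t : 0 < t < T -> forall e, 0 < e -> exists2 d0 : R, 0 < d0 &
    forall d, 0 < d -> d < d0 -> `|avg d (state p y t) - eta 1 * tau t| <= e.
  move=> tT; apply: (normal_deriv_avg my); first by case/andP: tT => /ltW.
  by apply: ntau; rewrite in_itv.
have := evolution_observability (ipS_inner p) (ipG_inner p) (@opArel_affine R p) (@green R p)
  (cl_ge0 p) (@lsc R p) (a1V_ge0 p) (cP_ge0 p) (@ipXl R p) (@ipXr R p) (@ipX_young R p)
  (@poincare R p) K0 (eta_gt0 p 1) cA0 cL0 (@avgB R p) (fun d u _ _ => avg_bounded d u)
  (@multiplier_V R p) Bconst_bound (@trace_exists R p) ev rw Ay0 vy1 T0 (L2_itg _ L2tau) tt.
move=> /(_ (measurable_itv _)).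
by case: _ / (energy2_0 my).
Qed.

Lemma sqnormH0E (y0 y1 y0' y1' : R -> R) : H1w a b y0 -> L2w a b y1 -> H1w a b y0' -> L2w a b y1' ->
  sqnormH0 a b (fun x => y0' x - y0 x) (fun x => y1' x - y1 x) =
  (E2 (asH p y1 - asH p y1') (asV p y0 - asV p y0'))%:E.
Proof.
move=> h0 h1 h0' h1'.
rewrite /energy2 (sip_swap _ _ (ipS_inner p)) (sip_swap _ _ (ipG_inner p)) /sqnormH0 EFinD addeC; congr (_ + _)%E.
  rewrite -(EFin_ipw (HLw (asH p y1' - asH p y1))).
  by apply: eq_integral => x _; rewrite elt_subE !asHE.
rewrite -(EFin_ipw (bw_Lw (eta_bw p) (Vd (asV p y0' - asV p y0)))).
have eu : elt_val (asV p y0' - asV p y0) = (fun x => y0' x - y0 x).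
  apply/funext => x.
  exact: (congr2 (fun f g : R -> R => f x - g x) (asVE h0') (asVE h0)).
by rewrite eu; apply: eq_integral => x _; rewrite mulrC.
Qed.

(** The inequality for classical solutions passes to the limit of the data and of
    the traces. *)
Lemma mild_observability T (y0 y1 : R -> R) (y : R -> R -> R) tau : 0 < T -> 0 <= T * (2 - cK p - 2 * cM p) - Bconst ->
  mild_solution a b y0 y1 y -> normal_trace a b T y0 y1 tau ->
  (T * (2 - cK p - 2 * cM p) - Bconst) / 2 * E2 (asH p y1) (asV p y0) <=
    eta 1 * \int[mu]_(t in `]0, T[) (tau t ^+ 2).
Proof.
move=> T0 c0 my [L2tau [y0n [y1n [yn [taun [cl cH nd L2n ct]]]]]].
set c := _ - Bconst in c0 *; set I := Rintegral _ _ _.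
have mT : measurable (`]0, T[%classic : set R) by [].
have I0 : 0 <= I by apply: Rintegral_ge0 => t _; exact: sqr_ge0.
have e10 := ltW (eta_gt0 p 1).
have k0 : 0 <= c / 2 by rewrite divr_ge0.
have C0 : 0 <= 3 * (eta 1 * I) + 4 * eta 1 + 2 * (c / 2).
  by rewrite !addr_ge0 ?mulr_ge0.
have itau := L2_itg mT L2tau.
suff key e : 0 < e -> e <= 1 -> c / 2 * E2 (asH p y1) (asV p y0) <=
    eta 1 * I + (3 * (eta 1 * I) + 4 * eta 1 + 2 * (c / 2)) * e.
  apply: (le_addeps C0) => e e0.
  have em : 0 < Num.min e 1 by rewrite lt_min e0 ltr01.
  apply: le_trans (key _ em _) _; first by rewrite ge_min lexx orbT.
  by rewrite lerD2l ler_wpM2l// ge_min lexx.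
move=> e0 e1; have e2 : 0 < e ^+ 2 by rewrite exprn_gt0.
have [N1 _ h1] := cH _ (@nbhs_open_ereal_lt _ 0 (fun=> e ^+ 2) e2).
have [N2 _ h2] := ct _ (@nbhs_open_ereal_lt _ 0 (fun=> e ^+ 2) e2).
pose n := maxn N1 N2.
have {}h1 := h1 n (leq_maxl _ _); have {}h2 := h2 n (leq_maxr _ _).
have [mn _ _] := cl n.
have [[hy0 hy1] _ _ _] := my; have [[hn0 hn1] _ _ _] := mn.
have itn := L2_itg mT (L2n n).
have [mt _] := L2tau; have [mtn _] := L2n n.
have idiff : itg `]0, T[ (fun t => (taun n t - tau t) ^+ 2).
  apply: (itg_le _ _ _ (itgZ 2 mT (itgD mT itn itau))) => //.
    by apply: measurable_funX; exact: measurable_funB.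
  by move=> t _; rewrite ger0_norm ?sqr_ge0//; exact: sqrB_le.
move: h1 h2; rewrite /= (sqnormH0E hy0 hy1 hn0 hn1) (EFin_Rintegral mT idiff) !lte_fin.
move=> /ltW h1 /ltW h2.
apply: (limit_le k0 e10 I0 e0 e1 _ _ h1 h2 (classical_observability T0 (cl n) (L2n n) (nd n))).
  rewrite /energy2 !mulrDr addrACA; apply: lerD.
    exact: (sip_split _ _ (ipS_inner p) e0).
  exact: (sip_split _ _ (ipG_inner p) e0).
rewrite -!RintegralZl// -RintegralD//; [|exact: itgZ|exact: itgZ].
apply: le_Rintegral => //; first by apply: itgD => //; exact: itgZ.
by move=> t _; exact: sqr_split.
Qed.

Lemma observability T : cK p < 2 - 2 * cM p -> 1 / (2 - cK p - 2 * cM p) * Bconst < T ->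
  observable a b T /\
  ((1 / eta 1 * (T * (2 - cK p - 2 * cM p) - Bconst))%:E <= obs_constant a b T)%E.
Proof.
move=> KM BT; have k0 : 0 < 2 - cK p - 2 * cM p by lra.
have T0 : 0 < T by apply: lt_trans BT; rewrite div1r mulr_gt0 ?invr_gt0// Bconst_gt0.
have c0 : 0 < T * (2 - cK p - 2 * cM p) - Bconst.
  by rewrite subr_gt0 -ltr_pdivrMr// mulrC -div1r.
have e0 := eta_gt0 p 1.
set C := 1 / eta 1 * _.
have C0 : 0 < C by rewrite mulr_gt0// div1r invr_gt0.
have obs : obs_inequality a b T C.
  move=> y0 y1 y tau my nt; rewrite (energy0 my) -EFinM.
  have [L2tau _] := nt.
  rewrite (EFin_Rintegral _ (L2_itg _ L2tau))// lee_fin.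
  have h := mild_observability T0 (ltW c0) my nt.
  rewrite /C div1r -mulrA -[leRHS](mulKf (lt0r_neq0 e0)).
  rewrite ler_wpM2l ?invr_ge0 ?(ltW e0)//; apply: le_trans h.
  by rewrite mulrA.
split; first by split=> //; exists C.
by apply: ereal_sup_ubound; exists C.
Qed.

End Main.

Unset Implicit Arguments.

Theorem corollary3p1 (R : realType) (a b : R -> R) (T : R)
  (a_cont : {within `[0, 1], continuous a})
  (b_cont : {within `[0, 1], continuous b})
  (ba_int : (@lebesgue_measure R).-integrable `]0, 1[
              (fun x => (b x / a x)%:E))
  (a_deg : weakly_degenerate a \/ (strongly_degenerate a /\ degK a = 1%E)) :
  let K := fine (degK a) in
  let M := Linfty_norm b / a 1 in
  let B := 8 * Num.max 1 (Num.max (a 1)^-1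
                 (K * max_eta a b / (a 1 * min_eta a b))) in
  K < 2 - 2 * M ->
  1 / (2 - K - 2 * M) * B < T ->
  observable a b T /\
  ((1 / eta a b 1 * (T * (2 - K - 2 * M) - B))%:E <= obs_constant a b T)%E.
Proof. exact: (@observability R (Coefficients a_cont b_cont ba_int a_deg) T). Qed.
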